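(* Let $C,C_1,C_2,\ldots$ be strict $d$-dimensional Archimedean copulas and let $\ell\in\{1,\ldots,d-2\}$. If $(C_n)_{n\in\mathbb{N}}$ converges uniformly to $C$, then for every fixed $\mathbf{x}\in(0,1)^\ell$ the sequence of conditional copulas $(C_n^{\mathbf{x}})_{n\in\mathbb{N}}$ converges $(d-\ell-1)$-weakly conditional to $C^{\mathbf{x}}$. Furthermore, $$\lim_{n\to\infty}|\zeta_1^{\mathbf{x}}(C_n)-\zeta_1^{\mathbf{x}}(C)|=0.$$
   Context: $\mathbb{I}=[0,1]$. Archimedean copulas: a generator is a continuous, non-increasing function $\psi:[0,\infty)\to\mathbb{I}$ with $\psi(0)=1$, $\lim_{z\to\infty}\psi(z)=0$, strictly decreasing on $[0,\inf\{z\in[0,\infty]:\psi(z)=0\}]$ (with $\psi(\infty):=0$). $\varphi:(0,1]\to[0,\infty)$ denotes the pseudoinverse of $\psi$, and $\varphi(0):=\inf\{z\in[0,\infty]:\psi(z)=0\}\in(0,\infty]$. A $d$-dimensional copula $C$ is Archimedean with generator $\psi$ if $C(\mathbf{x})=\psi(\varphi(x_1)+\cdots+\varphi(x_d))$ for all $\mathbf{x}\in\mathbb{I}^d$; $C$ (and $\psi$) is strict if $\varphi(0)=\infty$. The right-hand side is a copula if and only if $\psi$ is $d$-monotone: $\psi$ is continuous on $[0,\infty)$, has derivatives $\psi^{(m)}$ up to order $d-2$ on $(0,\infty)$ with $(-1)^m\psi^{(m)}\ge0$ for $m=0,\ldots,d-2$, and $(-1)^{d-2}\psi^{(d-2)}$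 is non-increasing and convex on $(0,\infty)$. Generators are normalized so that $\psi(1)=\frac12$. Markov kernels: for a $k$-dimensional copula $A$ and $1\le m<k$, the $m$-Markov kernel $K_A:\mathbb{I}^m\times\mathcal{B}(\mathbb{I}^{k-m})\to\mathbb{I}$ is (a version of) the regular conditional distribution of the last $k-m$ coordinates given the first $m$ coordinates of a random vector with distribution function $A$. $A^{1:m}$ denotes the marginal copula of the first $m$ coordinates and $\mu_{A^{1:m}}$ the measure it induces on $\mathbb{I}^m$. For an Archimedean copula $A$ with generator $\psi$, pseudoinverse $\varphi$ and $\varphi(0)=\infty$, the version used is $K_A(\mathbf{s},[\mathbf{0},\mathbf{y}])=\psi^{(m)}\left(\sum_i\varphi(s_i)+\sum_j\varphi(y_j)\right)/\psi^{(m)}\left(\sum_i\varphi(s_i)\right)$ if $\min(\mathbf{s})\in(0,1)$ and $K_A(\mathbf{s},[\mathbf{0},\mathbf{y}])=1$ if $\min(\mathbf{s})\in\{0,1\}$; here $\psi^{(m)}(\infty):=0$ and, for $m=k-1$, $\psi^{(m)}$ means the left-hand derivative of $\psi^{(k-2)}$. Conditional copula: for strict $C$, $\ell\in\{1,\ldots,d-2\}$ and $\mathbf{x}\in(0,1)^\ell$, let $g_{\mathbf{x}}(y)=\psi^{(\ell)}\left(\sum_{i=1}^\ell\varphi(x_i)+\varphi(y)\right)/\psi^{(\ell)}\left(\sum_{i=1}^\ell\varphi(x_i)\right)$, $y\in\mathbb{I}$ (the common univariate marginal distribution function of $K_C(\mathbf{x},\cdot)$, an increasing bijection of $\mathbb{I}$).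 The conditional copula is $C^{\mathbf{x}}(\mathbf{u})=K_C(\mathbf{x},[0,g_{\mathbf{x}}^{-1}(u_1)]\times\cdots\times[0,g_{\mathbf{x}}^{-1}(u_{d-\ell})])$, $\mathbf{u}\in\mathbb{I}^{d-\ell}$; it is a strict $(d-\ell)$-dimensional Archimedean copula. Weak conditional convergence: $k$-dimensional copulas $A_n$ converge $m$-weakly conditional to $A$ if there is $\Lambda\in\mathcal{B}(\mathbb{I}^m)$ with $\mu_{A^{1:m}}(\Lambda)=1$ such that for every $\mathbf{s}\in\Lambda$ the probability measures $K_{A_n}(\mathbf{s},\cdot)$ on $\mathcal{B}(\mathbb{I}^{k-m})$ converge weakly to $K_A(\mathbf{s},\cdot)$. Dependence measure: for a $k$-dimensional copula $A$ with $k\ge2$, $\zeta_1^k(A)=3\int_{\mathbb{I}}\int_{\mathbb{I}^{k-1}}|K_A(\mathbf{s},[0,y])-y|\,\mathrm{d}\mu_{A^{1:k-1}}(\mathbf{s})\,\mathrm{d}\lambda(y)$, where $\lambda$ is Lebesgue measure and $K_A$ the $(k-1)$-Markov kernel. The conditional version is $\zeta_1^{\mathbf{x}}(C)=\zeta_1^{d-\ell}(C^{\mathbf{x}})$. *)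

(* Defs.v *)
From HB Require Import structures.
From mathcomp Require Import all_boot all_order all_algebra.
From mathcomp Require Import all_classical all_reals all_analysis.

Set Implicit Arguments.
Unset Strict Implicit.
Unset Printing Implicit Defensive.

Import Order.TTheory GRing.Theory Num.Theory.
Import numFieldNormedType.Exports.

Local Open Scope classical_set_scope.
Local Open Scope ring_scope.

(** Points of [R^n] are [n.-tuple R], with the product Borel sigma-algebra.
    Copulas are total functions [n.-tuple R -> R] of which only the values on
    [cube n] matter; probability measures on the cube are probability measures
    on [R^n] giving mass 1 to [cube n]. *)

Section cubes.
Context {R : realType}.

Definition cube (n : nat) : set (n.-tuple R) :=
  [set t | forall i, 0 <= tnth t i <= 1].

(* the box [0,u_1] x ... x [0,u_n] *)
Definition box (n : nat) (u : n.-tuple R) : set (n.-tuple R) :=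
  [set t | forall i, 0 <= tnth t i <= tnth u i].

End cubes.
Arguments cube {R} n.

Section copulas.
Context {R : realType}.

Definition induces (n : nat) (A : n.-tuple R -> R)
    (mu : probability (n.-tuple R) R) : Prop :=
  forall u, cube n u -> mu (box u) = (A u)%:E.

Definition copula (n : nat) (A : n.-tuple R -> R) : Prop :=
  exists2 mu : probability (n.-tuple R) R,
    (forall (i : 'I_n) (y : R), 0 <= y <= 1 ->
       mu [set t | 0 <= tnth t i <= y] = y%:E) &
    induces A mu.

(* [dirac origin] is only the default value used when no measure has the
   required values on boxes; such a measure is unique on [cube n]. *)
Definition origin (n : nat) : n.-tuple R := [tuple 0 | _ < n].

Definition copula_measure (n : nat) (A : n.-tuple R -> R) :
    probability (n.-tuple R) R :=
  xget (dirac (origin n) : probability _ R) [set mu | induces A mu].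

(* [A^{1:m}(u) = A(u_1, ..., u_m, 1, ..., 1)]: the default value of [nth] is 1 *)
Definition marginal (k m : nat) (A : k.-tuple R -> R) : m.-tuple R -> R :=
  fun u => A [tuple nth 1 u i | i < k].

End copulas.
Arguments marginal {R k} m A.

Section generators.
Context {R : realType}.

(* [f(oo) := 0] *)
Definition ext0 (f : R -> R) (z : \bar R) : R :=
  if z is r%:E then f r else 0.

(* On (0,1] this is the pseudoinverse of the generator [psi]; at 0 it is
   [inf {z in [0,oo] : psi z = 0}], which is [+oo] when [psi] has no zero. *)
Definition pinverse (psi : R -> R) (x : R) : \bar R :=
  ereal_inf [set z : \bar R | (0 <= z)%E /\ ext0 psi z = x].

Definition sum_pinverse (psi : R -> R) (n : nat) (u : n.-tuple R) : \bar R :=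
  (\sum_(i < n) pinverse psi (tnth u i))%E.

Record generator (psi : R -> R) : Prop := {
  generator_continuous : {within `[0, +oo[, continuous psi};
  generator_range : forall z : R, 0 <= z -> 0 <= psi z <= 1;
  generator_nonincreasing : forall z w : R, 0 <= z -> z <= w -> psi w <= psi z;
  generator_at0 : psi 0 = 1;
  generator_lim : psi z @[z --> +oo] --> 0;
  generator_decreasing : forall z w : R, 0 <= z -> z < w ->
    (w%:E <= pinverse psi 0)%E -> psi w < psi z;
  generator_normalized : psi 1 = 2^-1 }.

Definition strict_generator (psi : R -> R) : Prop := pinverse psi 0 = +oo%E.

Record monotone_of_order (d : nat) (psi : R -> R) : Prop := {
  monotone_continuous : {within `[0, +oo[, continuous psi};
  monotone_derivable : forall (m : nat) (z : R), (m < d - 2)%N -> 0 < z ->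
    derivable (derive1n m psi) z 1;
  monotone_sign : forall (m : nat) (z : R), (m <= d - 2)%N -> 0 < z ->
    0 <= (-1) ^+ m * derive1n m psi z;
  monotone_nonincreasing : forall z w : R, 0 < z -> z <= w ->
    (-1) ^+ (d - 2) * derive1n (d - 2) psi w <=
    (-1) ^+ (d - 2) * derive1n (d - 2) psi z;
  monotone_convex : convex_function (`]0, +oo[ : set R)
    (fun z => (-1) ^+ (d - 2) * derive1n (d - 2) psi z) }.

Definition has_generator (d : nat) (C : d.-tuple R -> R) (psi : R -> R) : Prop :=
  generator psi /\
  forall u, cube d u -> C u = ext0 psi (sum_pinverse psi u).

(* [monotone_of_order d psi] is implied by the other conditions (McNeil and
   Neslehova): a generator defines a d-copula iff it is d-monotone. *)
Definition strict_archimedean (d : nat) (C : d.-tuple R -> R) : Prop :=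
  copula C /\
  exists psi, [/\ has_generator C psi, strict_generator psi &
                 monotone_of_order d psi].

(* For [d >= 2] the normalized generator is unique on [[0, +oo[]; the constant
   is a default value for functions that are not Archimedean. *)
Definition generator_of (d : nat) (C : d.-tuple R -> R) : R -> R :=
  xget (fun=> 0) [set psi | has_generator C psi].

End generators.

Section kernels.
Context {R : realType}.

Definition left_derivative (f : R -> R) (z : R) : R :=
  lim (h^-1 * (f (z + h) - f z) @[h --> 0^'-]).

(* [psi^(m)] as it occurs in the [m]-Markov kernel of a [k]-copula: [psi] is
   only [k - 2] times differentiable, so for [m = k - 1] the left-hand
   derivative is used. *)
Definition kernel_derivative (k m : nat) (psi : R -> R) : R -> R :=
  if m == (k - 1)%N then left_derivative (derive1n (k - 2) psi)
  else derive1n m psi.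

(* [K_A(s, [0,y])] for the Archimedean [k]-copula [A], in the version of the
   regular conditional distribution that is fixed for every [s], not only for
   almost every [s]. *)
Definition kernel_df (k m : nat) (A : k.-tuple R -> R)
    (s : m.-tuple R) (y : (k - m).-tuple R) : R :=
  let psi := generator_of A in
  let dpsi := ext0 (kernel_derivative k m psi) in
  let min_s := \big[Num.min/1]_(i < m) tnth s i in
  if 0 < min_s < 1 then
    dpsi (sum_pinverse psi s + sum_pinverse psi y)%E / dpsi (sum_pinverse psi s)
  else 1.

(* the measure [K_A(s, .)], determined by its values on boxes *)
Definition markov_kernel (k m : nat) (A : k.-tuple R -> R) (s : m.-tuple R) :
    probability ((k - m).-tuple R) R :=
  xget (dirac (origin (k - m)) : probability _ R)
    [set P | induces (kernel_df A s) P].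

(* [f] is an arbitrary element of [C(I^n)]; the topology of [R^n] is that of
   row vectors. *)
Definition weak_cvg (n : nat) (P_ : nat -> probability (n.-tuple R) R)
    (P : probability (n.-tuple R) R) : Prop :=
  forall f : 'rV[R]_n -> R,
    {within [set v : 'rV[R]_n | forall i, 0 <= v ord0 i <= 1], continuous f} ->
    (\int[P_ j]_(t in cube n) (f (\row_i tnth t i))%:E)%E @[j --> \oo] -->
    (\int[P]_(t in cube n) (f (\row_i tnth t i))%:E)%E.

Definition weakly_conditional_cvg (k m : nat) (A_ : nat -> k.-tuple R -> R)
    (A : k.-tuple R -> R) : Prop :=
  exists L : set (m.-tuple R),
    [/\ measurable L, L `<=` cube m,
        copula_measure (marginal m A) L = 1%E &
        forall s, L s ->
          weak_cvg (fun j => markov_kernel (A_ j) s) (markov_kernel A s)].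

Definition zeta1 (k : nat) (A : k.-tuple R -> R) : R :=
  3 * fine (\int[lebesgue_measure]_(y in `[0%R, 1%R])
        \int[copula_measure (marginal (k - 1) A)]_(s in cube (k - 1))
          `| markov_kernel A s (box [tuple y | _ < k - (k - 1)]) - y%:E |)%E.

End kernels.

Section conditional.
Context {R : realType}.

(* the common univariate marginal distribution function [g_x] of [K_C(x, .)] *)
Definition cond_margin (d l : nat) (C : d.-tuple R -> R) (x : l.-tuple R)
    (y : R) : R :=
  let psi := generator_of C in
  ext0 (derive1n l psi) (sum_pinverse psi x + pinverse psi y)%E /
  ext0 (derive1n l psi) (sum_pinverse psi x).

Definition cond_copula (d l : nat) (C : d.-tuple R -> R) (x : l.-tuple R) :
    (d - l).-tuple R -> R :=
  let g_inv := 'pinv_(fun=> 0) `[0, 1] (cond_margin C x) in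
  fun u => kernel_df C x [tuple g_inv (tnth u i) | i < d - l].

Definition cond_zeta1 (d l : nat) (C : d.-tuple R -> R) (x : l.-tuple R) : R :=
  zeta1 (cond_copula C x).

End conditional.

(* Main.v *)
(* Pointwise convergence [C_n -> C] forces [phi_n -> phi]: iterating [C_n] on a
   point [u] determines [psi_n (q phi_n u)], and comparing [q phi_n u] with the
   integers [p = p phi_n (1/2)] pins down the limit. Hence [psi_n -> psi], and
   monotonicity of difference quotients upgrades this to
   [psi_n^(j) (z_n) -> psi^(j) (z)] for [z_n -> z] whenever [psi^(j)] is
   continuous at [z], including the left-hand derivative of order [d - 1].

   The conditional copula is Archimedean with the unnormalized generator
   [z |-> psi^(l)(sigma + z) / psi^(l)(sigma)], [sigma = \sum_i phi x_i]. Its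
   kernels are therefore quotients of one-sided derivatives of order [d - 1] of
   [psi], which converge off a countable set of arguments. The arguments
   [sigma + \sum_i tau s_i] in this countable set carry no mass, because in the
   coordinates [z_i = tau s_i] the marginal measure has the density
   [F m (\sum_i z_i)]. In the same coordinates [zeta1] becomes an integral of
   functions dominated by these densities, and Scheffe's argument gives its
   convergence. *)
Require Import Defs.
From HB Require Import structures.
From mathcomp Require Import all_boot all_order all_algebra.
From mathcomp Require Import all_classical all_reals all_analysis.
From mathcomp Require Import measurable_realfun zify ring lra.

Set Implicit Arguments.
Unset Strict Implicit.
Unset Printing Implicit Defensive.

Import Order.TTheory GRing.Theory Num.Theory.
Import numFieldNormedType.Exports.

Local Open Scope classical_set_scope.
Local Open Scope ring_scope.

(** * Monotone slopes *)

(** The derivative of top order exists only one-sidedly, so every order is handled through the chord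
    inequality [slopes]. It mentions no derivative, yet it yields monotonicity, continuity,
    positivity, decay and integrals. Consecutive orders satisfy it by the mean value theorem below
    the top and by convexity at the top. Sequences [z_ n] are unavoidable because the shift [sigma]
    and the inverse [tau] vary with [n]. Since [sigma > 0], the conditional generator lives on
    [(- sigma, oo)] and has finite derivatives at 0. Generators, kernels and copula measures are
    chosen by [xget], so each must be identified before use. Kernels exist by a quantile transform
    and marginal measures by an explicit density; both are unique by their values on boxes.
    Generators are unique by the convergence result itself, applied to a constant sequence.
    Conditioning on all but one coordinate leaves kernels on a segment, where weak convergence
    reduces to distribution functions. Their right-continuity is the left-continuity of the top
    derivative, because [tau] decreases. *)

Section slopes.
Context {R : realType}.
Implicit Types (a b : R) (G g : R -> R).

(* For a convex nonincreasing [G] this says that [- g] lies between the two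
   one-sided derivatives of [G] on [(a, oo)]. *)
Definition slopes a G g : Prop := forall z w, a < z -> z < w ->
  g w * (w - z) <= G z - G w <= g z * (w - z).

Lemma slopes_nonincreasing a G g z w : slopes a G g ->
  a < z -> z <= w -> g w <= g z.
Proof.
move=> S az; rewrite le_eqVlt => /predU1P[->//|zw].
have /andP[h1 h2] := S _ _ az zw.
by rewrite -(ler_pM2r (x := w - z)) ?subr_gt0// (le_trans h1).
Qed.

Lemma slopes_decreasing a G g z w : slopes a G g -> (forall z, a < z -> 0 < g z) ->
  a < z -> z < w -> G w < G z.
Proof.
move=> S g0 az zw; have /andP[h1 _] := S _ _ az zw.
by rewrite -subr_gt0 (lt_le_trans _ h1)// mulr_gt0 ?subr_gt0 ?g0 ?(lt_trans az).
Qed.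

(** A monotone [g] is bounded on a neighbourhood of [z] by its values at two outer points, so [G] is
    Lipschitz there with constant [K]. *)
Lemma slopes_continuous a G g z : slopes a G g -> a < z -> {for z, continuous G}.
Proof.
move=> S az; apply/cvgrPdist_lt => e e0.
pose y := (a + z) / 2.
have ay : a < y by rewrite /y; lra.
have yz : y < z by rewrite /y; lra.
pose K := `|g y| + `|g (z + 1)| + 1.
have K0 : 0 < K.
  by rewrite /K; have := normr_ge0 (g y); have := normr_ge0 (g (z + 1)); lra.
have bnd u : y < u -> u < z + 1 -> `|g u| <= K.
  move=> yu uz.
  have h1 := slopes_nonincreasing S ay (ltW yu).
  have h2 := slopes_nonincreasing S (lt_trans ay yu) (ltW uz).
  have := ler_norm (g y); have := ler_norm (- g (z + 1)); rewrite normrN.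
  have := normr_ge0 (g y); have := normr_ge0 (g (z + 1)).
  by rewrite ler_norml /K => ? ? ? ?; apply/andP; split; lra.
have lip u v : y < u -> u < v -> v < z + 1 -> `|G u - G v| <= K * (v - u).
  move=> yu uv vz.
  have /andP[h1 h2] := S _ _ (lt_trans ay yu) uv.
  have := bnd _ yu (lt_trans uv vz); have := bnd _ (lt_trans yu uv) vz.
  rewrite !ler_norml => /andP[? ?] /andP[? ?].
  have uv' : 0 < v - u by rewrite subr_gt0.
  apply/andP; split; nra.
near=> t.
have ht : `|z - t| < e / K.
  near: t; apply: (cvgrPdist_lt _ _).1 (divr_gt0 e0 K0); exact: cvg_id.
have yt : y < t by near: t; exact: lt_nbhsr.
have tz : t < z + 1 by near: t; apply: lt_nbhsl; lra.
rewrite ltr_pdivlMr// mulrC in ht.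
have [tz'|tz'|<-] := ltgtP z t; last by rewrite subrr normr0.
- apply: le_lt_trans ht; rewrite [`|z - t|]distrC.
  by rewrite (@gtr0_norm _ (t - z)) ?subr_gt0//; apply: lip.
- apply: le_lt_trans ht; rewrite distrC.
  by rewrite (@gtr0_norm _ (z - t)) ?subr_gt0//; apply: lip => //; lra.
Unshelve. all: by end_near. Qed.

(** If [g z <= 0], then [G w >= G z > 0] for every [w > z], which contradicts the limit 0. *)
Lemma slopes_pos a G g : slopes a G g -> (forall z, a < z -> 0 < G z) ->
  G z @[z --> +oo] --> 0 -> forall z, a < z -> 0 < g z.
Proof.
move=> S G0 Glim z az; rewrite ltNge; apply/negP => gz.
have := G0 _ az; move/cvgrPdist_lt : Glim => /[apply] -[M [Mr HM]].
pose w := Num.max (M + 1) (z + 1).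
have zw : z < w by rewrite /w lt_max; apply/orP; right; lra.
have Mw : M < w by rewrite /w lt_max; apply/orP; left; lra.
have := HM _ Mw; rewrite sub0r normrN gtr0_norm ?G0 ?(lt_trans az)//.
have /andP[_ h2] := S _ _ az zw.
have : g z * (w - z) <= 0 by rewrite mulr_le0_ge0// subr_ge0 ltW.
lra.
Qed.

Lemma slopes_cvg0 a G g : slopes a G g -> (forall z, a < z -> 0 < G z) ->
  G z @[z --> +oo] --> 0 -> g z @[z --> +oo] --> 0.
Proof.
move=> S G0 Glim; have g0 := slopes_pos S G0 Glim.
apply/cvgrPdist_lt => e e0.
move/cvgrPdist_lt : (Glim) => /(_ _ e0)[M [Mr HM]].
pose b := Num.max (M + 1) (a + 1).
have ab : a < b by rewrite /b lt_max; apply/orP; right; lra.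
have Mb : M < b by rewrite /b lt_max; apply/orP; left; lra.
(* The distance 1 from [b] turns [g z * (z - b) <= G b - G z < e] into [g z < e]. *)
exists (b + 1); split; first exact: num_real.
move=> z bz /=; rewrite sub0r normrN gtr0_norm ?g0//; last by lra.
have bz1 : b < z by lra.
have /andP[h1 _] := S _ _ ab bz1.
have := HM _ Mb; rewrite sub0r normrN gtr0_norm ?G0//.
have := G0 z (lt_trans ab bz1); have := g0 z (lt_trans ab bz1) => ? ? ?.
nra.
Qed.

(** By monotonicity [g_ n (z_ n)] lies between the chord slopes of [G_ n] over [[z + h, z + 2h]] and
    [[z - 2h, z - h]]. These converge to chord slopes of [G], which lie between [g (z + 2h)] and
    [g (z - 2h)], both close to [g z] by continuity. *)
Lemma slopes_moving_cvg (G_ g_ : nat -> R -> R) G g (z_ : nat -> R) (z : R) :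
  (forall n, slopes 0 (G_ n) (g_ n)) -> slopes 0 G g ->
  (forall z, 0 < z -> G_ n z @[n --> \oo] --> G z) ->
  0 < z -> z_ n @[n --> \oo] --> z -> {for z, continuous g} ->
  g_ n (z_ n) @[n --> \oo] --> g z.
Proof.
move=> S_ S GG z0 zz gz; apply/cvgrPdist_lt => e e0.
have e20 : 0 < e / 2 by lra.
move/cvgrPdist_lt : (gz) => /(_ _ e20) [/= r r0 Hr].
pose h := Num.min (r / 4) (z / 4).
have h0 : 0 < h by rewrite /h lt_min; apply/andP; split; lra.
have hr : h <= r / 4 by rewrite /h ge_min lexx.
have hz : h <= z / 4 by rewrite /h ge_min lexx orbT.
have H1 : `|g z - g (z - 2 * h)| < e / 2.
  by apply: Hr => /=; rewrite gtr0_norm; lra.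
have H2 : `|g z - g (z + 2 * h)| < e / 2.
  by apply: Hr => /=; rewrite ltr0_norm; lra.
have he : 0 < e / 2 * h / 2 by rewrite !mulr_gt0// invr_gt0.
have close y : 0 < y -> \forall n \near \oo, `|G y - G_ n y| < e / 2 * h / 2.
  by move=> y0; apply: (cvgrPdist_lt _ _).1 he; exact: GG.
have P1 : 0 < z - 2 * h by clear - z0 hz; lra.
have P2 : z - 2 * h < z - h by clear - h0; lra.
have P3 : 0 < z - h by exact: lt_trans P2.
have P4 : 0 < z + h by exact: addr_gt0.
have P5 : z + h < z + 2 * h by clear - h0; lra.
have P6 : 0 < z + 2 * h by exact: lt_trans P5.
near=> n.
have c1 : `|G (z - 2 * h) - G_ n (z - 2 * h)| < e / 2 * h / 2.
  by near: n; exact: close.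
have c2 : `|G (z - h) - G_ n (z - h)| < e / 2 * h / 2.
  by near: n; exact: close.
have c3 : `|G (z + h) - G_ n (z + h)| < e / 2 * h / 2.
  by near: n; exact: close.
have c4 : `|G (z + 2 * h) - G_ n (z + 2 * h)| < e / 2 * h / 2.
  by near: n; exact: close.
have zn : `|z - z_ n| < h by near: n; exact: (cvgrPdist_lt _ _).1 h0.
move: zn; rewrite ltr_norml => /andP[zn1 zn2].
have zn3 : z - h <= z_ n by clear - zn2; lra.
have zn4 : z_ n <= z + h by clear - zn1; lra.
have i1 := slopes_nonincreasing (S_ n) P3 zn3.
have i2 := slopes_nonincreasing (S_ n) (lt_le_trans P3 zn3) zn4.
have /andP[j1 _] := S_ n _ _ P1 P2.
have /andP[_ j2] := S _ _ P1 P2.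
have /andP[_ j3] := S_ n _ _ P4 P5.
have /andP[j4 _] := S _ _ P4 P5.
have E1 : z - h - (z - 2 * h) = h by ring.
have E2 : z + 2 * h - (z + h) = h by ring.
rewrite {}E1 in j1 j2; rewrite {}E2 in j3 j4.
move: H1 H2 c1 c2 c3 c4; rewrite !ltr_norml.
move=> /andP[? ?] /andP[? ?] /andP[? ?] /andP[? ?] /andP[? ?] /andP[? ?].
have k1 : g_ n (z - h) < g (z - 2 * h) + e / 2 by rewrite -(ltr_pM2r h0); lra.
have k2 : g (z + 2 * h) - e / 2 < g_ n (z + h) by rewrite -(ltr_pM2r h0); lra.
by apply/andP; split; lra.
Unshelve. all: by end_near. Qed.

End slopes.

(** * Left-hand derivatives of convex nonincreasing functions *)

Section left_derivative.
Context {R : realType}.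
Implicit Types (G : R -> R) (z w : R).

Lemma convex_function_le_chord G x y z : convex_function (`]0, +oo[ : set R) G ->
  0 < x -> x < y -> y < z -> G y * (z - x) <= G x * (z - y) + G z * (y - x).
Proof.
move=> cG x0 xy yz.
have zx : 0 < z - x by rewrite subr_gt0 (lt_trans xy).
have t0 : 0 <= (z - y) / (z - x) by rewrite divr_ge0 ?subr_ge0 ?ltW// (lt_trans xy).
have t1 : (z - y) / (z - x) <= 1 by rewrite ler_pdivrMr// mul1r lerD2l lerN2 ltW.
have := cG (Itv01 t0 t1) x z; rewrite !inE /= !in_itv/= x0 !andbT.
rewrite (lt_trans x0 (lt_trans xy yz)) => /(_ isT isT).
set t := Itv01 t0 t1.
have E : 1 - (z - y) / (z - x) = (y - x) / (z - x).
  by field; rewrite gt_eqF.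
have -> : conv t (x : convex_lmodType R^o) z = y.
  rewrite [LHS](_ : _ = t%:num * x + unstable.onem t%:num * z)//=.
  by rewrite /unstable.onem E; field; rewrite gt_eqF.
rewrite convRE /= /unstable.onem E.
rewrite -(ler_pM2r zx) => /le_trans; apply.
by rewrite le_eqVlt; apply/orP; left; apply/eqP; field; rewrite gt_eqF.
Qed.

(** Slopes of chords ending at [z] increase with the left endpoint and are at most 0, so their limit
    exists and is their supremum. The last two clauses characterize this supremum. *)
Lemma left_derivative_cvg G z : convex_function (`]0, +oo[ : set R) G ->
  {in `]0, +oo[ &, nonincreasing_fun G} -> 0 < z ->
  [/\ h^-1 * (G (z + h) - G z) @[h --> 0^'-] --> left_derivative G z,
      (forall w, 0 < w -> w < z -> (G w - G z) / (w - z) <= left_derivative G z) &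
      (forall B, (forall w, 0 < w -> w < z -> (G w - G z) / (w - z) <= B) ->
         left_derivative G z <= B)].
Proof.
move=> cG niG z0.
pose q h := h^-1 * (G (z + h) - G z).
have qE w : q (w - z) = (G w - G z) / (w - z).
  by rewrite /q [z + _]addrC subrK mulrC.
have qnd : {in `]- z, 0[ &, nondecreasing_fun q}.
  move=> s t; rewrite !in_itv/= => /andP[zs s0] /andP[zt t0].
  rewrite le_eqVlt => /predU1P[->//|st].
  have := @convex_function_le_chord G (z + s) (z + t) z cG.
  move=> /(_ ltac:(lra) ltac:(lra) ltac:(lra)) H.
  rewrite /q.
  rewrite -subr_ge0.
  have -> : t^-1 * (G (z + t) - G z) - s^-1 * (G (z + s) - G z) =
    (G (z + s) * (z - (z + t)) + G z * (z + t - (z + s)) - G (z + t) * (z - (z + s))) / (s * t).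
    by field; rewrite !lt_eqF.
  by rewrite divr_ge0 ?subr_ge0// nmulr_rge0 ?ltW.
have qub : forall h, - z < h -> h < 0 -> q h <= 0.
  move=> h zh h0; rewrite /q; apply: mulr_le0_ge0; first by rewrite invr_le0 ltW.
  rewrite subr_ge0; apply: niG; rewrite ?in_itv/= ?andbT//; lra.
have near0 : \forall h \near (0:R)^'-, - z < h.
  by apply: nbhs_left_gt; lra.
have cvq : cvg (q h @[h --> 0^'-]).
  apply: nondecreasing_at_left_is_cvgr.
  - near=> a; apply: sub_in2 qnd => u; rewrite !in_itv/= => /andP[au ->].
    rewrite andbT (lt_trans _ au)//; near: a; exact: near0.
  - near=> a; exists 0 => y [u /= uI <-{y}].
    move: uI; rewrite in_itv/= => /andP[au u0].
    apply: qub => //; apply: lt_trans au; near: a; exact: near0.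
split; first exact: cvq.
- move=> w w0 wz; rewrite -qE; apply: limr_ge => //.
  near=> h; apply: qnd; rewrite ?in_itv/=.
  + by apply/andP; split; lra.
  + apply/andP; split; first by near: h; exact: near0.
    by near: h; exact: nbhs_left_lt.
  + by near: h; apply: nbhs_left_ge; lra.
- move=> B HB; apply: limr_le => //; near=> h.
  have -> : h^-1 * (G (z + h) - G z) = q ((z + h) - z) by rewrite /q addrAC subrr add0r.
  rewrite qE; apply: HB.
  + by rewrite -ltrBlDl sub0r; near: h; exact: near0.
  + by rewrite gtrDl; near: h; exact: nbhs_left_lt.
Unshelve. all: by end_near. Qed.

Lemma slopes_left_derivative G : convex_function (`]0, +oo[ : set R) G ->
  {in `]0, +oo[ &, nonincreasing_fun G} ->
  slopes 0 G (fun z => - left_derivative G z).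
Proof.
move=> cG niG z w z0 zw; have w0 := lt_trans z0 zw.
have [_ D1 _] := left_derivative_cvg cG niG w0.
have [_ _ D2] := left_derivative_cvg cG niG z0.
have wz : 0 < w - z by rewrite subr_gt0.
apply/andP; split.
  have := D1 _ z0 zw; rewrite ler_ndivrMr ?subr_lt0//; nra.
have : left_derivative G z <= (G w - G z) / (w - z).
  apply: D2 => v v0 vz; rewrite ler_ndivrMr ?subr_lt0// mulrAC ler_pdivrMr//.
  have := convex_function_le_chord cG v0 vz zw; nra.
rewrite ler_pdivlMr//; lra.
Qed.

(** A supremum of chord slopes that depend continuously on the right endpoint is lower
    semicontinuous. Since the left-hand derivative is also nondecreasing, it is left-continuous. *)
Lemma left_derivative_left_continuous G z : convex_function (`]0, +oo[ : set R) G ->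
  {in `]0, +oo[ &, nonincreasing_fun G} -> 0 < z ->
  left_derivative G w @[w --> z^'-] --> left_derivative G z.
Proof.
move=> cG niG z0; have S := slopes_left_derivative cG niG.
have Gc := slopes_continuous S z0.
apply/cvgrPdist_lt => e e0.
have [_ _ D2] := left_derivative_cvg cG niG z0.
have [w [w0 wz Hw]] : exists w, [/\ 0 < w, w < z &
    left_derivative G z - e < (G w - G z) / (w - z)].
  apply/not_existsP => H; suff : left_derivative G z <= left_derivative G z - e by lra.
  apply: D2 => w w0 wz; rewrite leNgt; apply/negP => Hw; exact: (H w).
have Qc : (G w - G y) / (w - y) @[y --> z] --> (G w - G z) / (w - z).
  apply: cvgM; first by apply: cvgB => //; exact: cvg_cst.
  apply: cvgV; first by rewrite subr_eq0 lt_eqF.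
  by apply: cvgB; [exact: cvg_cst|exact: cvg_id].
have Qn : \forall y \near z, left_derivative G z - e < (G w - G y) / (w - y).
  exact: (cvgr_gt _ Qc).
near=> y.
have yz : y < z by near: y; exact: nbhs_left_lt.
have wy : w < y by near: y; exact: nbhs_left_gt.
have y0 := lt_trans w0 wy.
have h1 : left_derivative G z - e < (G w - G y) / (w - y).
  by near: y; exact: cvg_within Qn.
have [_ D1 _] := left_derivative_cvg cG niG y0.
have h2 := D1 _ w0 wy.
have := slopes_nonincreasing S y0 (ltW yz).
rewrite lerN2 => h3; rewrite ltr_norml; apply/andP; split; lra.
Unshelve. all: by end_near. Qed.

End left_derivative.

(** * Decreasing bijections of the half-line onto (0,1] and their inverses *)

Section decreasing_bijection.
Context {R : realType}.

(** Positivity on the whole half-line is strictness. Nothing is required of [phi] outside (0,1]; the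
    infinite inverse at 0 is treated separately, which keeps [phi] real-valued. *)
Record dec_bij (psi phi : R -> R) : Prop := {
  db_at0 : psi 0 = 1;
  db_gt0 : forall z, 0 <= z -> 0 < psi z;
  db_dec : forall z w, 0 <= z -> z < w -> psi w < psi z;
  db_inv_ge0 : forall u, 0 < u <= 1 -> 0 <= phi u;
  db_invK : forall u, 0 < u <= 1 -> psi (phi u) = u }.

Variables psi phi : R -> R.
Hypothesis B : dec_bij psi phi.

Lemma db_lt z w : 0 <= z -> 0 <= w -> (psi w < psi z) = (z < w).
Proof.
move=> z0 w0; have [zw|wz|->] := ltgtP z w; last by rewrite ltxx.
  by rewrite (db_dec B).
by apply/negP => /lt_trans /(_ (db_dec B w0 wz)); rewrite ltxx.
Qed.

Lemma db_le z w : 0 <= z -> 0 <= w -> (psi w <= psi z) = (z <= w).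
Proof. by move=> z0 w0; rewrite leNgt db_lt// -leNgt. Qed.

Lemma db_inj z w : 0 <= z -> 0 <= w -> psi z = psi w -> z = w.
Proof.
by move=> z0 w0 e; apply/eqP; rewrite eq_le -(db_le z0 w0) -(db_le w0 z0) e lexx.
Qed.

Lemma db_in01 z : 0 <= z -> 0 < psi z <= 1.
Proof. by move=> z0; rewrite (db_gt0 B)//= -(db_at0 B) db_le. Qed.

Lemma db_K z : 0 <= z -> phi (psi z) = z.
Proof.
move=> z0; have z01 := db_in01 z0.
by apply: db_inj => //; [exact: (db_inv_ge0 B)|exact: (db_invK B)].
Qed.

Lemma db_inv1 : phi 1 = 0.
Proof. by rewrite -(db_at0 B) db_K. Qed.

Lemma db_inv_lt u v : 0 < u <= 1 -> 0 < v <= 1 -> (phi v < phi u) = (u < v).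
Proof.
by move=> u01 v01; rewrite -db_lt ?(db_invK B)// ?(db_inv_ge0 B).
Qed.

Lemma db_inv_le u v : 0 < u <= 1 -> 0 < v <= 1 -> (phi v <= phi u) = (u <= v).
Proof.
by move=> u01 v01; rewrite -db_le ?(db_invK B)// ?(db_inv_ge0 B).
Qed.

Lemma db_inv_gt0 u : 0 < u < 1 -> 0 < phi u.
Proof.
by move=> /andP[u0 u1]; rewrite -db_inv1 db_inv_lt// ?u0 ?(ltW u1)// ltr01 lexx.
Qed.

End decreasing_bijection.

Section decreasing_bijection_cvg.
Context {R : realType}.
Variables (psi_ phi_ : nat -> R -> R) (psi phi : R -> R).
Hypothesis B_ : forall n, dec_bij (psi_ n) (phi_ n).
Hypothesis B : dec_bij psi phi.

(** [phi_ n u] is compared with the fixed numbers [phi u + e] and [phi u - e] by applying [psi_ n]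
    to both sides. When [phi u - e] is negative, the lower bound holds because [phi_ n] is
    nonnegative. *)
Lemma dec_bij_inv_cvg :
  (forall z, 0 <= z -> psi_ n z @[n --> \oo] --> psi z) ->
  forall u, 0 < u <= 1 -> phi_ n u @[n --> \oo] --> phi u.
Proof.
move=> pp u u01; have pu0 := db_inv_ge0 B u01.
apply/cvgrPdist_lt => e e0.
have P1 : 0 <= phi u + e by lra.
have P1' : psi (phi u + e) < u by rewrite -[ltRHS](db_invK B u01) (db_lt B)//; lra.
have E1 : \forall n \near \oo, psi_ n (phi u + e) < u.
  exact: (cvgr_lt _ (pp _ P1)).
have E2 : \forall n \near \oo, phi u - e < phi_ n u.
  have [h|h] := ltP (phi u - e) 0.
    by near=> n; apply: lt_le_trans h _; exact: (db_inv_ge0 (B_ n)).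
  have h' : u < psi (phi u - e) by rewrite -[ltLHS](db_invK B u01) (db_lt B)//; lra.
  have H : \forall n \near \oo, u < psi_ n (phi u - e) by exact: (cvgr_gt _ (pp _ h)).
  near=> n; have hn : u < psi_ n (phi u - e) by near: n; exact: H.
  by rewrite -(db_lt (B_ n)) ?(db_inv_ge0 (B_ n))// (db_invK (B_ n)).
near=> n.
have h1 : phi_ n u < phi u + e.
  rewrite -(db_lt (B_ n)) ?(db_inv_ge0 (B_ n))//.
  by rewrite (db_invK (B_ n))//; near: n; exact: E1.
have h2 : phi u - e < phi_ n u by near: n; exact: E2.
by rewrite ltr_norml; apply/andP; split; lra.
Unshelve. all: by end_near. Qed.

Lemma dec_bij_cvg :
  (forall u, 0 < u < 1 -> phi_ n u @[n --> \oo] --> phi u) ->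
  forall z, 0 <= z -> psi_ n z @[n --> \oo] --> psi z.
Proof.
move=> pp z; rewrite le_eqVlt => /predU1P[<-|z0].
  have -> : (fun n => psi_ n 0) = fun=> 1 by apply/funext => n; rewrite (db_at0 (B_ n)).
  by rewrite (db_at0 B); exact: cvg_cst.
have /andP[pz0 _] := db_in01 B (ltW z0).
have pz1 : psi z < 1 by rewrite -(db_at0 B) (db_lt B)// ltW.
apply/cvgrPdist_lt => e e0.
have E1 : \forall n \near \oo, psi z - e < psi_ n z.
  have [h|h] := ltP (psi z - e) 0.
    by near=> n; apply: lt_trans h _; rewrite (db_gt0 (B_ n))// ltW.
  pose a := psi z - e / 2.
  have a01 : 0 < a < 1 by rewrite /a; apply/andP; split; lra.
  have a01' : 0 < a <= 1 by case/andP: a01 => -> /ltW ->.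
  have za : z < phi a.
    by rewrite -(db_lt B) ?(db_inv_ge0 B) ?(db_invK B)// /a ?ltW//; lra.
  have H : \forall n \near \oo, z < phi_ n a by exact: (cvgr_gt _ (pp _ a01)).
  near=> n; have : z < phi_ n a by near: n; exact: H.
  rewrite -(db_lt (B_ n)) ?(db_inv_ge0 (B_ n))// ?(db_invK (B_ n))// ?ltW//.
  by rewrite /a; lra.
have E2 : \forall n \near \oo, psi_ n z < psi z + e.
  have [h|h] := ltP 1 (psi z + e).
    by near=> n; apply: le_lt_trans h; case/andP: (db_in01 (B_ n) (ltW z0)).
  pose a := psi z + e / 2.
  have a01 : 0 < a < 1 by rewrite /a; apply/andP; split; lra.
  have a01' : 0 < a <= 1 by case/andP: a01 => -> /ltW ->.
  have za : phi a < z.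
    by rewrite -(db_lt B) ?(db_inv_ge0 B) ?(db_invK B)// /a ?ltW//; lra.
  have H : \forall n \near \oo, phi_ n a < z by exact: (cvgr_lt _ (pp _ a01)).
  near=> n; have : phi_ n a < z by near: n; exact: H.
  rewrite -(db_lt (B_ n)) ?(db_inv_ge0 (B_ n))// ?(db_invK (B_ n))// ?ltW//.
  by rewrite /a; lra.
near=> n.
have h1 : psi z - e < psi_ n z by near: n; exact: E1.
have h2 : psi_ n z < psi z + e by near: n; exact: E2.
by rewrite ltr_norml; apply/andP; split; lra.
Unshelve. all: by end_near. Qed.

End decreasing_bijection_cvg.

(** * Strict generators *)

Section strict_generators.
Context {R : realType}.
Implicit Types (psi phi : R -> R) (d : nat).

Lemma pinverseE psi phi u : dec_bij psi phi -> 0 < u <= 1 ->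
  pinverse psi u = (phi u)%:E.
Proof.
move=> B u01; rewrite /pinverse (_ : [set _ | _] = [set (phi u)%:E]) ?ereal_inf1//.
apply/seteqP; split => [[r| |] /= [z0 e]|_ ->] //=.
- by congr (_%:E); rewrite -e (db_K B).
- by move: u01; rewrite -e ltxx.
- by rewrite lee_fin (db_inv_ge0 B)// (db_invK B).
Qed.

Lemma pinverse0E psi phi : dec_bij psi phi -> pinverse psi 0 = +oo%E.
Proof.
move=> B; rewrite /pinverse (_ : [set _ | _] = [set +oo%E]) ?ereal_inf1//.
apply/seteqP; split => [[r| |] /= [z0 e]|_ ->] //=.
by have := db_gt0 B (z := r) z0; rewrite e ltxx.
Qed.

Lemma dec_bij_exists psi : psi 0 = 1 -> (forall z, 0 <= z -> 0 < psi z) ->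
  (forall z w, 0 <= z -> z < w -> psi w < psi z) ->
  {within `[0, +oo[, continuous psi} -> psi z @[z --> +oo] --> 0 ->
  exists phi, dec_bij psi phi.
Proof.
move=> psi0 pos dec psic psil.
have surj u : exists z, 0 < u <= 1 -> 0 <= z /\ psi z = u.
  have [/andP[u0 u1]|] := boolP (0 < u <= 1); last by exists 0.
  have [M [Mr HM]] := (cvgrPdist_lt _ _).1 psil _ u0.
  pose b := Num.max 0 (M + 1).
  have b0 : 0 <= b by rewrite /b le_max lexx.
  have Mb : M < b by rewrite /b lt_max; apply/orP; right; lra.
  have := HM _ Mb; rewrite sub0r normrN gtr0_norm ?pos// => bu.
  have [||c] := @IVT _ psi 0 b u b0.
  - apply: continuous_subspaceW psic => z /=.
    by rewrite !in_itv/= andbT => /andP[].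
  - by rewrite psi0 ge_min le_max u1 (ltW bu) orbT.
  by rewrite in_itv/= => /andP[c0 _] <-; exists c.
have [phi phiP] := choice surj.
by exists phi; split => // u /phiP[].
Qed.

Lemma strict_generator_bij psi : generator psi -> strict_generator psi ->
  dec_bij psi (fine \o pinverse psi).
Proof.
move=> G S; have psi0 := generator_at0 G.
have pos z : 0 <= z -> 0 < psi z.
  move=> z0; rewrite lt_neqAle eq_sym; have /andP[-> _] := generator_range G z0.
  rewrite andbT; apply/eqP => e.
  have : (pinverse psi 0 <= z%:E)%E by apply: ereal_inf_lbound; rewrite /= lee_fin.
  by rewrite S.
have dec z w : 0 <= z -> z < w -> psi w < psi z.
  by move=> z0 zw; apply: (generator_decreasing G) => //; rewrite S leey.
have [phi B] := dec_bij_exists psi0 pos dec (generator_continuous G) (generator_lim G).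
by split=> // u u01 /=; rewrite (pinverseE B u01)/=; [exact: (db_inv_ge0 B)|exact: (db_invK B)].
Qed.

Lemma sum_pinverseE psi phi n (u : n.-tuple R) : dec_bij psi phi ->
  (forall i, 0 < tnth u i <= 1) ->
  sum_pinverse psi u = (\sum_(i < n) phi (tnth u i))%:E.
Proof.
by move=> B u01; rewrite -sumEFin; apply: eq_bigr => i _; exact: pinverseE.
Qed.

Lemma sum_pinverse_pinfty psi phi n (u : n.-tuple R) i : dec_bij psi phi ->
  cube n u -> tnth u i = 0 -> sum_pinverse psi u = +oo%E.
Proof.
move=> B u01 ui; rewrite /sum_pinverse (bigD1 i)//= ui (pinverse0E B) addye//.
suff : (0 <= \sum_(j < n | j != i) pinverse psi (tnth u j))%E.
  by move=> h; apply/eqP => e; rewrite e in h.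
apply: sume_ge0 => j _; have /andP[] := u01 j.
rewrite le_eqVlt => /predU1P[<- _|uj0 uj1]; first by rewrite (pinverse0E B).
by rewrite (pinverseE B) ?uj0// lee_fin (db_inv_ge0 B) ?uj0.
Qed.

(** The coordinates filled with 1 contribute [phi 1 = 0], so [C] is seen only through a bivariate
    margin, which already determines the generator. *)
Definition tuple2 d (u v : R) : d.-tuple R := [tuple nth 1 [:: u; v] i | i < d].

Lemma cube_tuple2 d u v : 0 <= u <= 1 -> 0 <= v <= 1 -> cube d (tuple2 d u v).
Proof.
move=> u01 v01 i; rewrite tnth_mktuple.
by case: i => -[|[|i]] //= _; rewrite nth_nil lexx ler01.
Qed.

Lemma generator_tuple2 d (C : d.-tuple R -> R) psi phi u v : (1 < d)%N ->
  has_generator C psi -> dec_bij psi phi -> 0 < u <= 1 -> 0 < v <= 1 ->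
  C (tuple2 d u v) = psi (phi u + phi v).
Proof.
case: d C => [//|[//|d]] C _ [G HC] B u01 v01.
have [/andP[u0 u1] /andP[v0 v1]] := (u01, v01).
rewrite HC; last by apply: cube_tuple2; rewrite ?(ltW u0) ?(ltW v0).
rewrite (sum_pinverseE B); last first.
  move=> i; rewrite tnth_mktuple.
  by case: i => -[|[|i]] //= _; rewrite nth_nil lexx ltr01.
rewrite /= !big_ord_recl !tnth_mktuple/= big1 ?addr0//.
by move=> i _; rewrite tnth_mktuple/= nth_nil (db_inv1 B).
Qed.

(** Needed because [generator_of] may pick any generator. If [psi'] had a first zero [z0], then [C]
    would vanish at a point with positive coordinates, whereas a strict generator makes it positive
    there. *)
Lemma strict_generator_unique d (C : d.-tuple R -> R) psi psi' : (1 < d)%N ->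
  has_generator C psi -> strict_generator psi -> has_generator C psi' ->
  strict_generator psi'.
Proof.
move=> d1 HC S [G' HC']; have B := strict_generator_bij HC.1 S.
rewrite /strict_generator; case E' : (pinverse psi' 0) => [r| |] //; last first.
  have : (0 <= pinverse psi' 0)%E by apply: le_ereal_inf_tmp => z /= [].
  by rewrite E'.
have [z0 E] : exists z0 : R, pinverse psi' 0 = z0%:E by exists r.
exfalso; clear r E'.
have zero_ge1 w : 0 <= w -> psi' w = 0 -> 1 <= w.
  move=> w0 e; rewrite leNgt; apply/negP => w1.
  have := generator_nonincreasing G' w0 (ltW w1).
  by rewrite e (generator_normalized G'); lra.
have z01 : (1 : R) <= z0.
  rewrite -lee_fin -E; apply: le_ereal_inf_tmp => -[r| |] /= [] //.
    by rewrite !lee_fin; exact: zero_ge1.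
  by move=> _ _; exact: leey.
(* Any factor strictly between 1/2 and 1 would do: [psi'] is positive at [z] and zero at [z + z]. *)
pose z : R := 3 / 4 * z0.
have z_gt0 : 0 < z by rewrite /z; lra.
have zz0 : z < z0 by rewrite /z; lra.
have pz : 0 < psi' z.
  rewrite lt_neqAle eq_sym; have /andP[-> _] := generator_range G' (ltW z_gt0).
  rewrite andbT; apply/eqP => e.
  have : (pinverse psi' 0 <= z%:E)%E by apply: ereal_inf_lbound; rewrite /= lee_fin ltW.
  by rewrite E lee_fin leNgt zz0.
have p2z : psi' (z + z) = 0.
  have [w [w0 ew wz]] : exists w, [/\ 0 <= w, psi' w = 0 & w <= z + z].
    apply/not_existsP => H.
    have : ((z + z)%:E <= pinverse psi' 0)%E.
      apply: le_ereal_inf_tmp => -[r| |] /= [] //; last by move=> _ _; exact: leey.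
      rewrite !lee_fin => r0 er; rewrite leNgt; apply/negP => rz.
      by apply: (H r); split=> //; exact: ltW.
    by rewrite E lee_fin leNgt => /negP; apply; rewrite /z; lra.
  apply/eqP; rewrite eq_le; have := generator_nonincreasing G' w0 wz.
  rewrite ew => ->; have zz : 0 <= z + z by rewrite addr_ge0 ?ltW.
  by have /andP[->] := generator_range G' zz.
have inv_z : pinverse psi' (psi' z) = z%:E.
  rewrite /pinverse (_ : [set _ | _] = [set z%:E]) ?ereal_inf1//.
  apply/seteqP; split => [[r| |] /= [r0 e]|_ ->] //=; last 2 first.
    by rewrite -e ltxx in pz.
    by rewrite lee_fin ltW.
  rewrite lee_fin in r0; congr (_%:E); have [rz|zr|//] := ltgtP r z.
    have := generator_decreasing G' r0 rz; rewrite E lee_fin (ltW zz0) e ltxx.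
    by move=> /(_ isT).
  (* Strict decrease is known only up to [z0], so [z] is first compared with the truncation of [r]
     at [z0]. *)
  pose r' := Num.min r z0.
  have zr' : z < r' by rewrite /r' lt_min zr.
  have := generator_decreasing G' (ltW z_gt0) zr'.
  rewrite E lee_fin /r' ge_min lexx orbT => /(_ isT).
  have r'0 : 0 <= r' by exact: ltW (lt_trans z_gt0 zr').
  have r'r : r' <= r by rewrite /r' ge_min lexx.
  have := generator_nonincreasing G' r'0 r'r; rewrite -/r' e.
  by move=> h1 /(le_lt_trans h1); rewrite ltxx.
have inv_1 : pinverse psi' 1 = 0%E.
  apply/eqP; rewrite eq_le; apply/andP; split.
    by apply: ereal_inf_lbound; split=> //=; exact: generator_at0.
  by apply: le_ereal_inf_tmp => w /= [].
have pz01 : 0 < psi' z <= 1.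
  by have /andP[_ ->] := generator_range G' (ltW z_gt0); rewrite pz.
have := generator_tuple2 d1 HC B pz01 pz01.
set t := tuple2 d _ _; have : cube d t.
  by case/andP: pz01 => h1 h2; apply: cube_tuple2; rewrite (ltW h1) h2.
move=> /[dup] ct /HC' ->.
have -> : sum_pinverse psi' t = (z + z)%:E.
  rewrite /t; case: d d1 {C HC HC' t ct} => [//|[//|d]] _.
  rewrite /sum_pinverse !big_ord_recl !tnth_mktuple/= inv_z big1 ?adde0//.
  by move=> i _; rewrite tnth_mktuple/= nth_nil inv_1.
rewrite /= p2z => e.
have := db_gt0 B (z := fine (pinverse psi (psi' z)) + fine (pinverse psi (psi' z))).
have h := db_inv_ge0 B pz01; rewrite addr_ge0// => /(_ isT).
by rewrite /= in e; rewrite -e ltxx.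
Qed.

Lemma nat_ratio_between (x y : R) : 0 <= x -> x < y ->
  exists p q : nat, [/\ (0 < q)%N, x * q%:R < p%:R & p%:R < y * q%:R].
Proof.
move=> x0 xy; have yx : 0 < y - x by rewrite subr_gt0.
pose q := (Num.truncn (y - x)^-1).+1.
have q1 : 1 < (y - x) * q%:R.
  by rewrite mulrC -ltr_pdivrMr// mul1r truncnS_gt.
have xq : 0 <= x * q%:R by rewrite mulr_ge0.
exists (Num.truncn (x * q%:R)).+1, q; split => //; first exact: truncnS_gt.
rewrite -natr1; have := truncn_le (x * q%:R); rewrite xq.
by move=> ?; lra.
Qed.

(** * Convergence of generators from convergence of copulas *)

Section generator_cvg.
Variables (d : nat) (C_ : nat -> d.-tuple R -> R) (C : d.-tuple R -> R).
Variables (psi_ phi_ : nat -> R -> R) (psi phi : R -> R).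
Hypothesis d1 : (1 < d)%N.
Hypothesis HC_ : forall n, has_generator (C_ n) (psi_ n).
Hypothesis HC : has_generator C psi.
Hypothesis B_ : forall n, dec_bij (psi_ n) (phi_ n).
Hypothesis B : dec_bij psi phi.
Hypothesis CC : forall u, cube d u -> C_ n u @[n --> \oo] --> C u.

Let psi_cont (z : R) : 0 < z -> {for z, continuous psi}.
Proof.
move=> z0.
have sub : ([set` `]0, +oo[%R] : set R) `<=` [set` `[0, +oo[%R].
  by move=> x /=; rewrite !in_itv/= !andbT => /ltW.
have := continuous_subspaceW sub (generator_continuous HC.1).
rewrite continuous_open_subspace; last exact: interval_open.
by apply => //; rewrite inE /= in_itv/= z0.
Qed.

(* Repeated composition of [C_ n] with itself determines [psi_ n] at the
   integer multiples of [phi_ n u]. *)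
Lemma generator_multiple_cvg (u : R) q : 0 < u < 1 ->
  psi_ n (q%:R * phi_ n u) @[n --> \oo] --> psi (q%:R * phi u).
Proof.
move=> u01'; have u01 : 0 < u <= 1 by case/andP: u01' => -> /ltW ->.
have pu0 := db_inv_gt0 B u01'.
elim: q => [|q].
  rewrite mul0r (db_at0 B).
  have -> : (fun n => psi_ n (0 * phi_ n u)) = fun=> 1.
    by apply/funext => n; rewrite mul0r (db_at0 (B_ n)).
  exact: cvg_cst.
case: q => [_|q IH].
  rewrite mul1r (db_invK B)//.
  have -> : (fun n => psi_ n (1 * phi_ n u)) = fun=> u.
    by apply/funext => n; rewrite mul1r (db_invK (B_ n)).
  exact: cvg_cst.
set w := q.+1%:R * phi u in IH *.
have w0 : 0 < w by rewrite mulr_gt0.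
have -> : q.+2%:R * phi u = w + phi u by rewrite /w -natr1 mulrDl mul1r.
pose v n := psi_ n (q.+1%:R * phi_ n u).
have pn0 n : 0 <= phi_ n u by exact: (db_inv_ge0 (B_ n)).
have qpn0 n : 0 <= q.+1%:R * phi_ n u by rewrite mulr_ge0.
have E n : psi_ n (q.+2%:R * phi_ n u) = psi_ n (phi_ n (v n) + phi_ n u).
  by rewrite /v (db_K (B_ n))// -[q.+2%:R]natr1 mulrDl mul1r.
rewrite (eq_cvg _ _ E); apply/cvgrPdist_lt => e e0.
have wu0 : 0 < w + phi u by rewrite addr_gt0.
have e20 : 0 < e / 2 by lra.
have [/= r r0 Hr] := (cvgrPdist_lt _ _).1 (psi_cont wu0) _ e20.
(* [C_ n] converges at fixed points, but [v n] moves. It is eventually trapped between the fixed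
   values [psi (w + h)] and [psi (w - h)], and monotonicity transfers the convergence there to
   [v n]. *)
pose h := Num.min (r / 2) (w / 2).
have h0 : 0 < h by rewrite /h lt_min; apply/andP; split; lra.
have hr : h <= r / 2 by rewrite /h ge_min lexx.
have hw : h <= w / 2 by rewrite /h ge_min lexx orbT.
have bound w' : `|w' - w| <= h -> 0 <= w' ->
    [/\ 0 < psi w' <= 1, `|psi (w + phi u) - psi (w' + phi u)| < e / 2 &
     \forall n \near \oo, `|psi (w' + phi u) - psi_ n (phi_ n (psi w') + phi_ n u)| < e / 2].
  move=> ww w'0; have w'01 := db_in01 B w'0; split => //.
    apply: Hr => /=.
    have -> : w + phi u - (w' + phi u) = w - w' by ring.
    by rewrite distrC; lra.
  have c01 : cube d (tuple2 d (psi w') u).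
    by apply: cube_tuple2; [case/andP: w'01|case/andP: u01] => /ltW -> ->.
  have := (cvgrPdist_lt _ _).1 (CC c01) _ e20.
  rewrite (generator_tuple2 d1 HC B)// (db_K B)//.
  by move=> H; near=> n; rewrite -(generator_tuple2 d1 (HC_ n) (B_ n))//; near: n; exact: H.
have [p1 p2 p3] := bound (w + h) ltac:(rewrite addrAC subrr add0r gtr0_norm ?lexx//) ltac:(lra).
have [m1 m2 m3] := bound (w - h)
  ltac:(rewrite addrAC subrr add0r normrN gtr0_norm ?lexx//) ltac:(lra).
have l1 : psi (w + h) < psi w by rewrite (db_lt B); lra.
have l2 : psi w < psi (w - h) by rewrite (db_lt B); lra.
near=> n.
have k1 : psi (w + h) < v n by near: n; exact: (cvgr_gt _ IH).
have k2 : v n < psi (w - h) by near: n; exact: (cvgr_lt _ IH).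
have k3 : `|psi (w + h + phi u) - psi_ n (phi_ n (psi (w + h)) + phi_ n u)| < e / 2.
  by near: n; exact: p3.
have k4 : `|psi (w - h + phi u) - psi_ n (phi_ n (psi (w - h)) + phi_ n u)| < e / 2.
  by near: n; exact: m3.
have vn01 : 0 < v n <= 1 by exact: (db_in01 (B_ n)).
have j1 : psi_ n (phi_ n (psi (w + h)) + phi_ n u) <= psi_ n (phi_ n (v n) + phi_ n u).
  rewrite (db_le (B_ n)) ?addr_ge0 ?(db_inv_ge0 (B_ n))//.
  by rewrite lerD2r (db_inv_le (B_ n))// ltW.
have j2 : psi_ n (phi_ n (v n) + phi_ n u) <= psi_ n (phi_ n (psi (w - h)) + phi_ n u).
  rewrite (db_le (B_ n)) ?addr_ge0 ?(db_inv_ge0 (B_ n))//.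
  by rewrite lerD2r (db_inv_le (B_ n))// ltW.
move: p2 m2 k3 k4 j1 j2; clear; rewrite !ltr_norml.
move=> /andP[? ?] /andP[? ?] /andP[? ?] /andP[? ?] ? ?.
by apply/andP; split; lra.
Unshelve. all: by end_near. Qed.

Lemma generator_inv_cvg (u : R) : 0 < u < 1 -> phi_ n u @[n --> \oo] --> phi u.
Proof.
move=> u01'; have u01 : 0 < u <= 1 by case/andP: u01' => -> /ltW ->.
have pu0 := db_inv_gt0 B u01'.
have half01 : 0 < (2^-1 : R) < 1 by apply/andP; split; lra.
have phalf : phi 2^-1 = 1.
  by rewrite -(generator_normalized HC.1) (db_K B).
have phalf_ n : phi_ n 2^-1 = 1.
  by rewrite -(generator_normalized (HC_ n).1) (db_K (B_ n)).
have nat_cvg p : psi_ n p%:R @[n --> \oo] --> psi p%:R.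
  have := generator_multiple_cvg (q := p) half01; rewrite phalf mulr1.
  by under eq_fun do rewrite phalf_ mulr1.
(* A strict order between the limits holds eventually between the terms. When the limits agree, both
   implications are vacuous. *)
have cmp p q : \forall n \near \oo,
    (psi p%:R < psi (q%:R * phi u) -> psi_ n p%:R < psi_ n (q%:R * phi_ n u)) /\
    (psi (q%:R * phi u) < psi p%:R -> psi_ n (q%:R * phi_ n u) < psi_ n p%:R).
  have h : psi_ n (q%:R * phi_ n u) - psi_ n p%:R @[n --> \oo] -->
      psi (q%:R * phi u) - psi p%:R.
    by apply: cvgB; [exact: generator_multiple_cvg|exact: nat_cvg].
  have [lt1|lt1|_] := ltgtP (psi p%:R) (psi (q%:R * phi u)).
  - have H : \forall n \near \oo, 0 < psi_ n (q%:R * phi_ n u) - psi_ n p%:R.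
      by apply: (cvgr_gt _ h); rewrite subr_gt0.
    near=> n; split=> // _.
    by rewrite -subr_gt0; near: n; exact: H.
  - have H : \forall n \near \oo, psi_ n (q%:R * phi_ n u) - psi_ n p%:R < 0.
      by apply: (cvgr_lt _ h); rewrite subr_lt0.
    near=> n; split=> // _.
    by rewrite -subr_lt0; near: n; exact: H.
  - by near=> n; split.
apply/cvgrPdist_lt => e e0.
(* Since [q * phi u < p], eventually [q * phi_ n u < p < q * (phi u + e)]. *)
have [p [q [q0 pq1 pq2]]] := nat_ratio_between (ltW pu0) (ltac:(lra) : phi u < phi u + e).
have q0' : 0 < q%:R :> R by rewrite ltr0n.
have lo : \forall n \near \oo, phi u - e < phi_ n u.
  have [ue|ue] := ltP (phi u - e) 0.
    by near=> n; apply: lt_le_trans ue _; exact: (db_inv_ge0 (B_ n)).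
  have [p' [q' [q'0 pq'1 pq'2]]] := nat_ratio_between ue (ltac:(lra) : phi u - e < phi u).
  have q'0' : 0 < q'%:R :> R by rewrite ltr0n.
  near=> n.
  have [_ H] : (psi p'%:R < psi (q'%:R * phi u) -> psi_ n p'%:R < psi_ n (q'%:R * phi_ n u)) /\
    (psi (q'%:R * phi u) < psi p'%:R -> psi_ n (q'%:R * phi_ n u) < psi_ n p'%:R).
    by near: n; exact: cmp.
  have pn0 : 0 <= phi_ n u by exact: (db_inv_ge0 (B_ n)).
  rewrite (db_lt B) ?mulr_ge0// ?(ltW pu0)// (db_lt (B_ n)) ?mulr_ge0// in H.
  rewrite -(ltr_pM2r q'0'); apply: lt_trans pq'1 _; rewrite [ltRHS]mulrC.
  by apply: H; rewrite mulrC.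
near=> n.
have h1 : phi u - e < phi_ n u by near: n; exact: lo.
have h2 : phi_ n u < phi u + e.
  have [H _] : (psi p%:R < psi (q%:R * phi u) -> psi_ n p%:R < psi_ n (q%:R * phi_ n u)) /\
    (psi (q%:R * phi u) < psi p%:R -> psi_ n (q%:R * phi_ n u) < psi_ n p%:R).
    by near: n; exact: cmp.
  have pn0 : 0 <= phi_ n u by exact: (db_inv_ge0 (B_ n)).
  rewrite (db_lt B) ?mulr_ge0// ?(ltW pu0)// (db_lt (B_ n)) ?mulr_ge0// in H.
  rewrite -(ltr_pM2r q0'); apply: lt_trans pq2; rewrite [ltLHS]mulrC.
  by apply: H; rewrite mulrC.
by rewrite ltr_norml; apply/andP; split; lra.
Unshelve. all: by end_near. Qed.

Lemma generator_cvg (z : R) : 0 <= z -> psi_ n z @[n --> \oo] --> psi z.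
Proof. by apply: (dec_bij_cvg B_ B) => u; exact: generator_inv_cvg. Qed.

End generator_cvg.

(** Uniqueness of the generator is the convergence result for the constant sequence [C] with
    [generator_of C] as its generators: the same constant sequence of values tends to both
    functions. *)
Lemma generator_of_strict d (C : d.-tuple R -> R) psi : (1 < d)%N ->
  has_generator C psi -> strict_generator psi ->
  {in `[0, +oo[, generator_of C =1 psi}.
Proof.
move=> d1 HC S z; rewrite in_itv/= andbT => z0.
have HC' : has_generator C (generator_of C).
  by rewrite /generator_of; case: xgetP => [f _ //|/(_ psi)].
have B := strict_generator_bij HC.1 S.
have B' := strict_generator_bij HC'.1 (strict_generator_unique d1 HC S HC').
have CC (u : d.-tuple R) : cube d u -> (fun=> C) n u @[n --> \oo] --> C u.
  by move=> _; exact: cvg_cst.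
have h := generator_cvg (C_ := fun=> C) d1 (fun=> HC') HC (fun=> B') B CC z0.
have h' : (fun=> generator_of C z : R) @ \oo --> (generator_of C z : R).
  exact: cvg_cst.
exact: (cvg_unique _ h' h).
Qed.

End strict_generators.

(** * Signed derivatives of a generator *)

Section signed_derivatives.
Context {R : realType}.
Variables (d : nat) (psi : R -> R).
Hypothesis d1 : (1 < d)%N.
Hypothesis M : monotone_of_order d psi.

(** Using [kernel_derivative] makes the order [j = d - 1], a left-hand derivative, part of one
    uniform family. *)
Definition signed_derivative (j : nat) (z : R) : R :=
  (-1) ^+ j * kernel_derivative d j psi z.

Let D j z := (-1) ^+ j * derive1n j psi z.

Lemma signed_derivativeE j : (j <= d - 2)%N ->
  signed_derivative j = fun z => (-1) ^+ j * derive1n j psi z.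
Proof.
move=> jd; apply/funext => z; rewrite /signed_derivative /kernel_derivative.
by rewrite ifF//; apply/negbTE; rewrite neq_ltn; apply/orP; left; lia.
Qed.

Let is_derive_D j (z : R) : (j < d - 2)%N -> 0 < z ->
  is_derive z 1 (D j) (- D j.+1 z).
Proof.
move=> jd z0.
have h : is_derive z 1 (derive1n j psi) (derive1n j.+1 psi z).
  by apply: DeriveDef; [exact: (monotone_derivable M)|rewrite derive1nS derive1E].
have -> : - D j.+1 z = (-1) ^+ j *: derive1n j.+1 psi z.
  by rewrite /D exprS mulN1r mulNr opprK.
exact: (is_deriveZ ((-1) ^+ j) h).
Qed.

Let mvt_D j (z w : R) : (j < d - 2)%N -> 0 < z -> z < w ->
  exists2 c, z < c < w & D j z - D j w = D j.+1 c * (w - z).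
Proof.
move=> jd z0 zw.
have [||c] := @MVT R (D j) (fun z => - D j.+1 z) z w zw.
- by move=> c; rewrite in_itv/= => /andP[zc _]; apply: is_derive_D => //; exact: lt_trans zc.
- apply: derivable_within_continuous => c; rewrite in_itv/= => /andP[zc _].
  by have [] := is_derive_D jd (lt_le_trans z0 zc).
rewrite in_itv/= => zcw e; exists c => //.
by rewrite -opprB e mulNr opprK.
Qed.

Let D_nonincreasing j (z w : R) : (j <= d - 2)%N -> 0 < z -> z <= w ->
  D j w <= D j z.
Proof.
rewrite leq_eqVlt => /predU1P[->|jd]; first exact: (monotone_nonincreasing M).
move=> z0; rewrite le_eqVlt => /predU1P[->//|zw].
have [c /andP[zc _] e] := mvt_D jd z0 zw.
rewrite -subr_ge0 e mulr_ge0 ?subr_ge0 ?(ltW zw)//.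
by apply: (monotone_sign M) => //; exact: lt_trans zc.
Qed.

(** Convexity concerns the signed function [D (d - 2)], while the kernel differentiates the unsigned
    one. The limit exists for the former, and the sign is pulled through it. *)
Let left_derivative_D (z : R) : 0 < z ->
  signed_derivative (d - 1) z = - left_derivative (D (d - 2)) z.
Proof.
move=> z0; rewrite /signed_derivative /kernel_derivative eqxx.
have niG : {in `]0, +oo[ &, nonincreasing_fun (D (d - 2))}.
  move=> s t; rewrite !in_itv/= !andbT => s0 t0; exact: D_nonincreasing.
have [c _ _] := left_derivative_cvg (monotone_convex M) niG z0.
have c' : (-1) ^+ (d - 2) * (h^-1 * (D (d - 2) (z + h) - D (d - 2) z)) @[h --> 0^'-]
    --> (-1) ^+ (d - 2) * left_derivative (D (d - 2)) z.
  by apply: cvgMl_tmp; exact: c.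
rewrite [X in _ * X](_ : _ = (-1) ^+ (d - 2) * left_derivative (D (d - 2)) z); last first.
  rewrite {1}/left_derivative; apply: cvg_lim => //.
  apply: cvg_trans c'; apply: near_eq_cvg; near=> h.
  rewrite /D -mulrBr mulrCA; congr (_ * _).
  by rewrite mulrA -expr2 sqrr_sign mul1r.
have -> : (d - 1 = (d - 2).+1)%N by lia.
by rewrite exprS -mulrA [X in _ * X]mulrA -expr2 sqrr_sign mul1r mulN1r.
Unshelve. all: by end_near. Qed.

(** Below the top order the mean value theorem writes the increment as [D j.+1 c * (w - z)] with
    [D j.+1] monotone; at the top order convexity takes over. *)
Lemma signed_derivative_slopes j : (j < d - 1)%N ->
  slopes 0 (signed_derivative j) (signed_derivative j.+1).
Proof.
move=> jd z w z0 zw; have [jd2|jd2] := ltnP j (d - 2).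
  rewrite !signed_derivativeE//; last by lia.
  have [c /andP[zc cw] e] := mvt_D jd2 z0 zw; rewrite [X in _ <= X <= _]e.
  rewrite !ler_pM2r ?subr_gt0//.
  by rewrite !D_nonincreasing// ?(ltW zc) ?(ltW cw)//; exact: lt_trans zc.
have -> : j = (d - 2)%N by lia.
have -> : (d - 2).+1 = (d - 1)%N by lia.
rewrite !left_derivative_D//; last exact: lt_trans zw.
rewrite signed_derivativeE//.
apply: (slopes_left_derivative (monotone_convex M)) => //.
by move=> s t; rewrite !in_itv/= !andbT => s0 t0; exact: D_nonincreasing.
Qed.

Lemma signed_derivative_left_continuous (z : R) : 0 < z ->
  signed_derivative (d - 1) w @[w --> z^'-] --> signed_derivative (d - 1) z.
Proof.
move=> z0; rewrite left_derivative_D//.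
have niG : {in `]0, +oo[ &, nonincreasing_fun (D (d - 2))}.
  move=> s t; rewrite !in_itv/= !andbT => s0 t0; exact: D_nonincreasing.
have c : - left_derivative (D (d - 2)) w @[w --> z^'-] --> - left_derivative (D (d - 2)) z.
  by apply: cvgN; exact: (left_derivative_left_continuous (monotone_convex M)).
apply: cvg_trans c; apply: near_eq_cvg; near=> w; have w0 : 0 < w by near: w; exact: nbhs_left_gt.
by rewrite left_derivative_D.
Unshelve. all: by end_near. Qed.

(** Strictness gives order 0, and [slopes] hands both properties on to the next order. Denominators
    of all kernels are therefore nonzero. *)
Lemma signed_derivative_gt0_cvg0 j : generator psi -> strict_generator psi ->
  (j <= d - 1)%N ->
  (forall z, 0 < z -> 0 < signed_derivative j z) /\
  signed_derivative j z @[z --> +oo] --> 0.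
Proof.
move=> G S; elim: j => [_|j IH jd].
  rewrite signed_derivativeE//; have B := strict_generator_bij G S.
  split=> [z z0|]; first by rewrite expr0 mul1r derive1n0 (db_gt0 B)// ltW.
  apply: cvg_trans (generator_lim G); apply: near_eq_cvg; near=> z.
  by rewrite expr0 mul1r derive1n0.
have [p c] := IH (ltnW jd); have SL := @signed_derivative_slopes j jd.
by split; [exact: slopes_pos SL p c|exact: slopes_cvg0 SL p c].
Unshelve. all: by end_near. Qed.

Section affine.
Variables (l : nat) (a s c : R).
Hypothesis c0 : 0 < c.

(** With [s = sigma], [a = 1 / psi^(l)(sigma)] and [c] the rescaling that gives value 1/2 at 1, this
    is the normalized generator of the conditional copula. *)
Let g z := a * derive1n l psi (s + c * z).

Lemma derive1n_affine j (z : R) : (l + j <= d - 2)%N -> 0 < s + c * z ->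
  derive1n j g z = a * c ^+ j * derive1n (l + j) psi (s + c * z).
Proof.
elim: j z => [|j IH] z ljd zs.
  by rewrite derive1n0 expr0 mulr1 addn0.
rewrite derive1nS derive1E.
have zz : \forall w \near z, 0 < s + c * w.
  have cc : s + c * w @[w --> z] --> s + c * z.
    by apply: cvgD; [exact: cvg_cst|apply: cvgMl_tmp; exact: cvg_id].
  exact: (cvgr_gt _ cc).
rewrite (@near_eq_derive _ _ _ _
  (fun w => a * c ^+ j * derive1n (l + j) psi (s + c * w))); last first.
  by near=> w; apply: IH; [lia|near: w; exact: zz].
have h1 : is_derive (s + c * z) 1 (derive1n (l + j) psi) (derive1n (l + j.+1) psi (s + c * z)).
  apply: DeriveDef; first by apply: (monotone_derivable M) => //; lia.
  by rewrite addnS derive1nS derive1E.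
have h2 : is_derive z 1 (fun w => s + c * w) (0 + c *: 1).
  by apply: is_deriveD; apply: is_deriveZ.
have h3 := is_deriveZ (a * c ^+ j) (@is_derive1_comp R _ (fun w => s + c * w) z _ _ h1 h2).
rewrite (_ : (fun _ => _) = (a * c ^+ j) \*: (derive1n (l + j) psi \o (fun w => s + c * w)))//.
rewrite derive_val add0r /GRing.scale/= mulr1 exprSr.
by rewrite -!mulrA; congr (_ * (_ * _)); rewrite mulrC.
Unshelve. all: by end_near. Qed.

(** Both sides are left-hand derivatives because [l + (d - l - 2) = d - 2]. Positivity of [c] makes
    [c * h] approach 0 from the left when [h] does. *)
Lemma kernel_derivative_affine (z : R) : (l <= d - 2)%N -> 0 < s + c * z ->
  kernel_derivative (d - l) (d - l - 1) g z =
  a * c ^+ (d - l - 1) * kernel_derivative d (d - 1) psi (s + c * z).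
Proof.
move=> ld zs; rewrite /kernel_derivative !eqxx.
have -> : (d - l - 1 = (d - l - 2).+1)%N by lia.
set m := (d - l - 2)%N; have dm : (d - 2 = l + m)%N by rewrite /m; lia.
have niG : {in `]0, +oo[ &, nonincreasing_fun (D (d - 2))}.
  move=> u t; rewrite !in_itv/= !andbT => u0 t0; exact: D_nonincreasing.
have [cv _ _] := left_derivative_cvg (monotone_convex M) niG zs.
have ch : c * h @[h --> (0:R)^'-] --> (0:R)^'-.
  have ch0 : c * h @[h --> (0:R)^'-] --> (0:R).
    rewrite -[X in _ --> X](mulr0 c); apply: cvgMl_tmp.
    exact: cvg_at_left_filter (@cvg_id _ _).
  move=> A /= nA; suff : \forall h \near (0:R)^'-, A (c * h) by [].
  have hA : \forall y \near (0:R), y < 0 -> A y by exact: nA.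
  near=> h.
  have hh0 : h < 0 by near: h; exact: nbhs_left_lt.
  suff : c * h < 0 -> A (c * h) by apply; rewrite pmulr_rlt0.
  by near: h; exact: (ch0 _ hA).
have cv2 : (c * h)^-1 * (D (d - 2) (s + c * z + c * h) - D (d - 2) (s + c * z))
    @[h --> (0:R)^'-] --> left_derivative (D (d - 2)) (s + c * z).
  exact: cvg_comp ch cv.
pose K := a * c ^+ m.+1 * (-1) ^+ (d - 2).
have cv3 : K * ((c * h)^-1 * (D (d - 2) (s + c * z + c * h) - D (d - 2) (s + c * z)))
    @[h --> (0:R)^'-] --> K * left_derivative (D (d - 2)) (s + c * z).
  by apply: cvgMl_tmp; exact: cv2.
have E : (-1) ^+ (d - 2) * left_derivative (D (d - 2)) (s + c * z) =
    left_derivative (derive1n (d - 2) psi) (s + c * z).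
  have := left_derivative_D zs; rewrite /signed_derivative /kernel_derivative eqxx.
  have -> : (d - 1 = (d - 2).+1)%N by lia.
  rewrite exprS mulN1r mulNr => /oppr_inj <-.
  by rewrite mulrA -expr2 sqrr_sign mul1r.
rewrite -E mulrA; apply: cvg_lim => //.
have c' : c * h @[h --> (0:R)^'-] --> (0:R).
  by move=> A nA; apply: ch; exact: cvg_within.
apply: cvg_trans cv3; apply: near_eq_cvg; near=> h.
have h0 : h < 0 by near: h; exact: nbhs_left_lt.
have sz : 0 < s + c * z + c * h.
  rewrite -ltrBlDl sub0r.
  by near: h; apply: (cvgr_gt _ c'); rewrite oppr_lt0.
rewrite !derive1n_affine -?dm//; last by rewrite mulrDr addrA.
have -> : s + c * (z + h) = s + c * z + c * h by ring.
rewrite /D -mulrBr /K exprS.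
have -> : forall x y : R, a * (c * c ^+ m) * (-1) ^+ (d - 2) *
    ((c * h)^-1 * ((-1) ^+ (d - 2) * (x - y))) =
   ((-1) ^+ (d - 2) * (-1) ^+ (d - 2)) * (h^-1 * (a * c ^+ m * x - a * c ^+ m * y)).
  by move=> x y; field; rewrite (lt_eqF h0) (gt_eqF c0).
by rewrite -expr2 sqrr_sign mul1r.
Unshelve. all: by end_near. Qed.

End affine.

End signed_derivatives.

Section derivative_eq.
Context {R : realType}.
Variables (f g : R -> R).
Hypothesis fg : forall z, 0 < z -> f z = g z.

(** Chosen generators are identified only on [[0, oo)]; since differentiation is local, this
    suffices at positive arguments. *)
Lemma derive1n_eq_pos m (z : R) : 0 < z -> derive1n m f z = derive1n m g z.
Proof.
elim: m z => [|m IH] z z0; first by rewrite !derive1n0 fg.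
rewrite !derive1nS !derive1E; apply: near_eq_derive; near=> w; apply: IH.
by near: w; exact: lt_nbhsr.
Unshelve. all: by end_near. Qed.

Lemma kernel_derivative_eq_pos k m (z : R) : 0 < z ->
  kernel_derivative k m f z = kernel_derivative k m g z.
Proof.
move=> z0; rewrite /kernel_derivative; case: ifP => _; last exact: derive1n_eq_pos.
rewrite /left_derivative; congr (lim _).
apply/seteqP; split; apply: near_eq_cvg; near=> h.
- rewrite !derive1n_eq_pos// -ltrBlDl sub0r; near: h.
  by apply: nbhs_left_gt; rewrite oppr_lt0.
- rewrite !derive1n_eq_pos// -ltrBlDl sub0r; near: h.
  by apply: nbhs_left_gt; rewrite oppr_lt0.
Unshelve. all: by end_near. Qed.

End derivative_eq.

(** * Iterated tail integrals *)

Section slopes_integral.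
Context {R : realType}.
Implicit Types (a b : R) (G g : R -> R).

Lemma slopes_shift a G g c : slopes a G g ->
  slopes (a - c) (fun z => G (c + z)) (fun z => g (c + z)).
Proof.
move=> S z w az zw; have az' : a < c + z by rewrite -ltrBlDl.
have zw' : c + z < c + w by rewrite ltrD2l.
by have := S _ _ az' zw'; rewrite opprD addrACA subrr add0r.
Qed.

(** Clamping the argument makes [g] monotone on the whole line, hence measurable without any
    information to the left of [b]. *)
Lemma slopes_measurable_max a G g b : slopes a G g -> a < b ->
  measurable_fun setT (fun t => g (Num.max b t)).
Proof.
move=> S ab; apply: nonincreasing_measurable => // s t st.
apply: (slopes_nonincreasing S); first by rewrite lt_max ab.
by rewrite ge_max le_max lexx/= le_max st orbT.
Qed.

Lemma slopes_measurable a G g b (D : set R) : slopes a G g -> a < b ->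
  measurable D -> D `<=` `[b, +oo[ -> measurable_fun D g.
Proof.
move=> S ab mD Db.
apply: (eq_measurable_fun (fun t => g (Num.max b t))).
  move=> t; rewrite inE => /Db; rewrite /= in_itv/= andbT => bt.
  by rewrite max_r.
by apply: measurable_funTS; exact: slopes_measurable_max S ab.
Qed.

Lemma le_halving0 (x c : R) : (forall n : nat, x <= c / 2 ^+ n) -> x <= 0.
Proof.
move=> H; rewrite leNgt; apply/negP => x0.
have [n hn] : exists n : nat, c / x < n%:R.
  by exists (Num.truncn (c / x)).+1; exact: truncnS_gt.
have := H n; have n0 : (0 : R) < 2 ^+ n by rewrite exprn_gt0.
rewrite ler_pdivlMr// leNgt => /negP; apply.
rewrite ltr_pdivrMr// mulrC in hn.
apply: lt_le_trans hn _; rewrite ler_pM2l// -natrX ler_nat ltnW//.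
exact: ltn_expl.
Qed.

Local Notation mu := (@lebesgue_measure R).

(** A fundamental theorem of calculus without derivatives: on each interval the integral of [g] and
    the decrement of [G] obey the same two bounds, and bisection makes these bounds meet. *)
Lemma slopes_integral_bounded a G g b c : slopes a G g -> (forall z, a < z -> 0 < g z) ->
  a < b -> b <= c -> (\int[mu]_(t in `]b, c]) (g t)%:E)%E = (G b - G c)%:E.
Proof.
move=> S g0 ab bc.
have mg z w : b <= z -> measurable_fun `]z, w] (fun t => (g t)%:E).
  move=> bz; apply/measurable_EFinP; apply: (slopes_measurable S ab) => //.
  move=> t; rewrite /= !in_itv/= andbT => /andP[zt _].
  exact: ltW (le_lt_trans bz zt).
pose I z w : \bar R := (\int[mu]_(t in `]z, w]) (g t)%:E)%E.
have Icst (r : R) z w : z <= w -> (\int[mu]_(t in `]z, w]) r%:E)%E = (r * (w - z))%:E.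
  move=> zw; rewrite integral_cst//= lebesgue_measure_itv/= lte_fin.
  case: ltP => [_|wz]; first by rewrite -EFinD -EFinM.
  by rewrite (le_anti (introT andP (conj zw wz))) subrr mulr0 mule0.
have bnd z w : b <= z -> z <= w -> ((g w * (w - z))%:E <= I z w <= (g z * (w - z))%:E)%E.
  move=> bz zw; have az := lt_le_trans ab bz; have aw := lt_le_trans az zw.
  rewrite -!Icst//; apply/andP; split; apply: ge0_le_integral => //=.
  - by move=> t _; rewrite lee_fin ltW// g0.
  - exact: mg.
  - move=> t; rewrite in_itv/= => /andP[zt tw]; rewrite lee_fin.
    by apply: (slopes_nonincreasing S) => //; exact: lt_trans zt.
  - by move=> t; rewrite in_itv/= => /andP[zt tw]; rewrite lee_fin ltW// g0// (lt_trans az).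
  - exact: mg.
  - move=> t; rewrite in_itv/= => /andP[zt tw]; rewrite lee_fin.
    by apply: (slopes_nonincreasing S) => //; exact: ltW.
have fI z w : b <= z -> z <= w -> I z w \is a fin_num.
  move=> bz zw; have /andP[h1 h2] := bnd _ _ bz zw.
  by rewrite fin_numElt (lt_le_trans (ltNyr _) h1) (le_lt_trans h2 (ltry _)).
have add z m w : b <= z -> z <= m -> m <= w -> I z w = (I z m + I m w)%E.
  move=> bz zm mw; rewrite /I -ge0_integral_setU//=.
  - congr (integral _ _ _); apply/seteqP; split => t /=; rewrite !in_itv/=.
      move=> /andP[zt tw]; case: (leP t m) => tm; [left|right]; first by rewrite zt.
      by rewrite tw.
    move=> [/andP[zt tm]|/andP[mt tw]]; first by rewrite zt (le_trans tm).
    by rewrite tw (le_lt_trans zm).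
  - by apply/measurable_funU => //; split; apply: mg => //; exact: le_trans zm.
  - move=> t; rewrite /= !in_itv/= => -[/andP[zt _]|/andP[mt _]]; rewrite lee_fin ltW// g0//.
      by rewrite (lt_trans (lt_le_trans ab bz)).
    by rewrite (lt_trans (lt_le_trans ab (le_trans bz zm))).
  - apply/disj_setPS => t [] /=; rewrite !in_itv/= => /andP[_ tm] /andP[mt _].
    by move: mt; rewrite ltNge tm.
(* The errors of the two halves add up to [(g z - g m) + (g m - g w)] times half the length, so each
   bisection halves the total error. *)
have half n z w : b <= z -> z <= w ->
    `|fine (I z w) - (G z - G w)| <= (g z - g w) * (w - z) / 2 ^+ n.
  elim: n z w => [|n IH] z w bz zw.
    rewrite expr0 divr1.
    have /andP[h1 h2] := bnd _ _ bz zw; have fzw := fI _ _ bz zw.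
    rewrite -(fineK fzw) !lee_fin in h1 h2.
    move: zw; rewrite le_eqVlt => /predU1P[zw|zw].
      move: h1 h2; rewrite -zw !subrr !mulr0 subr0 => h1 h2.
      by rewrite ler_norml oppr0 h1 h2.
    have /andP[h3 h4] := S _ _ (lt_le_trans ab bz) zw.
    by clear - h1 h2 h3 h4; rewrite ler_norml; apply/andP; split; lra.
  pose m := (z + w) / 2.
  have zm : z <= m by rewrite /m; clear - zw; lra.
  have mw : m <= w by rewrite /m; clear - zw; lra.
  have bm := le_trans bz zm.
  rewrite (add _ m)// fineD ?fI//.
  have h1 := IH _ _ bz zm; have h2 := IH _ _ bm mw.
  have -> : fine (I z m) + fine (I m w) - (G z - G w) =
    (fine (I z m) - (G z - G m)) + (fine (I m w) - (G m - G w)) by ring.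
  apply: (le_trans (ler_normD _ _)); apply: (le_trans (lerD h1 h2)).
  have -> : m - z = (w - z) / 2 by rewrite /m; field.
  have -> : w - m = (w - z) / 2 by rewrite /m; field.
  have e0 : (2 : R) ^+ n != 0 by rewrite gt_eqF// exprn_gt0.
  rewrite le_eqVlt; apply/orP; left; apply/eqP; rewrite exprS; field.
  by rewrite e0.
have := le_halving0 (fun n => half n b c (lexx b) bc).
rewrite normr_le0 subr_eq0 => /eqP <-.
by rewrite fineK// fI.
Qed.

Lemma slopes_integral a G g b : slopes a G g -> (forall z, a < z -> 0 < g z) ->
  G z @[z --> +oo] --> 0 -> a < b ->
  (\int[mu]_(t in `[b, +oo[) (g t)%:E)%E = (G b)%:E.
Proof.
move=> S g0 Glim ab.
have mg : measurable_fun `]b, +oo[ (fun t => (g t)%:E).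
  apply/measurable_EFinP; apply: (slopes_measurable S ab) => // t.
  by rewrite /= !in_itv/= !andbT => /ltW.
rewrite -integral_itv_obnd_cbnd//.
pose F (n : nat) : set R := [set` `]b, b + n%:R]%R].
have -> : ([set` `]b, +oo[%R] : set R) = \bigcup_n F n.
  apply/seteqP; split=> t; rewrite /F /= in_itv/= ?andbT.
    move=> bt; exists (Num.truncn (t - b)).+1 => //=.
    by rewrite in_itv/= bt/= -lerBlDl ltW// truncnS_gt.
  by move=> [n _]; rewrite /= !in_itv/= => /andP[->].
have c1 : (\int[mu]_(t in F i) (g t)%:E)%E @[i --> \oo] -->
    (\int[mu]_(t in \bigcup_n F n) (g t)%:E)%E.
  apply: ge0_nondecreasing_set_cvg_integral.
  - move=> m n mn; apply/subsetPset => t; rewrite /F /= !in_itv/= => /andP[-> tm] /=.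
    by rewrite (le_trans tm)// lerD2l ler_nat.
  - by move=> n; exact: measurable_itv.
  - move=> n; apply: measurable_funS mg => // t; rewrite /F /= !in_itv/= => /andP[->] //.
  - move=> n t; rewrite /F /= in_itv/= => /andP[bt _].
    by rewrite lee_fin ltW// g0// (lt_trans ab).
have c2 : (\int[mu]_(t in F i) (g t)%:E)%E @[i --> \oo] --> (G b)%:E.
  have -> : (fun i => \int[mu]_(t in F i) (g t)%:E)%E = (fun i => (G b - G (b + i%:R))%:E).
    by apply/funext => i; rewrite (slopes_integral_bounded S)// lerDl.
  apply/cvg_EFin; first by near=> i.
  rewrite -[X in _ --> X]subr0; apply: cvgB; first exact: cvg_cst.
  have cb : (b + i%:R) @[i --> \oo] --> +oo.
    apply/cvgryPge => A; near=> i; rewrite -lerBlDl.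
    by near: i; exact: nbhs_infty_ger.
  exact: cvg_comp cb Glim.
exact: (cvg_unique _ c1 c2).
Unshelve. all: by end_near. Qed.

End slopes_integral.

Section iterated_integral.
Context {R : realType}.
Local Notation mu := (@lebesgue_measure R).
Local Open Scope ereal_scope.

(* The integral of [t_1, ..., t_n |-> G (t_1 + ... + t_n)] over the product of
   the half-lines [[a_i, oo)]. *)
Fixpoint tail_integral (a : seq R) (G : R -> \bar R) : \bar R :=
  if a is a0 :: a' then
    \int[mu]_(t in `[a0, +oo[) tail_integral a' (fun s => G (t + s)%R)
  else G 0%R.

(** Each integration lowers the order of the derivative by one. The offset [b] carries the variables
    that are still fixed in the induction. *)
Lemma tail_integral_slopes (F : nat -> R -> R) (a0 : R) (a : seq R) (b : R) :
  (forall j, (j < size a)%N -> slopes a0 (F j) (F j.+1)) ->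
  (forall j z, (j <= size a)%N -> a0 < z -> 0 < F j z)%R ->
  (forall j, (j <= size a)%N -> F j z @[z --> +oo%R] --> 0%R) ->
  (forall t, t \in a -> 0 <= t)%R -> (a0 < b)%R ->
  tail_integral a (fun t => (F (size a) (b + t))%:E) = (F 0 (b + \sum_(t <- a) t))%:E.
Proof.
elim: a F b => [F b _ _ _ _ _|a1 a IH F b S p c a_ge0 ab].
  by rewrite /= big_nil addr0.
rewrite /= big_cons.
have a1_ge0 : (0 <= a1)%R by apply: a_ge0; rewrite mem_head.
have a_ge0' t : t \in a -> (0 <= t)%R by move=> ta; apply: a_ge0; rewrite in_cons ta orbT.
have sa_ge0 : (0 <= \sum_(t <- a) t)%R.
  by rewrite big_seq; apply: sumr_ge0 => i; exact: a_ge0'.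
pose b' := (b + \sum_(t <- a) t)%R.
transitivity (\int[mu]_(t in `[a1, +oo[) (F 1%N (b' + t)%R)%:E).
  apply: eq_integral => t; rewrite inE /= in_itv/= andbT => a1t.
  have ab' : (a0 < b + t)%R by rewrite (lt_le_trans ab)// lerDl (le_trans a1_ge0).
  have := IH (fun j => F j.+1) (b + t)%R.
  rewrite /b' addrAC => <- //.
  - by congr tail_integral; apply/funext => s; rewrite addrA.
  - by move=> j ja; exact: S.
  - by move=> j z ja; exact: p.
  - by move=> j ja; exact: c.
have ab' : (a0 < b')%R by rewrite (lt_le_trans ab)// lerDl.
have S' := slopes_shift (c := b') (S 0%N isT).
rewrite (slopes_integral S').
- by rewrite /b' addrA addrAC.
- by move=> z; rewrite ltrBlDl => /p; apply.
- have cb : (b' + z)%R @[z --> +oo%R] --> +oo%R.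
    apply/cvgryPge => A; near=> z; rewrite -lerBlDl; near: z.
    by apply: nbhs_pinfty_ge; rewrite num_real.
  exact: cvg_comp cb (c 0%N isT).
- by rewrite ltrBlDl (lt_le_trans ab')// lerDl.
Unshelve. all: by end_near. Qed.

(** The innermost integral already vanishes: with the other variables fixed, the sum meets [N] only
    for countably many values of the last one. *)
Lemma tail_integral_countable (N : set R) (G : R -> \bar R) (c : R) (a : seq R) :
  countable N -> measurable_fun setT G -> (forall t, 0 <= G t) ->
  (forall t, ~ N t -> G t = 0) -> (0 < size a)%N ->
  tail_integral a (fun t => G (c + t)%R) = 0.
Proof.
move=> cN mG G0 GN; elim: a c => // a1 a IH c _ /=.
have [->|a_neq0] := eqVneq a [::]; last first.
  apply: integral0_eq => t _.
  rewrite -(IH (c + t)%R); first by congr tail_integral; apply/funext => s; rewrite addrA.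
  by rewrite lt0n size_eq0.
pose N' := [set t | N (c + t)%R].
have cN' : countable N'.
  apply: (@sub_countable _ _ _ ((fun t => t - c)%R @` N)); last first.
    exact: sub_countable (card_image_le _ _) cN.
  apply: subset_card_le => t /= Nt.
  by exists (c + t)%R => //; rewrite addrAC subrr add0r.
have mN' : measurable N' by apply: countable_measurable.
rewrite -(integral0 mu `[a1, +oo[) /=; apply: ge0_ae_eq_integral => //=.
- rewrite [X in measurable_fun _ X](_ : _ = fun t => G (c + t)%R); last first.
    by apply/funext => t; rewrite addr0.
  apply: measurable_funTS; apply: measurableT_comp => //.
  exact: measurable_funD.
- exists N'; split => //; first exact: countable_lebesgue_measure0.
  move=> t /= /not_implyP[_ Gt]; apply: contrapT => Nt; apply: Gt.
  by rewrite addr0 GN.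
Qed.

End iterated_integral.

(** * Lebesgue measure on tuples and integrals over orthants *)

Section upper_orthant.
Context {R : realType}.
Local Notation mu := (@lebesgue_measure R).

Definition tsum (n : nat) (z : n.-tuple R) : R := \sum_(i < n) tnth z i.

Definition upper_orthant (n : nat) (a : n.-tuple R) : set (n.-tuple R) :=
  [set z | forall i, tnth a i <= tnth z i].

Lemma measurable_forall_ord d (T : measurableType d) n (A : 'I_n -> set T) :
  (forall i, measurable (A i)) -> measurable [set z | forall i, A i z].
Proof.
move=> mA; rewrite (_ : [set _ | _] = \bigcap_(i in [set: 'I_n]) A i).
  exact: fin_bigcap_measurable.
by apply/seteqP; split=> z /= h i; [move=> _; exact: h|exact: h].
Qed.

Lemma measurable_tsum n : measurable_fun setT (@tsum n).
Proof. by apply: measurable_sum => i; exact: measurable_tnth. Qed.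

Lemma measurable_upper_orthant n (a : n.-tuple R) : measurable (upper_orthant a).
Proof.
apply: (@measurable_forall_ord _ _ n (fun i => [set z : n.-tuple R | tnth a i <= tnth z i])) => i.
rewrite (_ : [set _ | _] = (fun z : n.-tuple R => tnth z i) @^-1` `[tnth a i, +oo[).
  by rewrite -[X in measurable X]setTI; apply: measurable_tnth => //; exact: measurable_itv.
by apply/seteqP; split => z /=; rewrite in_itv/= andbT.
Qed.

Definition pair_cons n (p : measurableTypeR R * n.-tuple R) : n.+1.-tuple R :=
  [tuple of (p.1 : R) :: p.2].

Lemma measurable_pair_cons n : measurable_fun setT (@pair_cons n).
Proof. exact: (measurable_cons measurable_fst measurable_snd). Qed.

Lemma tsum_pair_cons n (p : R * n.-tuple R) : tsum (pair_cons p) = p.1 + tsum p.2.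
Proof.
rewrite /tsum big_ord_recl; congr (_ + _).
by apply: eq_bigr => i _; rewrite tnthS.
Qed.

Lemma tnth_behead_lift n (a : n.+1.-tuple R) i :
  tnth [tuple of behead a] i = tnth a (lift ord0 i).
Proof.
rewrite tnth_behead; congr tnth; apply/val_inj.
by rewrite /= inordK// ltnS.
Qed.

Lemma upper_orthant_cons n (a : n.+1.-tuple R) (p : R * n.-tuple R) :
  upper_orthant a (pair_cons p) <->
  thead a <= p.1 /\ upper_orthant [tuple of behead a] p.2.
Proof.
split=> [h|[h1 h2] i].
  split; first exact: (h ord0).
  by move=> i; have := h (lift ord0 i); rewrite tnth_behead_lift tnthS.
case: (unliftP ord0 i) => [j|] ->; last exact: h1.
by rewrite tnthS; have := h2 j; rewrite tnth_behead_lift.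
Qed.

Section cons_measure.
Variables (n : nat) (L : {sigma_finite_measure set (n.-tuple R) -> \bar R}).

Definition cons_measure : set (n.+1.-tuple R) -> \bar R :=
  pushforward (mu \x L)%E (@pair_cons n).

Let M := measure_function_pushforward__canonical__measure_function_Measure
  (mu \x L)%E (@measurable_pair_cons n).

HB.instance Definition _ := Measure.copy cons_measure M.

Let cons_measure_sigma_finite : sigma_finite setT cons_measure.
Proof.
have /sigma_finiteP[E [ET End Efin]] := sigma_finiteT L.
pose F (k : nat) : set R := [set` `[- k%:R, k%:R]%R].
exists (fun k => [set t : n.+1.-tuple R | F k (thead t) /\ E k [tuple of behead t]]).
  apply/esym; rewrite -subTset => t _.
  have [j _ Ej] : (\bigcup_i E i) [tuple of behead t] by rewrite -ET.
  pose k := maxn j (Num.truncn `|thead t|).+1.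
  exists k => //; split.
    rewrite /F /= in_itv/= -ler_norml; apply: ltW.
    apply: lt_le_trans (truncnS_gt _) _; rewrite ler_nat; exact: leq_maxr.
  by have /subsetPset := End _ _ (leq_maxl j (Num.truncn `|thead t|).+1); exact.
move=> k; have [mE fE] := Efin k.
have mF : measurable (F k) by exact: measurable_itv.
split.
  apply: measurableI.
    by rewrite -[X in measurable X]setTI; exact: (measurable_tnth ord0).
  by rewrite -[X in measurable X]setTI; exact: (measurable_behead).
rewrite /cons_measure /pushforward.
rewrite (_ : _ @^-1` _ = F k `*` E k).
  have muF : mu (F k) \is a fin_num.
    by rewrite /F lebesgue_measure_itv/=; case: ifP.
  by rewrite product_measure1E// lte_mul_pinfty.
apply/seteqP; split=> -[x y] /=.
- move=> [h1 h2]; split => //=; move: h2; congr (E k _); exact/val_inj.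
- move=> [h1 h2]; split => //=; move: h2; congr (E k _); exact/val_inj.
Qed.

HB.instance Definition _ :=
  Measure_isSigmaFinite.Build _ _ _ cons_measure cons_measure_sigma_finite.

End cons_measure.

(** Built one coordinate at a time so that Tonelli's theorem follows the recursion of
    [tail_integral]; sigma-finiteness is carried along for that theorem. *)
Fixpoint tuple_lebesgue (n : nat) : {sigma_finite_measure set (n.-tuple R) -> \bar R} :=
  if n is n'.+1 then cons_measure (tuple_lebesgue n')
  else \d_([tuple] : 0.-tuple R).

Lemma integral_tuple_lebesgue n (a : n.-tuple R) (G : R -> \bar R) :
  measurable_fun setT G -> (forall t, 0 <= G t)%E ->
  (\int[tuple_lebesgue n]_(z in upper_orthant a) G (tsum z))%E = tail_integral a G.
Proof.
elim: n a G => [|n IH] a G mG G0.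
  have mGt : measurable_fun (upper_orthant a) (fun z => G (tsum z)).
    by apply: measurable_funTS; apply: measurableT_comp => //; exact: measurable_tsum.
  rewrite /= integral_dirac//; last exact: measurable_upper_orthant.
  rewrite (tuple0 a) /= /tsum big_ord0 diracE mem_set ?mul1e//.
have mGs : measurable_fun setT (fun z : n.+1.-tuple R => G (tsum z)).
  by apply: measurableT_comp => //; exact: measurable_tsum.
have mD := measurable_upper_orthant a.
pose f : n.+1.-tuple R -> \bar R := (fun z => G (tsum z)) \_ (upper_orthant a).
have mf : measurable_fun setT f.
  by apply/(measurable_restrictT _ mD); exact: measurable_funTS.
have f0 z : (0 <= f z)%E by rewrite /f patchE; case: ifP.
rewrite integral_mkcond -/f.
transitivity (\int[(mu \x tuple_lebesgue n)%E]_p (f \o @pair_cons n) p)%E.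
  have := ge0_integral_pushforward (@measurable_pair_cons n)
    (mu \x tuple_lebesgue n)%E measurableT mf (fun z _ => f0 z).
  by rewrite preimage_setT => <-.
have mfp : measurable_fun setT (f \o @pair_cons n).
  by apply: measurableT_comp => //; exact: measurable_pair_cons.
rewrite fubini_tonelli1//; last by move=> ?; exact: f0.
have -> : (a : seq R) = thead a :: [tuple of behead a].
  by rewrite {1}(tuple_eta a).
rewrite /= [RHS]integral_mkcond; apply: eq_integral => x _.
rewrite /fubini_F patchE; case: ifPn => [|nx]; rewrite ?inE.
  rewrite /= in_itv/= andbT => ax.
  rewrite -(IH [tuple of behead a] (fun s => G (x + s)%R)); last first.
  - by move=> t; exact: G0.
  - by apply: measurableT_comp => //; exact: measurable_funD.
  rewrite [RHS]integral_mkcond; apply: eq_integral => y _ /=.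
  rewrite /f !patchE tsum_pair_cons; congr (if _ then _ else _).
  by apply/idP/idP; rewrite !inE upper_orthant_cons /=; [case|split].
apply: integral0_eq => y _ /=; rewrite /f patchE ifF//.
apply/negbTE; apply: contra nx; rewrite !inE => /upper_orthant_cons[h _].
by rewrite /= in_itv/= andbT.
Qed.

End upper_orthant.

(** * Image of a measure with density under a measurable map *)

Section image_density.
Context d d' (T : measurableType d) (Y : measurableType d') (R : realType).
Variables (nu : {measure set T -> \bar R}) (p : T -> R) (X : T -> Y).
Hypothesis mp : measurable_fun setT p.
Hypothesis p0 : forall x, 0 <= p x.
Hypothesis p1 : (\int[nu]_x (p x)%:E = 1)%E.
Hypothesis mX : measurable_fun setT X.

Definition image_density (mp : measurable_fun setT p) (p0 : forall x, 0 <= p x)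
  (p1 : (\int[nu]_x (p x)%:E = 1)%E) (mX : measurable_fun setT X) :
  set Y -> \bar R := fun A => (\int[nu]_(x in X @^-1` A) (p x)%:E)%E.

Local Notation M := (image_density mp p0 p1 mX).

Let mpE : measurable_fun setT (EFin \o p).
Proof. exact/measurable_EFinP. Qed.

Let mpre A : measurable A -> measurable (X @^-1` A).
Proof. by move=> mA; rewrite -[X in measurable X]setTI; exact: mX. Qed.

Let M0 : M set0 = 0%E.
Proof. by rewrite /image_density preimage_set0 integral_set0. Qed.

Let M_ge0 A : (0 <= M A)%E.
Proof. by apply: integral_ge0 => x _; rewrite lee_fin. Qed.

Let M_sigma_additive : semi_sigma_additive M.
Proof.
have pE0 x : (0 <= (EFin \o p) x)%E by rewrite lee_fin.
move=> F mF tF mUF; rewrite /image_density preimage_bigcup.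
apply: (semi_sigma_additive_nng_induced (mu := nu) mpE pE0).
- by move=> n; exact: mpre.
- apply/trivIsetP => /= i j _ _ ij; rewrite -preimage_setI.
  by move/trivIsetP : tF => /(_ _ _ _ _ ij) ->//; rewrite preimage_set0.
- by rewrite -preimage_bigcup; exact: mpre.
Qed.

HB.instance Definition _ := isMeasure.Build _ _ _ M M0 M_ge0 M_sigma_additive.

Let M1 : M setT = 1%E.
Proof. by rewrite /image_density preimage_setT. Qed.

HB.instance Definition _ := Measure_isProbability.Build _ _ _ M M1.

Definition image_density_probability : probability Y R := M.

Import HBNNSimple.

Lemma ge0_integral_image_density (h : Y -> \bar R) :
  measurable_fun setT h -> (forall y, 0 <= h y)%E ->
  (\int[image_density_probability]_y h y = \int[nu]_x (h (X x) * (p x)%:E))%E.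
Proof.
move=> mh h0; pose f_ := nnsfun_approx measurableT mh.
have f_h y : (f_ n y)%:E @[n --> \oo] --> h y.
  by apply: cvg_nnsfun_approx => // *; exact: h0.
transitivity (limn (fun n => \int[image_density_probability]_y (f_ n y)%:E))%E.
  rewrite -monotone_convergence//.
  - by apply: eq_integral => y _; apply/esym/cvg_lim => //; exact: f_h.
  - by move=> n; exact/measurable_EFinP/measurable_funP.
  - by move=> n y _; rewrite lee_fin.
  - by move=> y _ m n mn; rewrite lee_fin; exact/lefP/nd_nnsfun_approx.
have mfX n : measurable_fun setT (fun x => f_ n (X x)).
  by apply: measurableT_comp => //; exact: measurable_funP.
transitivity (limn (fun n => \int[nu]_x ((f_ n (X x))%:E * (p x)%:E)))%E; last first.
  rewrite -monotone_convergence//.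
  - apply: eq_integral => x _; apply/cvg_lim => //.
    by apply: cvgeZr => //; exact: f_h.
  - move=> n; apply: emeasurable_funM => //; exact/measurable_EFinP.
  - by move=> n y _; rewrite mule_ge0// lee_fin.
  - move=> y _ m n mn; rewrite lee_wpmul2r ?lee_fin//.
    exact/lefP/nd_nnsfun_approx.
congr (limn _); apply/funext => n.
have mpreI r : measurable (X @^-1` (f_ n @^-1` [set r])) by exact: mpre.
transitivity (\sum_(r \in range (f_ n))
    \int[nu]_x ((r * \1_(X @^-1` (f_ n @^-1` [set r])) x)%:E * (p x)%:E))%E.
  transitivity (\int[image_density_probability]_y
      (\sum_(r \in range (f_ n)) (r * \1_(f_ n @^-1` [set r]) y)%:E))%E.
    by apply: eq_integral => y _; rewrite fsumEFin// -fimfunE.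
  rewrite ge0_integral_fsum//; last 2 first.
  - by move=> r; exact/measurable_EFinP/measurable_funM.
  - by move=> r y _; rewrite nnfun_muleindic_ge0.
  apply: eq_fsbigr => r; rewrite inE => -[y0 _ ry0].
  have r0 : (0 <= r%:E)%E by rewrite -ry0 lee_fin.
  rewrite integralZl_indic_nnsfun// integral_indic// setIT.
  under eq_integral do rewrite EFinM -muleA.
  rewrite ge0_integralZl//; last 2 first.
  - by apply: emeasurable_funM => //; exact/measurable_EFinP/measurable_indic.
  - by move=> x _; rewrite mule_ge0// lee_fin.
  congr (_ * _)%E; rewrite /image_density_probability/= /image_density.
  rewrite integral_mkcond; apply: eq_integral => x _.
  by rewrite patchE indicE /in_mem /=; case: ifP; rewrite ?mul1e ?mul0e.
rewrite -ge0_integral_fsum//; last 2 first.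
- move=> r; apply: emeasurable_funM => //; apply/measurable_EFinP.
  by apply: measurable_funM => //; exact: measurable_indic.
- move=> r x _; rewrite mule_ge0 ?lee_fin//.
  have := nnfun_muleindic_ge0 (f_ n) r (X x); rewrite -EFinM lee_fin.
  by rewrite !indicE /in_mem.
apply: eq_integral => x _; rewrite -ge0_mule_fsuml; last first.
  move=> r; have := nnfun_muleindic_ge0 (f_ n) r (X x).
  by rewrite !indicE /in_mem.
congr (_ * _)%E; rewrite fsumEFin//; congr (_%:E).
rewrite [RHS](fimfunE (f_ n) (X x)); apply: eq_fsbigr => r _.
by rewrite !indicE /in_mem.
Qed.

End image_density.

(** * Measures determined by their values on boxes *)

Section inducing_measures.
Context {R : realType}.

Lemma measurable_box n (u : n.-tuple R) : measurable (box u).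
Proof.
apply: (@measurable_forall_ord _ _ n
  (fun i => [set z : n.-tuple R | 0 <= tnth z i <= tnth u i])) => i.
rewrite (_ : [set _ | _] = (fun z : n.-tuple R => tnth z i) @^-1` `[0, tnth u i]).
  by rewrite -[X in measurable X]setTI; apply: measurable_tnth => //; exact: measurable_itv.
by apply/seteqP; split => z /=; rewrite in_itv.
Qed.

Lemma cubeE n : cube n = box [tuple (1 : R) | _ < n].
Proof. by apply/seteqP; split=> t h i; have := h i; rewrite tnth_mktuple. Qed.

Lemma measurable_cube n : measurable (cube n : set (n.-tuple R)).
Proof. by rewrite cubeE; exact: measurable_box. Qed.

Definition lower_orthants n : set (set (n.-tuple R)) :=
  range (fun u : n.-tuple R => [set z | forall i, tnth z i <= tnth u i]).

(** Lower orthants form a generating system that is closed under intersection and exhausts the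
    space; within the cube they are boxes or empty. *)
Lemma measurable_lower_orthants n : @measurable _ (n.-tuple R) = <<s @lower_orthants n >>.
Proof.
apply/seteqP; split; last first.
  apply: smallest_sub; first exact: sigma_algebra_measurable.
  move=> _ [u _ <-].
  apply: (@measurable_forall_ord _ _ n
  (fun i => [set z : n.-tuple R | tnth z i <= tnth u i])) => i.
  rewrite (_ : [set _ | _] = (fun z : n.-tuple R => tnth z i) @^-1` `]-oo, tnth u i]).
    by rewrite -[X in measurable X]setTI; apply: measurable_tnth => //; exact: measurable_itv.
  by apply/seteqP; split => z /=; rewrite in_itv.
pose T := g_sigma_algebraType (@lower_orthants n).
have mid : measurable_fun setT (idfun : T -> n.-tuple R).
  apply/measurable_fun_tnthP => i.
  apply: (measurability (@RGenOInfty.G R)) => [|_ [_ [x ->] <-]].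
    exact: RGenOInfty.measurableE.
  rewrite setTI -[X in measurable X]setCK; apply: measurableC.
  (* A half-space bounding coordinate [i] is the union over [k] of orthants whose other corner
     coordinates equal [k]. *)
  rewrite (_ : ~` _ = \bigcup_(k : nat)
     [set z : n.-tuple R | forall j, tnth z j <= tnth [tuple if j == i then x else k%:R | j < n] j]).
    apply: bigcupT_measurable => k; apply: sub_sigma_algebra.
    by exists [tuple if j == i then x else k%:R | j < n].
  apply/seteqP; split => z /=; rewrite in_itv/= andbT.
    move=> /negP; rewrite -leNgt => zx.
    pose k := (Num.truncn (\sum_(j < n) `|tnth z j|)).+1.
    exists k => // j; rewrite tnth_mktuple; case: eqP => [->//|_].
    apply: le_trans (ltW (truncnS_gt _)).
    apply: (le_trans (ler_norm _)); rewrite (bigD1 j)//= lerDl.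
    exact: sumr_ge0.
  by move=> [k _ /(_ i)]; rewrite tnth_mktuple eqxx leNgt => /negP.
by move=> A mA; rewrite -[A](preimage_id) -[X in <<s _ >> X]setTI; exact: mid.
Qed.

Lemma induces_cube n (A : n.-tuple R -> R) (mu : probability (n.-tuple R) R) :
  induces A mu -> A [tuple 1 | _ < n] = 1 -> mu (cube n) = 1%E.
Proof.
move=> H A1; rewrite cubeE H ?A1// => i.
by rewrite tnth_mktuple ler01 lexx.
Qed.

Lemma probability_setI1 d (T : measurableType d) (P : probability T R) (A B : set T) :
  measurable A -> measurable B -> P B = 1%E -> P (A `&` B) = P A.
Proof.
move=> mA mB PB; apply/eqP; rewrite eq_le; apply/andP; split.
  by apply: le_measure; rewrite ?inE//; exact: measurableI.
have nB : P (~` B) = 0%E by rewrite probability_setC// PB subee.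
rewrite -[X in P X](setUIDK A B) (measureU P)//; last 3 first.
- exact: measurableI.
- exact: measurableD.
- by rewrite setDE setIACA setICr setI0.
rewrite [X in (_ + X)%E](_ : _ = 0%E) ?adde0//.
apply/eqP; rewrite eq_le measure_ge0 andbT -nB.
by apply: le_measure; rewrite ?inE//; [exact: measurableD|exact: measurableC].
Qed.

(** Values are prescribed only on boxes in the cube. As [A] is 1 at the top corner, the cube has
    full mass, so an orthant may be cut down to a box with corner [min u 1], or to the empty set
    when some [u_i] is negative. *)
Lemma induces_unique n (A : n.-tuple R -> R) (mu nu : probability (n.-tuple R) R) :
  induces A mu -> induces A nu -> A [tuple 1 | _ < n] = 1 ->
  forall B, measurable B -> mu B = nu B.
Proof.
move=> Hmu Hnu A1.
apply: (measure_unique (@lower_orthants n)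
  (fun k : nat => [set z | forall i, tnth z i <= tnth [tuple k%:R | _ < n] i])).
- exact: measurable_lower_orthants.
- move=> _ _ [u _ <-] [v _ <-].
  exists [tuple Num.min (tnth u i) (tnth v i) | i < n] => //.
  apply/seteqP; split=> z /= => [h|[h1 h2] i].
    by split=> i; have := h i; rewrite tnth_mktuple le_min => /andP[].
  by rewrite tnth_mktuple le_min h1 h2.
- by move=> k; exists [tuple k%:R | _ < n].
- rewrite -subTset => z _.
  exists (Num.truncn (\sum_(j < n) `|tnth z j|)).+1 => //= j; rewrite tnth_mktuple.
  apply: le_trans (ltW (truncnS_gt _)).
  apply: (le_trans (ler_norm _)); rewrite (bigD1 j)//= lerDl.
  exact: sumr_ge0.
- move=> B [u _ <-]; set D := [set _ | _].
  have mD : measurable D.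
    rewrite [X in X D](measurable_lower_orthants n); apply: sub_sigma_algebra.
    by exists u.
  have mc := @measurable_cube n.
  suff : mu D = nu D by [].
  rewrite -(probability_setI1 mD mc (induces_cube Hmu A1)).
  rewrite -(probability_setI1 mD mc (induces_cube Hnu A1)).
  have [/forallP u0|/forallPn[i ui]] := boolP [forall i, 0 <= tnth u i]; last first.
    rewrite (_ : D `&` cube n = set0) ?measure0//.
    rewrite -subset0 => z [/(_ i) zu /(_ i) /andP[z0 _]].
    by move: ui; rewrite (le_trans z0 zu).
  pose v := [tuple Num.min (tnth u i) 1 | i < n].
  have cv : cube n v.
    by move=> i; rewrite tnth_mktuple le_min u0 ler01/= ge_min lexx orbT.
  rewrite (_ : D `&` cube n = box v); first by rewrite Hmu// Hnu.
  apply/seteqP; split=> z => [[h1 h2] i|h].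
    by have /andP[z0 z1] := h2 i; rewrite tnth_mktuple le_min z0 z1 h1.
  split=> i; have := h i; rewrite tnth_mktuple le_min => /andP[z0 /andP[zu z1]] //.
  by rewrite z0.
- by move=> k; apply: le_lt_trans (probability_le1 _ _) (ltry 1);
   rewrite measurable_lower_orthants; apply: sub_sigma_algebra;
   exists [tuple k%:R | _ < n].
Qed.

End inducing_measures.

Section one_dimensional.
Context {R : realType}.

(** The law of the quantile function [Q] of a uniform variable. The last hypothesis is
    right-continuity, which gives the equivalence of [Q p <= y] and [p <= F y]. The dimension is a
    variable because it will be [k - (k - 1)]. *)
Lemma quantile_measure n (F : R -> R) : n = 1%N ->
  (forall y z, 0 <= y -> y <= z -> z <= 1 -> F y <= F z) -> 0 <= F 0 -> F 1 = 1 ->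
  (forall y e, 0 <= y -> y < 1 -> 0 < e -> exists z, [/\ y < z, z <= 1 & F z < F y + e]) ->
  exists P : probability (n.-tuple R) R,
    forall u, cube n u -> forall i, P (box u) = (F (tnth u i))%:E.
Proof.
move=> -> Fnd F0 F1 Frc.
pose S p := [set y | 0 <= y <= 1 /\ p <= F y].
have S_nonempty p : p <= 1 -> S p !=set0 by exists 1; rewrite /S /= ler01 lexx F1.
have S_lb p : has_lbound (S p) by exists 0 => y [/andP[]].
(* The truncation keeps the set nonempty for [p > 1], so [Q] is monotone, hence measurable, on the
   whole line. *)
pose Q p := inf (S (Num.min p 1)).
have Qnd : nondecreasing_fun Q.
  move=> p q pq; apply: lb_le_inf.
    by apply: S_nonempty; rewrite ge_min lexx orbT.
  move=> w [w01 qw]; apply: ge_inf; first exact: S_lb.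
  split=> //; apply: le_trans qw.
  by rewrite le_min !ge_min pq lexx orbT.
have QP p y : p <= 1 -> 0 <= y <= 1 -> (Q p <= y) = (p <= F y).
  move=> p1 /andP[y0 y1]; have Qp : Q p = inf (S p) by rewrite /Q min_l.
  rewrite Qp; apply/idP/idP => [h|h]; last first.
    by apply: ge_inf => //; rewrite /S /= y0 y1.
  rewrite leNgt; apply/negP => Fp.
  have y1' : y < 1.
    by rewrite lt_neqAle y1 andbT; apply/eqP => e; move: Fp; rewrite e F1 ltNge p1.
  have [z [yz z1 Fz]] := Frc y (p - F y) y0 y1' ltac:(by rewrite subr_gt0).
  have : z <= inf (S p).
    apply: lb_le_inf; first exact: S_nonempty.
    move=> w [/andP[w0 w1] pw]; rewrite leNgt; apply/negP => wz.
    have := Fnd _ _ w0 (ltW wz) z1; rewrite leNgt => /negP; apply.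
    by apply: lt_le_trans pw; rewrite -[ltRHS](addrNK (F y)) [ltRHS]addrC.
  by move=> /le_trans/(_ h); rewrite leNgt yz.
have mu01 : (\int[@lebesgue_measure R]_p (\1_(`[0%R, 1%R] : set R) p)%:E = 1)%E.
  rewrite integral_indic// setIT /= lebesgue_measure_itv/= lte_fin ltr01.
  by rewrite oppr0 adde0.
have mX : measurable_fun setT (fun p : measurableTypeR R => [tuple Q p | _ < 1]).
  apply/measurable_fun_tnthP => i.
  rewrite (_ : _ \o _ = Q); last by apply/funext => p; rewrite /= tnth_mktuple.
  exact: nondecreasing_measurable.
have m1 : measurable_fun [set: measurableTypeR R] (\1_(`[0%R, 1%R] : set R) : R -> R).
  exact: measurable_indic.
have p0 (p : measurableTypeR R) : 0 <= \1_(`[0%R, 1%R] : set R) p :> R by [].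
exists (image_density_probability m1 p0 mu01 mX) => u u01 i.
rewrite ord1; set y := tnth u ord0.
have y01 : 0 <= y <= 1 by exact: u01.
rewrite /image_density_probability /= /image_density.
have Fy0 : 0 <= F y.
  by case/andP: y01 => y0 y1; apply: le_trans F0 _; exact: Fnd.
have Fy1 : F y <= 1.
  by case/andP: y01 => y0 y1; rewrite -F1; exact: Fnd.
transitivity (\int[@lebesgue_measure R]_x (\1_(`[0%R, F y] : set R) x)%:E)%E.
  rewrite integral_mkcond; apply: eq_integral => p _; rewrite patchE.
  rewrite !indicE; case: ifPn => [|]; rewrite ?inE.
    move=> /(_ ord0); rewrite tnth_mktuple => /andP[Q0 Qy].
    congr ((_ : bool)%:R%:E); apply/idP/idP; rewrite !inE/= !in_itv/= => /andP[-> pF] /=.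
      by rewrite -QP.
    exact: le_trans Fy1.
  move=> np; congr (_%:E); apply/esym/eqP; rewrite pnatr_eq0 eqb0.
  apply: contra np; rewrite !inE/= in_itv/= => /andP[p0' pF] j.
  have p1 := le_trans pF Fy1.
  rewrite ord1 tnth_mktuple -/y (QP _ _ p1 y01) pF andbT.
  rewrite /Q min_l//; apply: lb_le_inf; first exact: S_nonempty.
  by move=> w [/andP[]].
rewrite integral_indic// setIT /= lebesgue_measure_itv/= lte_fin.
case: ltgtP Fy0 => [h|//|<-] _ //; by rewrite oppr0 adde0.
Qed.

End one_dimensional.

(** * Weak convergence from distribution functions *)

Section weak_convergence.
Context {R : realType}.

(** Heine's theorem, with the near-covering form of compactness choosing one radius for all
    points. *)
Lemma unit_segment_uniformly_continuous (g : R -> R) (e : R) :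
  {within `[0%R, 1%R], continuous g} -> 0 < e ->
  exists2 del : R, 0 < del & forall x y : R, 0 <= x <= 1 -> 0 <= y <= 1 ->
    `|x - y| < del -> `|g x - g y| < e.
Proof.
move=> gc e0.
have /compact_near_coveringP cov := @segment_compact R 0 1.
pose P (del x : R) := forall y : R, 0 <= x <= 1 -> 0 <= y <= 1 ->
    `|x - y| < del -> `|g x - g y| < e.
suff : \forall del \near (0:R)^'+, [set` `[0%R, 1%R]%R] `<=` P del.
  move=> H; near (0:R)^'+ => del.
  exists del; first by near: del; exact: nbhs_right_gt.
  move=> x y x01 y01 xy.
  have HP : [set` `[0%R, 1%R]%R] `<=` P del by near: del; exact: H.
  by apply: (HP x) => //=; rewrite in_itv.
apply: cov => x; rewrite /= in_itv/= => x01.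
have e20 : 0 < e / 2 by rewrite divr_gt0.
have xI : [set` `[0%R, 1%R]%R] x by rewrite /= in_itv.
have := (subspace_continuousP _ _).1 gc x xI.
move/cvgrPdist_lt => /(_ _ e20) [/= r r0 Hr].
have r20 : 0 < r / 2 by rewrite divr_gt0.
exists (ball x (r / 2), [set del : R | del < r / 2]) => /=.
  split; first exact: nbhsx_ballx.
  by apply: nbhs_right_lt.
move=> [x' del] /= [xx' dr] y x'01 y01 x'y.
have h1 : `|g x - g x'| < e / 2.
  apply: Hr => /=; last by rewrite in_itv.
  by apply: lt_le_trans xx' _; rewrite ler_pdivrMr// ler_peMr ?ler1n// ltW.
have h2 : `|g x - g y| < e / 2.
  apply: Hr => /=; last by rewrite in_itv.
  rewrite -(subrKA x') (le_lt_trans (ler_normD _ _))// [ltRHS](splitr r).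
  by rewrite ltrD// (lt_trans x'y).
rewrite -(subrKA (g x)) (le_lt_trans (ler_normD _ _))// [ltRHS](splitr e).
by rewrite ltrD// distrC.
Unshelve. all: by end_near. Qed.

Definition segment_box (x : R) : set (1.-tuple R) := box [tuple x | _ < 1].

Lemma segment_boxP (x : R) (t : 1.-tuple R) :
  segment_box x t <-> 0 <= tnth t ord0 <= x.
Proof.
by split=> [/(_ ord0)|h i]; rewrite ?ord1 tnth_mktuple.
Qed.

(* The initial term accounts for the mass at [y 0]. *)
Fixpoint stieltjes_sum (g F : R -> R) (y : nat -> R) (k : nat) : R :=
  if k is k'.+1 then
    stieltjes_sum g F y k' + g (y k) * (F (y k) - F (y k'))
  else g (y 0%N) * F (y 0%N).

(** The segment is cut into the point 0 and half-open slices. On each slice [g] is within [e] of its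
    value at the right end, so the error is at most [e] times the mass, and the masses add up to
    [F (y N)]. *)
Lemma stieltjes_sum_close (P : probability (1.-tuple R) R) (F g : R -> R) (e : R)
    (y : nat -> R) (N : nat) :
  (forall x, 0 <= x <= 1 -> P (segment_box x) = (F x)%:E) ->
  P.-integrable (segment_box 1) (fun t => (g (tnth t ord0))%:E) ->
  0 <= e -> y 0%N = 0 -> (forall k, (k < N)%N -> y k <= y k.+1) -> y N <= 1 ->
  (forall k t, (k < N)%N -> y k < t -> t <= y k.+1 -> `|g t - g (y k.+1)| <= e) ->
  `|\int[P]_(t in segment_box (y N)) g (tnth t ord0) - stieltjes_sum g F y N|
    <= e * F (y N).
Proof.
move=> PF gI e0 y0.
have mB (x : R) : measurable (segment_box x) by exact: measurable_box.
have gIx (D : set (1.-tuple R)) : measurable D -> D `<=` segment_box 1 ->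
    P.-integrable D (EFin \o (fun t => g (tnth t ord0))).
  by move=> mD D1; apply: (integrableS (mB 1)).
have sub (x z : R) : x <= z -> segment_box x `<=` segment_box z.
  by move=> xz t /segment_boxP/andP[t0 tx]; apply/segment_boxP; rewrite t0 (le_trans tx).
have cI (D : set (1.-tuple R)) (r : R) : measurable D -> P.-integrable D (EFin \o (fun=> r)).
  by move=> mD; exact: finite_measure_integrable_cst.
have step (D : set (1.-tuple R)) (c : R) : measurable D -> D `<=` segment_box 1 ->
    (forall t, D t -> `|g (tnth t ord0) - c| <= e) ->
    `|\int[P]_(t in D) g (tnth t ord0) - c * fine (P D)| <= e * fine (P D).
  move=> mD D1 gc; rewrite -Rintegral_cst// -RintegralB//; [|exact: gIx|exact: cI].
  have dI : P.-integrable D (EFin \o (fun t => g (tnth t ord0) - c)).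
    apply: (eq_integrable _ (fun t => (g (tnth t ord0))%:E - c%:E)%E) => //.
    by apply: integrableB => //; [exact: gIx|exact: cI].
  apply: (le_trans (le_normr_Rintegral mD dI)).
  rewrite -Rintegral_cst//; apply: le_Rintegral => //; last exact: cI.
  apply: (eq_integrable _ (fun t => `|(g (tnth t ord0) - c)%:E|)%E) => //.
  exact: integrable_abse.
elim: N => [_ _ _|N IH ynd yN osc].
  rewrite /= y0.
  have F0 : F 0 = fine (P (segment_box 0)) by rewrite PF ?lexx ?ler01.
  rewrite F0; apply: step => //; first by apply: sub; exact: ler01.
  move=> t /segment_boxP t0.
  by rewrite (le_anti t0) subrr normr0.
have yge0 k : (k <= N.+1)%N -> 0 <= y k.
  elim: k => [|k IHk] kN; first by rewrite y0.
  by rewrite (le_trans (IHk (ltnW kN)))// ynd.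
have yN' : y N <= y N.+1 by exact: ynd.
have yN1 : y N <= 1 by exact: le_trans yN.
have {}IH := IH (fun k kN => ynd k (ltnW kN)) yN1 (fun k t kN => osc k t (ltnW kN)).
pose D := segment_box (y N.+1) `\` segment_box (y N).
have mD : measurable D by exact: measurableD.
have D1 : D `<=` segment_box 1 by move=> t [h _]; exact: sub h.
have PD : fine (P D) = F (y N.+1) - F (y N).
  have PDE : P D = (P (segment_box (y N.+1)) - P (segment_box (y N.+1) `&` segment_box (y N)))%E.
    apply: measureD => //; apply: le_lt_trans (probability_le1 _ _) (ltry 1).
    exact: mB.
  by rewrite PDE setIidr ?PF ?yge0//; exact: sub.
have osc' t : D t -> `|g (tnth t ord0) - g (y N.+1)| <= e.
  move=> [/segment_boxP/andP[t0 tN1] /segment_boxP ntN]; apply: osc => //.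
  by rewrite ltNge; apply/negP => tN; apply: ntN; rewrite t0.
have := step D (g (y N.+1)) mD D1 osc'; rewrite PD => sD.
have BU : segment_box (y N.+1) = segment_box (y N) `|` D.
  apply/seteqP; split=> [t tN1|t [|[]//]]; last exact: sub.
  by have [tN|tN] := pselect (segment_box (y N) t); [left|right].
rewrite [X in Rintegral _ X]BU Rintegral_setU//; last 2 first.
- by apply: gIx; [exact: measurableU|move=> t [h|/D1//]; exact: sub h].
- by apply/disj_setPS => t [h [_ nh]].
rewrite /=; set I1 := Rintegral _ _ _; set I2 := Rintegral _ _ _.
have -> : I1 + I2 - (stieltjes_sum g F y N + g (y N.+1) * (F (y N.+1) - F (y N))) =
  (I1 - stieltjes_sum g F y N) + (I2 - g (y N.+1) * (F (y N.+1) - F (y N))) by ring.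
apply: (le_trans (ler_normD _ _)); apply: (le_trans (lerD IH sD)).
by rewrite -mulrDr addrCA subrr addr0.
Qed.

(** The Helly-Bray argument. Convergence at 0 is a separate hypothesis because the limit may have an
    atom there. *)
Lemma weak_cvg_of_cdf n (P_ : nat -> probability (n.-tuple R) R)
    (P : probability (n.-tuple R) R) (F_ : nat -> R -> R) (F : R -> R) (D : set R) :
  n = 1%N ->
  (forall j u, cube n u -> forall i, P_ j (box u) = (F_ j (tnth u i))%:E) ->
  (forall u, cube n u -> forall i, P (box u) = (F (tnth u i))%:E) ->
  (forall j, F_ j 1 = 1) -> F 1 = 1 ->
  F_ j 0 @[j --> \oo] --> F 0 ->
  (forall y, D y -> 0 < y < 1 -> F_ j y @[j --> \oo] --> F y) ->
  (forall a b, 0 <= a -> a < b -> b <= 1 -> exists2 y, D y & a < y < b) ->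
  weak_cvg P_ P.
Proof.
move=> n1; subst n => PF_ PF F_1 F1 F0 FD Dd f fc.
pose g (x : R) := f (const_mx x).
have gE (t : 1.-tuple R) : f (\row_i tnth t i) = g (tnth t ord0).
  by congr f; apply/rowP => i; rewrite !mxE ord1.
have gc : {within `[0%R, 1%R], continuous g}.
  apply/subspace_continuousP => x; rewrite /= in_itv/= => x01.
  have cx : [set v : 'rV[R]_1 | forall i, 0 <= v ord0 i <= 1] (const_mx x).
    by move=> i; rewrite mxE.
  have := (subspace_continuousP _ _).1 fc _ cx.
  move=> /cvgrPdist_lt fx; apply/cvgrPdist_lt => e e0.
  have [/= r r0 Hr] := fx _ e0.
  have := r0 ord0 ord0; rewrite mxE; apply: filterS => y ry.
  rewrite /= in_itv/= => y01.
  apply: Hr => /=; last by move=> i; rewrite mxE.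
  by move=> i j; rewrite !ord1 mxE.
have gI (Q : probability (1.-tuple R) R) :
    Q.-integrable (segment_box 1) (fun t => (g (tnth t ord0))%:E).
  apply: measurable_bounded_integrable.
  - exact: measurable_box.
  - by apply: le_lt_trans (probability_le1 _ _) (ltry 1); exact: measurable_box.
  - have mg : measurable_fun ([set` `[0%R, 1%R]%R] : set R) g.
      by apply: subspace_continuous_measurable_fun => //; exact: measurable_itv.
    apply: (measurable_comp _ _ mg) => //.
      by move=> _ [t /segment_boxP t1 <-]; rewrite /= in_itv.
    by apply: measurable_funTS; exact: measurable_tnth.
  - have := continuous_compact gc (@segment_compact R 0 1).
    move=> /compact_bounded[M [Mr HM]]; exists M; split=> // K MK t /segment_boxP t1.
    by apply: (HM K MK); exists (tnth t ord0) => //; rewrite /= in_itv.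
have cubeS : cube 1 = segment_box 1 by rewrite cubeE.
have PB_ j x : 0 <= x <= 1 -> P_ j (segment_box x) = (F_ j x)%:E.
  by move=> x01; rewrite (PF_ _ _ _ ord0) ?tnth_mktuple// => i; rewrite tnth_mktuple.
have PB x : 0 <= x <= 1 -> P (segment_box x) = (F x)%:E.
  by move=> x01; rewrite (PF _ _ ord0) ?tnth_mktuple// => i; rewrite tnth_mktuple.
have IE (Q : probability (1.-tuple R) R) :
    (\int[Q]_(t in cube 1) (f (\row_i tnth t i))%:E)%E =
    (\int[Q]_(t in segment_box 1) g (tnth t ord0))%:E.
  rewrite /Rintegral fineK; last first.
    by apply: integrable_fin_num; [exact: measurable_box|exact: gI].
  by rewrite cubeS; apply: eq_integral => t _; rewrite gE.
rewrite IE; under eq_fun do rewrite IE.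
apply/cvg_EFin; first by near=> j.
apply/cvgrPdist_lt => e e0.
have e40 : 0 < e / 4 by rewrite divr_gt0.
have [del del0 Hdel] := unit_segment_uniformly_continuous gc e40.
(* The partition consists of 0, one point of [D] inside each of [N] equal cells, and 1. Neighbours
   are less than [2 / N] apart, hence the factor 2. *)
pose N := (Num.truncn (2 / del)).+1.
have N0 : (0 : R) < N%:R by rewrite ltr0n.
have Ndel : 2 / N%:R < del by rewrite ltr_pdivrMr// mulrC -ltr_pdivrMr// truncnS_gt.
have exy k : exists y : R, (k < N)%N -> D y /\ k%:R / N%:R < y < k.+1%:R / N%:R.
  have [kN|] := boolP (k < N)%N; last by exists 0.
  have [|||y Dy yk] := Dd (k%:R / N%:R) (k.+1%:R / N%:R).
  - by rewrite divr_ge0.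
  - by rewrite ltr_pM2r ?invr_gt0// ltr_nat.
  - by rewrite ler_pdivrMr// mul1r ler_nat.
  by exists y.
have [c cP] := choice exy.
pose y k := if k is k'.+1 then (if (k' < N)%N then c k' else 1) else 0.
have N1 : (1 : R) / N%:R + 1 / N%:R = 2 / N%:R by rewrite -mulrDl.
have kN_ (k : nat) : k.+1%:R / N%:R = k%:R / N%:R + 1 / N%:R :> R.
  by rewrite -natr1 mulrDl.
have yk k : (k < N)%N -> D (y k.+1) /\ k%:R / N%:R < y k.+1 < k.+1%:R / N%:R.
  by move=> kN; rewrite /y kN; exact: cP.
have yN : y N.+1 = 1 by rewrite /y ltnn.
have gap k : (k <= N)%N -> y k <= y k.+1 /\ y k.+1 - y k < del.
  case: k => [_|k kN].
    have [_ /andP[h1 h2]] := yk 0%N isT.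
    rewrite mul0r in h1; rewrite [y 0%N]/= subr0; split; first exact: ltW.
    by apply: lt_trans h2 _; apply: lt_trans Ndel; rewrite ltr_pM2r ?invr_gt0// ltr_nat.
  have [_ /andP[h1 h2]] := yk k kN.
  move: kN; rewrite leq_eqVlt => /predU1P[kN|kN].
    have yk1 : y k.+2 = 1 by rewrite -kN in yN *; rewrite yN.
    have NN : k.+1%:R / N%:R = 1 :> R by rewrite kN divff// gt_eqF.
    rewrite NN in h2; have := kN_ k; rewrite NN => e1.
    have N1_gt0 : 0 < 1 / N%:R :> R by rewrite divr_gt0.
    rewrite yk1; split; first exact: ltW.
    by clear - h1 e1 N1 Ndel N1_gt0; lra.
  have [_ /andP[h3 h4]] := yk k.+1 kN.
  have := kN_ k; have := kN_ k.+1 => e1 e2; clear - h1 h2 h3 h4 e1 e2 N1 Ndel.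
  by split; lra.
have yle1 k : (k <= N)%N -> 0 <= y k <= 1.
  case: k => [|k] kN; first by rewrite lexx ler01.
  have [_ /andP[h1 h2]] := yk k kN; apply/andP; split.
    by apply: ltW; apply: le_lt_trans h1; rewrite divr_ge0.
  by apply: ltW; apply: lt_le_trans h2 _; rewrite ler_pdivrMr// mul1r ler_nat.
have yle1' k : (k <= N.+1)%N -> 0 <= y k <= 1.
  by rewrite leq_eqVlt => /predU1P[->|]; [rewrite yN ler01 lexx|exact: yle1].
have osc k t : (k < N.+1)%N -> y k < t -> t <= y k.+1 -> `|g t - g (y k.+1)| <= e / 4.
  move=> kN kt tk; apply: ltW; have /andP[a1 a2] := yle1' k (ltnW kN).
  have /andP[a3 a4] := yle1' k.+1 kN.
  apply: Hdel; first by rewrite (ltW (le_lt_trans a1 kt)) (le_trans tk).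
    by rewrite a3 a4.
  have [_ h] := gap k kN; apply: le_lt_trans h; rewrite distrC ger0_norm ?subr_ge0//.
  by rewrite lerD2l lerN2 ltW.
have close (Q : probability (1.-tuple R) R) G :
    (forall x, 0 <= x <= 1 -> Q (segment_box x) = (G x)%:E) -> G 1 = 1 ->
    `|\int[Q]_(t in segment_box 1) g (tnth t ord0) - stieltjes_sum g G y N.+1| <= e / 4.
  move=> QG G1; have := @stieltjes_sum_close Q G g (e / 4) y N.+1 QG (gI Q) (ltW e40) erefl.
  rewrite {1}yN (_ : y N.+1 = 1)// G1 mulr1; apply => //.
  by move=> k kN; have [] := gap k kN.
have Scvg k : (k <= N.+1)%N ->
    stieltjes_sum g (F_ j) y k @[j --> \oo] --> stieltjes_sum g F y k.
  have Fy i : (i <= N.+1)%N -> F_ j (y i) @[j --> \oo] --> F (y i).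
    case: i => [_|i]; first exact: F0.
    rewrite ltnS leq_eqVlt => /predU1P[->|iN].
      by rewrite yN F1; under eq_fun do rewrite F_1; exact: cvg_cst.
    have [Dy /andP[h1 h2]] := yk i iN; apply: FD => //; apply/andP; split.
      by apply: le_lt_trans h1; rewrite divr_ge0.
    by apply: lt_le_trans h2 _; rewrite ler_pdivrMr// mul1r ler_nat.
  elim: k => [_|k IH kN]; first by apply: cvgMl_tmp; exact: Fy.
  apply: cvgD; first exact: IH (ltnW kN).
  by apply: cvgMl_tmp; apply: cvgB; apply: Fy => //; exact: ltnW.
have h1 := close _ _ PB F1.
near=> j.
have h2 := close _ _ (PB_ j) (F_1 j).
have h3 : `|stieltjes_sum g F y N.+1 - stieltjes_sum g (F_ j) y N.+1| < e / 4.
  by near: j; apply: (cvgrPdist_lt _ _).1 e40; exact: Scvg.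
rewrite [X in _ - X]/=; move: h1 h2 h3; clear -e0.
set I1 := Rintegral _ _ _; set I2 := Rintegral _ _ _.
rewrite !ler_norml !ltr_norml => /andP[? ?] /andP[? ?] /andP[? ?].
by apply/andP; split; lra.
Unshelve. all: by end_near. Qed.

End weak_convergence.

(** * Measures and kernels of Archimedean copulas *)

Section tail_chain.
Context {R : realType}.

(* [F 0] is a not necessarily normalized generator and [F j] its [j]-th
   derivative with the sign [(-1)^j], one-sided for [j = m]. The generators of
   conditional copulas extend to the left of [0], so that nothing has to be said
   about derivatives at [0]. *)
Record tail_chain (a : R) (m : nat) (F : nat -> R -> R) (tau : R -> R) : Prop := {
  tc_lt0 : a < 0;
  tc_slopes : forall j, (j < m)%N -> slopes a (F j) (F j.+1);
  tc_gt0 : forall j z, (j <= m)%N -> a < z -> 0 < F j z;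
  tc_cvg0 : forall j, (j <= m)%N -> F j z @[z --> +oo] --> 0;
  tc_bij : dec_bij (F 0%N) tau;
  tc_left : forall z : R, a < z -> F m w @[w --> z^'-] --> F m z }.

(** The case split replaces the value 0 of a generator at infinity, so [tau] matters only on
    (0,1]. *)
Definition arch_value (F0 tau : R -> R) (n : nat) (u : n.-tuple R) : R :=
  if [forall i, 0 < tnth u i] then F0 (\sum_(i < n) tau (tnth u i)) else 0.

(* The value of [K(s, [0,y])] at points [s] with [t = \sum_i tau s_i]. *)
Definition kernel_cdf (Fm tau : R -> R) (t y : R) : R :=
  if 0 < y then Fm (t + tau y) / Fm t else 0.

Definition zeros (n : nat) : n.-tuple R := [tuple 0 | _ < n].

Variables (a : R) (m : nat) (F : nat -> R -> R) (tau : R -> R).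
Hypothesis m0 : (0 < m)%N.
Hypothesis TC : tail_chain a m F tau.

Let B := tc_bij TC.
Let a0 := tc_lt0 TC.

Lemma tc_ge0_gt0 j z : (j <= m)%N -> 0 <= z -> 0 < F j z.
Proof. by move=> jm z0; apply: (tc_gt0 TC) => //; exact: lt_le_trans z0. Qed.

Lemma tc_nonincreasing z w : 0 <= z -> z <= w -> F m w <= F m z.
Proof.
have := tc_slopes TC (j := m.-1); rewrite prednK// leqnn => /(_ isT) S.
by move=> z0 zw; apply: (slopes_nonincreasing S) => //; exact: lt_le_trans z0.
Qed.

Lemma measurable_tc_max : measurable_fun setT (fun t : R => F m (Num.max 0 t)).
Proof.
have := tc_slopes TC (j := m.-1); rewrite prednK// leqnn => /(_ isT) S.
exact: slopes_measurable_max S a0.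
Qed.

Lemma measurable_tc0_max : measurable_fun setT (fun t : R => F 0%N (Num.max 0 t)).
Proof.
apply: nonincreasing_measurable => // s t st.
have ge0 (x : R) : 0 <= Num.max 0 x by rewrite le_max lexx.
by rewrite (db_le B) ?ge0// ge_max ge0/= le_max st orbT.
Qed.

(** Right-continuity in [y > 0] is left-continuity of [F m] at [t + tau y], as [tau] decreases. At
    [y = 0] it is the decay of [F m] at infinity. *)
Lemma kernel_cdf_measure n t : n = 1%N -> 0 <= t ->
  exists P : probability (n.-tuple R) R,
    forall u, cube n u -> forall i, P (box u) = (kernel_cdf (F m) tau t (tnth u i))%:E.
Proof.
move=> n1 t0; have Ft0 : 0 < F m t by exact: tc_ge0_gt0.
have tau0 y : 0 < y -> y <= 1 -> 0 <= tau y by move=> y0 y1; rewrite (db_inv_ge0 B)// y0.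
have Fty y : 0 < y -> y <= 1 -> 0 < F m (t + tau y).
  by move=> y0 y1; apply: tc_ge0_gt0 => //; rewrite addr_ge0// tau0.
apply: quantile_measure => //.
- move=> y z y0 yz z1; rewrite /kernel_cdf; case: ltP => [y_gt0|_]; last first.
    by case: ltP => // z_gt0; rewrite divr_ge0 ?ltW// Fty.
  have z_gt0 := lt_le_trans y_gt0 yz; have y1 := le_trans yz z1; rewrite z_gt0.
  rewrite ler_pM2r ?invr_gt0//; apply: tc_nonincreasing.
    by rewrite addr_ge0// tau0.
  by rewrite lerD2l (db_inv_le B) ?y_gt0 ?z_gt0.
- by rewrite /kernel_cdf ltxx.
- by rewrite /kernel_cdf ltr01 (db_inv1 B) addr0 divff// gt_eqF.
- move=> y e y0 y1 e0; rewrite {2}/kernel_cdf.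
  have eF : 0 < e * F m t by rewrite mulr_gt0.
  case: ltP => [y_gt0|y_le0].
    have y01 : 0 < y < 1 by rewrite y_gt0.
    have y01' : 0 < y <= 1 by rewrite y_gt0 ltW.
    have ty := db_inv_gt0 B y01.
    have aty : a < t + tau y by apply: lt_trans a0 _; rewrite ltr_wpDl.
    have [/= r r0 Hr] := (cvgrPdist_lt _ _).1 (tc_left TC aty) _ eF.
    pose h := Num.min (r / 2) (tau y / 2).
    have h0 : 0 < h by rewrite lt_min !divr_gt0.
    have hr : h < r by rewrite gt_min ltr_pdivrMr// ltr_pMr// ltr1n.
    have hy : h < tau y by rewrite gt_min [X in _ || X]ltr_pdivrMr// ltr_pMr// ltr1n orbT.
    have w0 : 0 <= tau y - h by rewrite subr_ge0 ltW.
    have w01 := db_in01 B w0.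
    exists (F 0%N (tau y - h)); split.
    + by rewrite -[ltLHS](db_invK B y01') (db_lt B)// ?gtrBl// ltW.
    + by case/andP: w01.
    + rewrite /kernel_cdf; case/andP: w01 => -> _; rewrite (db_K B)//.
      have := Hr (t + (tau y - h)); rewrite /= opprD addrACA subrr add0r opprB addrCA subrr addr0.
      rewrite gtr0_norm// => /(_ hr); rewrite ltrD2l gtrBl => /(_ h0).
      rewrite ltr_norml => /andP[lt1 _].
      rewrite ltr_pdivrMr// mulrDl divfK ?gt_eqF// -ltrBlDl.
      by move: lt1; rewrite ltrNl opprB.
  have yE : y = 0 by apply: le_anti; rewrite y_le0 y0.
  have [M [Mr HM]] := (cvgrPdist_lt _ _).1 (tc_cvg0 TC (leqnn m)) _ eF.
  pose w := Num.max 0 (M + 1).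
  have w0 : 0 <= w by rewrite le_max lexx.
  have Mw : M < t + w.
    by rewrite (@lt_le_trans _ _ (M + 1)) ?ltrDl// (@le_trans _ _ w) ?lerDr// le_max lexx orbT.
  have w01 := db_in01 B w0.
  exists (F 0%N w); split; [by rewrite yE; case/andP: w01|by case/andP: w01|].
  rewrite add0r /kernel_cdf; case/andP: w01 => -> _; rewrite (db_K B)//.
  rewrite ltr_pdivrMr//; have := HM _ Mw; rewrite sub0r normrN gtr0_norm//.
  by apply: tc_ge0_gt0 => //; rewrite addr_ge0.
Qed.

Lemma measurable_tc_inv : measurable_fun setT (tau \_ `]0%R, 1%R]).
Proof.
have mI : measurable ([set` `]0%R, 1%R]%R] : set R) by exact: measurable_itv.
apply/(measurable_restrictT _ mI).
apply: (measurability (@RGenCInfty.G R)) => [|/= _ [_] [r] -> <-].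
  exact: RGenCInfty.measurableE.
apply: is_interval_measurable => s t /= [].
rewrite !in_itv/= !andbT => /andP[s0 s1] fs [/andP[t0 t1] ft] u /andP[su ut].
have u0 : 0 < u by exact: lt_le_trans su.
have u1 : u <= 1 by exact: le_trans t1.
split; first by rewrite in_itv/= u0.
by rewrite in_itv/= andbT (le_trans ft)// (db_inv_le B) ?u0 ?t0.
Qed.

Lemma upper_orthant0P n (z : n.-tuple R) :
  upper_orthant (zeros n) z <-> forall i, 0 <= tnth z i.
Proof. by split=> h i; have := h i; rewrite tnth_mktuple. Qed.

Lemma tsum_ge0 n (z : n.-tuple R) : upper_orthant (zeros n) z -> 0 <= tsum z.
Proof. by move=> /upper_orthant0P h; apply: sumr_ge0. Qed.

Lemma eq_tail_integral (s : seq R) (G H : R -> \bar R) :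
  (forall t, 0 <= t -> G t = H t) -> (forall x, x \in s -> 0 <= x) ->
  tail_integral s G = tail_integral s H.
Proof.
elim: s G H => [|x s IH] G H GH s0 /=; first exact: GH.
apply: eq_integral => t; rewrite inE /= in_itv/= andbT => xt.
have t0 : 0 <= t by apply: le_trans xt; apply: s0; rewrite mem_head.
apply: IH => [w w0|w ws]; first by apply: GH; rewrite addr_ge0.
by apply: s0; rewrite in_cons ws orbT.
Qed.

Local Notation L := (@tuple_lebesgue R m).
Local Notation D0 := (upper_orthant (zeros m)).

(** On the orthant the clamp changes nothing; elsewhere it keeps the formula measurable and
    nonnegative. *)
Let p (z : m.-tuple R) : R := F m (Num.max 0 (tsum z)) * \1_D0 z.

Lemma integral_tc_upper_orthant (u : m.-tuple R) : (forall i, 0 <= tnth u i) ->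
  (\int[L]_(z in upper_orthant u) (F m (Num.max 0 (tsum z)))%:E)%E
    = (F 0%N (\sum_(i < m) tnth u i))%:E.
Proof.
move=> u0.
have mG : measurable_fun setT (fun t : R => (F m (Num.max 0 t))%:E).
  by apply/measurable_EFinP; exact: measurable_tc_max.
have G0 (t : R) : (0 <= (F m (Num.max 0 t))%:E)%E.
  by rewrite lee_fin ltW// tc_ge0_gt0// le_max lexx.
rewrite (integral_tuple_lebesgue u mG G0).
have us x : x \in (u : seq R) -> 0 <= x by move=> /tnthP[i ->].
rewrite (eq_tail_integral (H := fun t => (F m (0 + t))%:E))//; last first.
  by move=> t t0; rewrite add0r max_r.
rewrite -[X in F X](size_tuple u) (tail_integral_slopes (a0 := a)) ?size_tuple//.
- by rewrite add0r big_tuple.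
- exact: (tc_slopes TC).
- exact: (tc_gt0 TC).
- exact: (tc_cvg0 TC).
Qed.

Let mp : measurable_fun setT p.
Proof.
apply: measurable_funM.
  by apply: (measurableT_comp measurable_tc_max); exact: measurable_tsum.
by apply: measurable_indic; exact: measurable_upper_orthant.
Qed.

Let p0 z : 0 <= p z.
Proof. by rewrite /p mulr_ge0// ltW// tc_ge0_gt0// le_max lexx. Qed.

Let pE (D : set (m.-tuple R)) : D `<=` D0 ->
  (\int[L]_(z in D) (p z)%:E = \int[L]_(z in D) (F m (Num.max 0 (tsum z)))%:E)%E.
Proof.
by move=> D0'; apply: eq_integral => z /set_mem/D0' zD; rewrite /p indicE mem_set// mulr1.
Qed.

Let pI (D : set (m.-tuple R)) :
  (\int[L]_(z in D) (p z)%:E = \int[L]_(z in D `&` D0) (p z)%:E)%E.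
Proof.
rewrite integral_mkcond [RHS]integral_mkcond; apply: eq_integral => z _.
rewrite !patchE in_setI; case: (z \in D) => //=; case: ifPn => // zD.
by rewrite /p indicE (negbTE zD) mulr0.
Qed.

Let p1 : (\int[L]_z (p z)%:E = 1)%E.
Proof.
rewrite pI setTI pE// integral_tc_upper_orthant; last by move=> i; rewrite tnth_mktuple.
by rewrite big1 ?(db_at0 B)// => i _; rewrite tnth_mktuple.
Qed.

Definition tc_point (z : m.-tuple R) : m.-tuple R :=
  [tuple F 0%N (Num.max 0 (tnth z i)) | i < m].

Lemma measurable_tc_point : measurable_fun setT tc_point.
Proof.
apply/measurable_fun_tnthP => i.
rewrite (_ : _ \o _ = fun z => F 0%N (Num.max 0 (tnth z i))).
  by apply: (measurableT_comp measurable_tc0_max); exact: measurable_tnth.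
by apply/funext => z; rewrite /= tnth_mktuple.
Qed.

(** Under [z_i |-> F 0 z_i] the box with corner [u] pulls back to the orthant [z_i >= tau u_i],
    where the density integrates to [F 0] of the sum of the [tau u_i]. A zero coordinate of [u]
    gives the empty set since [F 0] is positive. *)
Lemma tc_copula_measure : exists M : probability (m.-tuple R) R,
  induces (@arch_value (F 0%N) tau m) M /\
  forall h : m.-tuple R -> \bar R, measurable_fun setT h -> (forall s, 0 <= h s)%E ->
    (\int[M]_s h s =
     \int[L]_(z in D0) (h (tc_point z) * (F m (tsum z))%:E))%E.
Proof.
exists (image_density_probability mp p0 p1 measurable_tc_point); split.
  move=> u u01; rewrite /image_density_probability /= /image_density pI.
  rewrite /arch_value; case: ifPn => [/forallP u0|/forallPn[i ui]]; last first.
    rewrite (_ : _ `&` _ = set0) ?integral_set0//.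
    rewrite -subset0 => z [/(_ i)]; rewrite tnth_mktuple => /andP[_ zi] _.
    move: ui; rewrite (lt_le_trans _ zi)// (db_gt0 B)// le_max lexx//.
  have u01' i : 0 < tnth u i <= 1 by rewrite u0; case/andP: (u01 i).
  pose v := [tuple tau (tnth u i) | i < m].
  rewrite (_ : _ `&` _ = upper_orthant v); last first.
    apply/seteqP; split=> [z [zX /upper_orthant0P z0] i|z zv].
      have := zX i; rewrite !tnth_mktuple max_r// => /andP[_ h].
      by rewrite -(db_le B (db_inv_ge0 B (u01' i)) (z0 i)) (db_invK B).
    have z0 i : 0 <= tnth z i.
      by have := zv i; rewrite tnth_mktuple; apply: le_trans; exact: (db_inv_ge0 B).
    split; last exact/upper_orthant0P.
    move=> i; rewrite tnth_mktuple max_r// (ltW (db_gt0 B (z0 i)))/=.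
    rewrite -[leRHS](db_invK B (u01' i)) (db_le B)//; last exact: (db_inv_ge0 B).
    by have := zv i; rewrite tnth_mktuple.
  rewrite pE; last first.
    move=> z zv; apply/upper_orthant0P => i; have := zv i; rewrite tnth_mktuple.
    by apply: le_trans; exact: (db_inv_ge0 B).
  rewrite integral_tc_upper_orthant; last first.
    by move=> i; rewrite tnth_mktuple; exact: (db_inv_ge0 B).
  by congr (F 0%N _)%:E; apply: eq_bigr => i _; rewrite tnth_mktuple.
move=> h mh h0; rewrite ge0_integral_image_density//.
rewrite [RHS]integral_mkcond; apply: eq_integral => z _.
rewrite patchE /p indicE; case: ifPn => [/set_mem zD|zD]; rewrite ?mulr0 ?mule0//.
by rewrite mulr1 max_r// tsum_ge0.
Qed.

Lemma tc_sum_inv (z : m.-tuple R) : D0 z ->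
  \sum_(i < m) tau (tnth (tc_point z) i) = tsum z.
Proof.
move=> /upper_orthant0P z0; apply: eq_bigr => i _.
by rewrite tnth_mktuple max_r// (db_K B).
Qed.

Lemma tsum_countable_null (N : set R) : countable N ->
  L (D0 `&` [set z | N (tsum z)]) = 0%E.
Proof.
move=> cN; have mN : measurable N by exact: countable_measurable.
have mNs : measurable [set z : m.-tuple R | N (tsum z)].
  by rewrite -[X in measurable X]setTI; exact: measurable_tsum.
have mG : measurable_fun setT (fun t : R => (\1_N t)%:E : \bar R).
  by apply/measurable_EFinP; exact: measurable_indic.
have G0 (t : R) : (0 <= (\1_N t)%:E :> \bar R)%E by rewrite lee_fin.
have TI : tail_integral (zeros m) (fun t : R => (\1_N t)%:E : \bar R) = 0%E.
  have h := @tail_integral_countable R N (fun t => (\1_N t)%:E) 0 (zeros m) cN mG G0.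
  rewrite -[RHS]h ?size_tuple//; last by move=> t Nt; rewrite indicE memNset.
  by congr tail_integral; apply/funext => t; rewrite add0r.
rewrite -TI -(integral_tuple_lebesgue (zeros m) mG G0).
by rewrite setIC -integral_indic//; exact: measurable_upper_orthant.
Qed.

Definition discontinuities : set R := [set z : R | 0 <= z /\ ~ {for z, continuous (F m)}].

Lemma countable_discontinuities : countable discontinuities.
Proof.
(* A point strictly between [a] and 0 makes 0 interior to the intervals on which monotone functions
   have countably many jumps. *)
pose b := a / 2.
have an := a0; have ab : a < b by rewrite /b; lra.
have b0 : b < 0 by rewrite /b; lra.
have := tc_slopes TC (j := m.-1); rewrite prednK// leqnn => /(_ isT) S.
have nd (n : nat) : {in `[b, n%:R] &, nondecreasing_fun (fun z => - F m z)}.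
  move=> z w; rewrite !in_itv/= => /andP[bz _] _ zw; rewrite lerN2.
  by apply: (slopes_nonincreasing S) => //; exact: lt_le_trans bz.
apply: (@sub_countable _ _ _ (\bigcup_(n : nat)
    [set z | z \in `]b, (n%:R : R)[%R /\ discontinuity (fun z => - F m z) z])); last first.
  by apply: bigcup_countable => // n _; exact: discontinuity_countable (nd n).
apply: subset_card_le => z [z0 nc].
have bz : b < z by exact: lt_le_trans z0.
exists (Num.truncn z).+1 => //; split; first by rewrite in_itv/= bz truncnS_gt.
have cl : - F m w @[w --> z^'-] --> - F m z.
  by apply: cvgN; apply: (tc_left TC); exact: lt_trans bz.
have cr : cvg (- F m w @[w --> z^'+]).
  apply: nondecreasing_at_right_is_cvgr; near=> w.
    move=> s t; rewrite !in_itv/= => /andP[zs _] /andP[zt _] st; rewrite lerN2.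
    by apply: (slopes_nonincreasing S) => //; apply: lt_trans zs; exact: lt_trans bz.
  exists (- F m z) => t' [t /= tI <-{t'}].
  move: tI; rewrite in_itv/= => /andP[zt _]; rewrite lerN2.
  apply: (slopes_nonincreasing S); [exact: lt_trans bz|exact: ltW].
split=> //; first by apply/cvg_ex; exists (- F m z).
rewrite (cvg_lim _ cl)//; apply/eqP => e; apply: nc.
have : - F m w @[w --> z] --> - F m z.
  by apply/left_right_continuousP; split => //; rewrite e.
move=> c; have c' : - - F m w @[w --> z] --> - - F m z by apply: cvgN.
rewrite /prop_for /continuous_at; move: c'; rewrite opprK.
by under eq_fun do rewrite opprK.
Unshelve. all: by end_near. Qed.

Lemma continuity_point_between (s t : R) : 0 <= s -> s < t ->
  exists2 z, s < z < t & {for z, continuous (F m)}.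
Proof.
move=> s0 st; apply: contrapT => H.
have : (@lebesgue_measure R (`]s, t[ : set R) = 0)%E.
  apply: countable_lebesgue_measure0.
  apply: (sub_countable _ countable_discontinuities); apply: subset_card_le.
  move=> z /=; rewrite in_itv/= => /andP[sz zt]; split.
    exact: ltW (le_lt_trans s0 sz).
  by move=> cz; apply: H; exists z => //; rewrite sz.
rewrite lebesgue_measure_itv/= lte_fin st -EFinD => /eqP.
by rewrite eqe subr_eq0 gt_eqF.
Qed.

End tail_chain.

(** * Convergence of integrals dominated by probability densities *)

Section scheffe.
Context {R : realType}.

Lemma minr_dist_le (x y c : R) : `|Num.min x c - Num.min y c| <= `|x - y|.
Proof.
have h1 := ler_norm (x - y); have h2 := ler_norm (y - x).
rewrite distrC in h2; have h3 := normr_ge0 (x - y).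
rewrite /Num.min ler_norml; case: ltP => xc; case: ltP => yc;
  by apply/andP; split; lra.
Qed.

Lemma cvg_minr (u : nat -> R) (l c : R) : u n @[n --> \oo] --> l ->
  Num.min (u n) c @[n --> \oo] --> Num.min l c.
Proof.
move=> ul; apply/cvgrPdist_lt => e e0; near=> n.
apply: le_lt_trans (minr_dist_le _ _ _) _.
by near: n; exact: (cvgrPdist_lt _ _).1 e0.
Unshelve. all: by end_near. Qed.

Variables (dd : measure_display) (T : measurableType dd) (nu : {measure set T -> \bar R}).
Variables (D N : set T) (p_ h_ : nat -> T -> R) (p h : T -> R).
Hypotheses (mD : measurable D) (mN : measurable N) (N0 : nu N = 0%E).
Hypotheses (mp_ : forall n, measurable_fun D (p_ n)) (mp : measurable_fun D p).
Hypotheses (mh_ : forall n, measurable_fun D (h_ n)) (mh : measurable_fun D h).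
Hypothesis h_0 : forall n x, D x -> 0 <= h_ n x.
Hypothesis h0 : forall x, D x -> 0 <= h x.
Hypothesis hp_ : forall n x, D x -> h_ n x <= p_ n x.
Hypothesis p_1 : forall n, (\int[nu]_(x in D) (p_ n x)%:E = 1)%E.
Hypothesis p0 : forall x, D x -> 0 <= p x.
Hypothesis p1 : (\int[nu]_(x in D) (p x)%:E = 1)%E.
Hypothesis pp : forall x, D x -> ~ N x -> p_ n x @[n --> \oo] --> p x.
Hypothesis hh : forall x, D x -> ~ N x -> h_ n x @[n --> \oo] --> h x.

(* Scheffe's argument: dominated convergence for [min (h_ n) p], and
   [h_ n - min (h_ n) p <= p_ n - min (p_ n) p], whose integral tends to [0]. *)
Lemma dominated_by_densities_cvg :
  (\int[nu]_(x in D) (h_ n x)%:E @[n --> \oo] --> \int[nu]_(x in D) (h x)%:E)%E.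
Proof.
pose E := D `\` N.
have mE : measurable E by exact: measurableD.
have ED : E `<=` D by exact: subDsetl.
have mEF (f : T -> R) : measurable_fun D f -> measurable_fun E (fun x => (f x)%:E).
  by move=> mf; apply/measurable_EFinP; exact: measurable_funS mf.
have red (f : T -> R) : measurable_fun D f -> (forall x, D x -> 0 <= f x) ->
    (\int[nu]_(x in D) (f x)%:E = \int[nu]_(x in E) (f x)%:E)%E.
  move=> mf f0; apply: ge0_negligible_integral => //; first exact/measurable_EFinP.
have p_0 n x : D x -> 0 <= p_ n x by move=> Dx; apply: le_trans (hp_ n Dx); exact: h_0.
have p1E : (\int[nu]_(x in E) (p x)%:E = 1)%E by rewrite -red.
have p_1E n : (\int[nu]_(x in E) (p_ n x)%:E = 1)%E by rewrite -red//; exact: p_0.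
rewrite red//; under eq_fun do rewrite (red _ (mh_ _) (h_0 _)).
have mmin (f : T -> R) : measurable_fun D f ->
    measurable_fun E (fun x => (Num.min (f x) (p x))%:E).
  by move=> mf; apply: mEF; exact: measurable_minr.
have pI : nu.-integrable E (fun x => (p x)%:E).
  apply/integrableP; split; first exact: mEF.
  rewrite (eq_integral (fun x => (p x)%:E)) ?p1E ?ltry// => x /set_mem xE.
  by rewrite gee0_abs// lee_fin p0//; exact: ED.
have dct (f_ : nat -> T -> R) (f : T -> R) : (forall n, measurable_fun D (f_ n)) ->
    (forall n x, D x -> 0 <= f_ n x) -> (forall x, E x -> f x <= p x) ->
    (forall x, E x -> f_ n x @[n --> \oo] --> f x) ->
    (\int[nu]_(x in E) (Num.min (f_ n x) (p x))%:E @[n --> \oo] -->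
     \int[nu]_(x in E) (f x)%:E)%E.
  move=> mf f0 fp ff; apply: (dominated_cvg mE (g := fun x => (p x)%:E)) => //.
  - by move=> n; exact: mmin.
  - move=> x Ex; apply: cvg_EFin; first by near=> n.
    rewrite -[X in _ --> X](min_l (fp x Ex)); apply: cvg_minr; exact: ff.
  - move=> n x Ex; rewrite gee0_abs lee_fin; first by rewrite ge_min lexx orbT.
    by rewrite le_min f0 ?p0//; exact: ED.
have hp x : E x -> h x <= p x.
  move=> [Dx Nx]; apply: (ler_cvg_to (hh Dx Nx) (pp Dx Nx)).
  by near=> n; exact: hp_.
have c1 := dct _ _ mh_ h_0 hp (fun x Ex => hh Ex.1 Ex.2).
have c2 : (\int[nu]_(x in E) (Num.min (p_ n x) (p x))%:E @[n --> \oo] --> 1)%E.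
  rewrite -p1E; apply: dct => // x [Dx Nx]; exact: pp.
have hI : (\int[nu]_(x in E) (h x)%:E \is a fin_num)%E.
  rewrite ge0_fin_numE; last by apply: integral_ge0 => x Ex; rewrite lee_fin h0//; exact: ED.
  apply: (@le_lt_trans _ _ 1%E); last exact: ltry.
  rewrite -p1E; apply: ge0_le_integral => //.
  - by move=> x Ex; rewrite lee_fin h0//; exact: ED.
  - exact: mEF.
  - exact: mEF.
pose lo n := (\int[nu]_(x in E) (Num.min (h_ n x) (p x))%:E)%E.
(* The bracket is the mass of [p_ n] above [p]; it bounds the part of [h_ n] above [p], and both
   [lo] and [up] have the desired limit. *)
pose up n := (lo n + (1 - \int[nu]_(x in E) (Num.min (p_ n x) (p x))%:E))%E.
apply: (@squeeze_cvge _ _ _ R lo _ up) => //; last first.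
  rewrite -[X in _ --> X]adde0 -[X in (_ + X)%E](@subee _ 1%E)//.
  apply: cvgeD => //; first by rewrite subee// fin_num_adde_defl.
  by apply: cvgeB => //; exact: cvg_cst.
near=> n; apply/andP; split.
  apply: ge0_le_integral => //.
  - by move=> x Ex; rewrite lee_fin le_min h_0 ?p0//; exact: ED.
  - exact: mmin.
  - exact: mEF.
  - by move=> x Ex; rewrite lee_fin ge_min lexx.
have minI : (\int[nu]_(x in E) (Num.min (p_ n x) (p x))%:E \is a fin_num)%E.
  rewrite ge0_fin_numE; last first.
    by apply: integral_ge0 => x Ex; rewrite lee_fin le_min p_0 ?p0//; exact: ED.
  apply: (@le_lt_trans _ _ 1%E); last exact: ltry.
  rewrite -p1E; apply: ge0_le_integral => //.
  - by move=> x Ex; rewrite lee_fin le_min p_0 ?p0//; exact: ED.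
  - exact: mmin.
  - exact: mEF.
  - by move=> x Ex; rewrite lee_fin ge_min lexx orbT.
have h_E n' x : E x -> 0 <= h_ n' x by move=> /ED; exact: h_0.
have p_E n' x : E x -> 0 <= p_ n' x by move=> /ED; exact: p_0.
have pE x : E x -> 0 <= p x by move=> /ED; exact: p0.
rewrite /up /lo addeA leeBrDr// -(p_1E n) -!ge0_integralD//;
  try exact: mEF; try exact: mmin;
  try by move=> x Ex; rewrite lee_fin ?le_min ?h_E ?p_E ?pE.
apply: ge0_le_integral => //.
- move=> x Ex; rewrite -EFinD lee_fin addr_ge0//; first by rewrite h_0//; exact: ED.
  by rewrite le_min p_0 ?p0//; exact: ED.
- by apply: emeasurable_funD; [exact: mEF|exact: mmin].
- by apply: emeasurable_funD; [exact: mmin|exact: mEF].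
- move=> x Ex; rewrite -!EFinD lee_fin.
  have hpx := hp_ n (ED _ Ex).
  case: (leP (p x) (h_ n x)) => [ph|hp'].
    by rewrite min_r ?(le_trans ph)// addrC lerD2l.
  by rewrite lerD2l ge_min lexx.
Unshelve. all: by end_near. Qed.

End scheffe.

(** * Kernels and dependence measure in terms of a chain of derivatives *)

Section kernel_model.
Context {R : realType}.

Definition interior_point (n : nat) (s : n.-tuple R) : bool :=
  0 < \big[Num.min/1]_(i < n) tnth s i < 1.

Lemma interior_pointP n (s : n.-tuple R) :
  interior_point s <-> (forall i, 0 < tnth s i) /\ (exists i, tnth s i < 1).
Proof.
split=> [/andP[/bigmin_gtP[_ h0] h1]|[h0 [i hi]]].
  split=> [i|]; first exact: h0.
  apply: contrapT => /forallNP H; move: h1; rewrite ltNge => /negP; apply.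
  by apply/bigmin_geP; split=> // i _; rewrite leNgt; apply/negP; exact: H.
apply/andP; split; first by apply/bigmin_gtP; split=> // j _.
exact: le_lt_trans (bigmin_le _ _ _) hi.
Qed.

Lemma measurable_interior_point n : measurable_fun setT (@interior_point n).
Proof.
apply: (measurable_fun_bool true); rewrite setTI.
have mlt (x : R) i : measurable [set s : n.-tuple R | x < tnth s i].
  rewrite (_ : [set _ | _] = (fun s : n.-tuple R => tnth s i) @^-1` `]x, +oo[).
    by rewrite -[X in measurable X]setTI; apply: measurable_tnth => //; exact: measurable_itv.
  by apply/seteqP; split => z /=; rewrite in_itv/= andbT.
have mgt (x : R) i : measurable [set s : n.-tuple R | tnth s i < x].
  rewrite (_ : [set _ | _] = (fun s : n.-tuple R => tnth s i) @^-1` `]-oo, x[).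
    by rewrite -[X in measurable X]setTI; apply: measurable_tnth => //; exact: measurable_itv.
  by apply/seteqP; split => z /=; rewrite in_itv.
rewrite (_ : _ @^-1` _ = [set s : n.-tuple R | forall i, 0 < tnth s i] `&`
    ~` [set s : n.-tuple R | forall i, ~ (tnth s i < 1)]).
  apply: measurableI.
    exact: (@measurable_forall_ord _ _ n (fun i => [set s : n.-tuple R | 0 < tnth s i])).
  apply: measurableC.
  apply: (@measurable_forall_ord _ _ n (fun i => ~` [set s : n.-tuple R | tnth s i < 1])) => i.
  by apply: measurableC; exact: mgt.
apply/seteqP; split=> s /=.
  move/interior_pointP => [h0 [i hi]]; split=> // H; exact: (H i).
move=> [h0 h1]; apply/interior_pointP; split => //.
by apply: contrapT => /forallNP H; exact: h1.
Qed.

(** All that the convergence argument needs to know of a copula, with an unnormalized generator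
    allowed. As [k - (k - 1)] is 1, the index [i] ranges over a single coordinate. *)
Record kernel_model (k : nat) (A : k.-tuple R -> R) (a : R) (F : nat -> R -> R)
    (tau : R -> R) : Prop := {
  km_chain : tail_chain a (k - 1) F tau;
  km_value : forall u, cube k u -> A u = arch_value (F 0%N) tau u;
  km_kernel : forall s y, cube (k - 1) s -> cube (k - (k - 1)) y ->
    interior_point s -> forall i,
    kernel_df A s y =
      kernel_cdf (F (k - 1)%N) tau (\sum_(j < k - 1) tau (tnth s j)) (tnth y i) }.

Variables (k : nat) (A : k.-tuple R -> R) (a : R) (F : nat -> R -> R) (tau : R -> R).
Hypothesis k1 : (1 < k)%N.
Hypothesis KM : kernel_model A a F tau.

Local Notation m := (k - 1)%N.
Let TC := km_chain KM.
Let B := tc_bij TC.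
Let m0 : (0 < m)%N. Proof. by rewrite subn_gt0. Qed.

Definition df_value (s : m.-tuple R) (y : R) : R :=
  if interior_point s then kernel_cdf (F m) tau (\sum_(j < m) tau (tnth s j)) y else 1.

(** The choice by [xget] is meaningful once some measure has these values: a quantile law at
    interior points, and the Dirac mass at the origin where the distribution function is the
    constant 1. *)
Lemma markov_kernel_box (s : m.-tuple R) : cube m s ->
  forall u, cube (k - m) u -> forall i, markov_kernel A s (box u) = (df_value s (tnth u i))%:E.
Proof.
move=> s01 u u01 i.
have km1 : (k - m)%N = 1%N by rewrite subKn// ltnW.
have HK u' : cube (k - m) u' -> kernel_df A s u' = df_value s (tnth u' i).
  move=> u'01; rewrite /df_value; case: ifPn => sI.
    by rewrite (km_kernel KM s01 u'01 sI i).
  by rewrite /kernel_df -/(interior_point s) (negbTE sI).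
have [P HP] : exists P, induces (kernel_df A s) P.
  have [sI|sI] := boolP (interior_point s).
    have t0 : 0 <= \sum_(j < m) tau (tnth s j).
      apply: sumr_ge0 => j _; apply: (db_inv_ge0 B).
      by have [h _] := (interior_pointP s).1 sI; rewrite h; case/andP: (s01 j).
    have [P HP] := kernel_cdf_measure m0 TC km1 t0.
    by exists P => v v01; rewrite (HP v v01 i) HK// /df_value sI.
  exists (dirac (origin (k - m)) : probability _ R) => v v01.
  rewrite HK// /df_value (negbTE sI) /= diracE mem_set// => j.
  by rewrite tnth_mktuple lexx; case/andP: (v01 j).
rewrite /markov_kernel; case: xgetP => [Q _ HQ|/(_ P)//].
by rewrite HQ// HK.
Qed.

(** The last coordinate is 1 and contributes [tau 1 = 0]. Equality of the predicates lets the choice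
    in [copula_measure] be identified. *)
Lemma marginal_value : induces (marginal m A) = induces (@arch_value R (F 0%N) tau m).
Proof.
apply/funext => mu; apply/propext; rewrite /induces.
suff E u : cube m u -> marginal m A u = arch_value (F 0%N) tau u.
  by split=> H u u01; rewrite H// E.
move=> u01; rewrite /marginal.
have km : k = m.+1 by rewrite subn1 prednK// ltnW.
have nthu i : 0 <= nth 1 u i <= 1.
  have [iu|iu] := ltnP i m; last by rewrite nth_default ?size_tuple// ler01 lexx.
  by rewrite -(tnth_nth 1 u (Ordinal iu)).
rewrite (km_value KM); last by move=> i; rewrite tnth_mktuple.
rewrite /arch_value.
have -> : [forall i, 0 < tnth [tuple nth 1 u i0 | i0 < k] i] = [forall i, 0 < tnth u i].
  apply/forallP/forallP => H i.
    have im : (i < k)%N by apply: leq_trans (ltn_ord i) _; rewrite leq_subLR leq_addl.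
    by have := H (Ordinal im); rewrite tnth_mktuple (tnth_nth 1).
  rewrite tnth_mktuple; have [iu|iu] := ltnP i m; last by rewrite nth_default ?size_tuple// ltr01.
  by rewrite -(tnth_nth 1 u (Ordinal iu)).
case: ifP => // _; congr (F 0%N _).
have -> : \sum_(i < k) tau (tnth [tuple nth 1 u i0 | i0 < k] i) = \sum_(0 <= i < k) tau (nth 1 u i).
  by rewrite big_mkord; apply: eq_bigr => i _; rewrite tnth_mktuple.
have split_k (g : nat -> R) : \sum_(0 <= i < k) g i = \sum_(0 <= i < m) g i + g m.
  by rewrite [in LHS]km big_nat_recr.
rewrite split_k nth_default ?size_tuple// (db_inv1 B) addr0.
by rewrite big_mkord; apply: eq_bigr => i _; rewrite (tnth_nth 1).
Qed.

Lemma arch_value1 : arch_value (F 0%N) tau [tuple 1 | _ < m] = 1.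
Proof.
rewrite /arch_value ifT; last by apply/forallP => i; rewrite tnth_mktuple.
rewrite big1 ?(db_at0 B)// => i _.
by rewrite tnth_mktuple (db_inv1 B).
Qed.

Local Notation L := (@tuple_lebesgue R m).
Local Notation D0 := (upper_orthant (zeros m)).

Lemma integral_copula_measure (h : m.-tuple R -> \bar R) :
  measurable_fun setT h -> (forall s, 0 <= h s)%E ->
  (\int[copula_measure (marginal m A)]_s h s =
   \int[L]_(z in D0) (h (tc_point F z) * (F m (tsum z))%:E))%E.
Proof.
move=> mh h0; have [M [HM IM]] := tc_copula_measure m0 TC.
rewrite -IM//; apply: eq_measure_integral => /= B' mB' _.
have HC : induces (@arch_value R (F 0%N) tau m) (copula_measure (marginal m A)).
  rewrite -marginal_value /copula_measure.
  by case: xgetP => [Q _ //|/(_ M)]; rewrite marginal_value.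
exact: (induces_unique HC HM arch_value1).
Qed.

Lemma copula_measure_cube : copula_measure (marginal m A) (cube m) = 1%E.
Proof.
have [M [HM IM]] := tc_copula_measure m0 TC.
apply: (@induces_cube _ _ (@arch_value R (F 0%N) tau m)); last exact: arch_value1.
rewrite -marginal_value /copula_measure.
by case: xgetP => [Q _ //|/(_ M)]; rewrite marginal_value.
Qed.

Lemma tc_point_cube (z : m.-tuple R) : D0 z ->
  cube m (tc_point F z) /\ forall i, 0 < tnth (tc_point F z) i <= 1.
Proof.
move=> /upper_orthant0P z0.
have h i : 0 < tnth (tc_point F z) i <= 1.
  by rewrite tnth_mktuple max_r//; exact: (db_in01 B).
by split=> // i; case/andP: (h i) => /ltW -> ->.
Qed.

Lemma tc_point_interior (z : m.-tuple R) : D0 z -> 0 < tsum z ->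
  interior_point (tc_point F z).
Proof.
move=> z0 zs; apply/interior_pointP; split.
  by move=> i; have [_ /(_ i)/andP[]] := tc_point_cube z0.
apply: contrapT => /forallNP H; move: zs; rewrite ltNge => /negP; apply.
rewrite /tsum big1// => i _.
have zi : 0 <= tnth z i by move/upper_orthant0P : z0.
apply/eqP; rewrite eq_le zi andbT leNgt; apply/negP => zi0; apply: (H i).
by rewrite tnth_mktuple max_r// -(db_at0 B) (db_lt B).
Qed.

(** Nothing is known of [tau] outside (0,1], not even measurability. Interior points of the cube
    have all coordinates in (0,1], where the restriction agrees with [tau]. *)
Let taub : R -> R := tau \_ `]0%R, 1%R].

Let tsumb (s : m.-tuple R) : R := \sum_(i < m) taub (tnth s i).

Let measurable_tsumb : measurable_fun setT tsumb.
Proof.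
apply: measurable_sum => i; apply: (measurableT_comp (measurable_tc_inv TC)).
exact: measurable_tnth.
Qed.

Lemma measurable_cdf_sum (y : R) : 0 < y <= 1 ->
  measurable_fun setT (fun s : m.-tuple R =>
    F m (Num.max 0 (tsumb s + tau y)) / F m (Num.max 0 (tsumb s))).
Proof.
move=> y01.
have mF := measurable_tc_max m0 TC.
have mv : measurable_fun setT (fun s : m.-tuple R => (F m (Num.max 0 (tsumb s)))^-1).
  have mF' : measurable_fun setT (fun t : R => - (F m (Num.max 0 t))^-1).
    apply: nonincreasing_measurable => // s t st; rewrite lerN2.
    have ge0 (x : R) : 0 <= Num.max 0 x by rewrite le_max lexx.
    rewrite lef_pV2 ?posrE ?(tc_ge0_gt0 TC)//; apply: (tc_nonincreasing m0 TC) => //.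
    by rewrite ge_max ge0/= le_max st orbT.
  rewrite (_ : (fun s => _) = (fun s => - - (F m (Num.max 0 (tsumb s)))^-1)); last first.
    by apply/funext => s; rewrite opprK.
  by apply: measurable_funN; exact: (measurableT_comp mF').
apply: measurable_funM => //.
by apply: (measurableT_comp mF); exact: measurable_funD.
Qed.

Lemma tsumbE (s : m.-tuple R) : cube m s -> interior_point s ->
  tsumb s = \sum_(i < m) tau (tnth s i) /\ 0 <= tsumb s.
Proof.
move=> s01 /interior_pointP[sI _].
have E : tsumb s = \sum_(i < m) tau (tnth s i).
  apply: eq_bigr => i _; rewrite /taub patchE mem_set//= in_itv/= sI.
  by case/andP: (s01 i).
split=> //; rewrite E; apply: sumr_ge0 => i _.
by apply: (db_inv_ge0 B); rewrite sI; case/andP: (s01 i).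
Qed.

(** The density [F m (tsum z)] cancels the denominator of the kernel, which leaves a difference in
    place of a quotient. *)
Lemma zeta1_inner (y : R) : 0 < y <= 1 ->
  (\int[copula_measure (marginal m A)]_(s in cube m)
     `| markov_kernel A s (box [tuple y | _ < k - m]) - y%:E | =
   \int[L]_(z in D0) `|F m (tsum z + tau y) - y * F m (tsum z)|%:E)%E.
Proof.
move=> y01; have [y0 y1] := andP y01.
have tauy : 0 <= tau y by exact: (db_inv_ge0 B).
pose g (s : m.-tuple R) : R := if interior_point s
  then `|F m (Num.max 0 (tsumb s + tau y)) / F m (Num.max 0 (tsumb s)) - y|
  else `|1 - y|.
have mg : measurable_fun setT g.
  apply: measurable_fun_ifT; [exact: measurable_interior_point| |exact: measurable_cst].
  apply: measurableT_comp => //; apply: measurable_funB => //.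
  exact: measurable_cdf_sum.
have mcube := @measurable_cube R m.
pose h : m.-tuple R -> \bar R := (EFin \o g) \_ (cube m).
have mh : measurable_fun setT h.
  by apply/(measurable_restrictT _ mcube); apply: measurable_funTS; exact/measurable_EFinP.
have h0 s : (0 <= h s)%E.
  by rewrite /h patchE; case: ifP => // _; rewrite lee_fin /g; case: ifP.
transitivity (\int[copula_measure (marginal m A)]_s h s)%E.
  rewrite /h -integral_mkcond; apply: eq_integral => s /set_mem s01.
  have yc : cube (k - m) [tuple y | _ < k - m] by move=> i; rewrite tnth_mktuple y1 ltW.
  have i0 : 'I_(k - m) by apply: (@Ordinal _ 0); rewrite subKn// ltnW.
  rewrite (markov_kernel_box s01 yc i0) tnth_mktuple -EFinB /=; congr (_%:E).
  rewrite /g /df_value; case: ifP => // sI.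
  have [E t0] := tsumbE s01 sI.
  by rewrite -E /kernel_cdf y0 !max_r// addr_ge0.
rewrite integral_copula_measure//.
have mD0 := measurable_upper_orthant (zeros m : m.-tuple R).
have mF := measurable_tc_max m0 TC.
pose f (z : m.-tuple R) : R := `|F m (Num.max 0 (tsum z + tau y)) - y * F m (Num.max 0 (tsum z))|.
have mf : measurable_fun setT f.
  apply: measurableT_comp => //; apply: measurable_funB.
    by apply: (measurableT_comp mF); apply: measurable_funD => //; exact: measurable_tsum.
  apply: measurable_funM => //.
  by apply: (measurableT_comp mF); exact: measurable_tsum.
have fE z : D0 z -> f z = `|F m (tsum z + tau y) - y * F m (tsum z)|.
  by move=> /tsum_ge0 zs; rewrite /f !max_r// addr_ge0.
transitivity (\int[L]_(z in D0) (f z)%:E)%E; last first.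
  by apply: eq_integral => z /set_mem zD; rewrite fE.
have mX : measurable_fun setT (@tc_point R m F) := measurable_tc_point TC.
apply: ge0_ae_eq_integral => //.
- apply: (eq_measurable_fun (fun z => h (tc_point F z) * (F m (Num.max 0 (tsum z)))%:E)%E).
    by move=> z /set_mem/tsum_ge0 zs; rewrite max_r.
  apply: measurable_funTS; apply: emeasurable_funM; first exact: (measurableT_comp mh mX).
  apply/measurable_EFinP; apply: (measurableT_comp mF); exact: measurable_tsum.
- by apply: measurable_funTS; exact/measurable_EFinP.
- move=> z /tsum_ge0 zs; rewrite mule_ge0// lee_fin ltW//.
  exact: (tc_ge0_gt0 TC).
- by move=> z _; rewrite lee_fin /f normr_ge0.
(* The equation [tsum z = 0] describes the corner [s = (1, ..., 1)], where the kernel takes its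
   default value 1. *)
exists (D0 `&` [set z | [set (0 : R)] (tsum z)]); split.
- apply: measurableI => //.
  rewrite -[X in measurable X]setTI; apply: measurable_tsum => //.
- by apply: (tsum_countable_null m0); exact: countable1.
move=> z /= /not_implyP[zD zne]; split=> //=; apply: contrapT => zs; apply: zne.
have zs0 := tsum_ge0 zD.
have zs1 : 0 < tsum z by rewrite lt_neqAle zs0 andbT eq_sym; apply/eqP.
have [zc _] := tc_point_cube zD; have zI := tc_point_interior zD zs1.
have [E _] := tsumbE zc zI.
rewrite /h patchE mem_set//= /g zI E (tc_sum_inv TC zD) fE// !max_r ?addr_ge0//.
have Fz : 0 < F m (tsum z) by exact: (tc_ge0_gt0 TC).
rewrite -EFinM; congr (_%:E).
rewrite -[X in _ * X](gtr0_norm Fz) -normrM mulrBl divfK// gt_eqF//.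
Qed.

End kernel_model.

(** * Convergence of kernels and of the dependence measure *)

Section deviation.
Context {R : realType}.

Local Notation L m := (@tuple_lebesgue R m).
Local Notation D0 m := (upper_orthant (zeros m : m.-tuple R)).

(* The inner integral in [zeta1] after the substitution [s_i = F 0 z_i], under
   which [mu_{A^{1:m}}] has the density [F m (z_1 + ... + z_m)]. *)
Definition deviation (m : nat) (F : nat -> R -> R) (tau : R -> R) (y : R) : \bar R :=
  (\int[L m]_(z in D0 m) `|F m (tsum z + tau y) - y * F m (tsum z)|%:E)%E.

Variables (a : R) (m : nat) (F : nat -> R -> R) (tau : R -> R).
Hypothesis m0 : (0 < m)%N.
Hypothesis TC : tail_chain a m F tau.

Let B := tc_bij TC.

Let mD0 : measurable (D0 m) := measurable_upper_orthant (zeros m : m.-tuple R).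

Lemma tc_density_integral : (\int[L m]_(z in D0 m) (F m (tsum z))%:E = 1)%E.
Proof.
have z0 (i : 'I_m) : 0 <= tnth (zeros m : m.-tuple R) i by rewrite tnth_mktuple.
have := integral_tc_upper_orthant m0 TC z0.
rewrite big1; last by move=> i _; rewrite tnth_mktuple.
rewrite (db_at0 B) => <-; apply: eq_integral => z /set_mem/tsum_ge0 zs.
by rewrite max_r.
Qed.

Lemma measurable_tc_density (c : R) : 0 <= c ->
  measurable_fun (D0 m) (fun z : m.-tuple R => F m (tsum z + c)).
Proof.
move=> c0; apply: (eq_measurable_fun (fun z : m.-tuple R => F m (Num.max 0 (tsum z + c)))).
  by move=> z /set_mem/tsum_ge0 zs; rewrite max_r// addr_ge0.
apply: measurable_funTS; apply: (measurableT_comp (measurable_tc_max m0 TC)).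
by apply: measurable_funD => //; exact: measurable_tsum.
Qed.

Lemma measurable_tc_density0 : measurable_fun (D0 m) (fun z : m.-tuple R => F m (tsum z)).
Proof.
have := measurable_tc_density (lexx 0).
by under eq_fun do rewrite addr0.
Qed.

Lemma deviation_integrand_le (y : R) (z : m.-tuple R) : 0 < y <= 1 -> D0 m z ->
  `|F m (tsum z + tau y) - y * F m (tsum z)| <= F m (tsum z).
Proof.
move=> y01 zD; have zs := tsum_ge0 zD; have t0 := db_inv_ge0 B y01.
case/andP: y01 => y0 y1.
have h1 : F m (tsum z + tau y) <= F m (tsum z).
  by apply: (tc_nonincreasing m0 TC) => //; rewrite lerDl.
have h2 : 0 < F m (tsum z + tau y) by apply: (tc_ge0_gt0 TC) => //; exact: addr_ge0.
have h3 : 0 < F m (tsum z) by exact: (tc_ge0_gt0 TC).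
have h4 : y * F m (tsum z) <= F m (tsum z) by rewrite ler_piMl// ltW.
have h5 : 0 < y * F m (tsum z) by exact: mulr_gt0.
move: h1 h2 h3 h4 h5; clear; move: (F m (tsum z)) (F m _) (y * _) => p q r *.
by rewrite ler_norml; apply/andP; split; lra.
Qed.

Lemma measurable_deviation_integrand (y : R) : 0 < y <= 1 ->
  measurable_fun (D0 m) (fun z : m.-tuple R => `|F m (tsum z + tau y) - y * F m (tsum z)|).
Proof.
move=> y01; apply: measurableT_comp => //; apply: measurable_funB.
  by apply: measurable_tc_density; exact: (db_inv_ge0 B).
by apply: measurable_funM => //; exact: measurable_tc_density0.
Qed.

Lemma deviation_ge0 (y : R) : (0 <= deviation m F tau y)%E.
Proof. by apply: integral_ge0 => z _; rewrite lee_fin. Qed.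

Lemma deviation_le1 (y : R) : 0 < y <= 1 -> (deviation m F tau y <= 1)%E.
Proof.
move=> y01; rewrite -tc_density_integral; apply: ge0_le_integral => //.
- by apply/measurable_EFinP; exact: measurable_deviation_integrand.
- by apply/measurable_EFinP; exact: measurable_tc_density0.
- by move=> z zD; rewrite lee_fin; exact: deviation_integrand_le.
Qed.

Lemma measurable_deviation : measurable_fun (`]0%R, 1%R] : set R) (deviation m F tau).
Proof.
pose taub : R -> R := tau \_ `]0%R, 1%R].
have mF := measurable_tc_max m0 TC.
pose f (w : R * m.-tuple R) : \bar R := ((fun w : R * m.-tuple R =>
  `|F m (Num.max 0 (tsum w.2 + taub w.1)) - w.1 * F m (Num.max 0 (tsum w.2))|%:E)
   \_ (setT `*` D0 m)) w.
have msum : measurable_fun setT (fun w : R * m.-tuple R => tsum w.2).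
  by apply: (measurableT_comp (@measurable_tsum R m)); exact: measurable_snd.
have mf : measurable_fun setT f.
  have mX : measurable ([set: R] `*` D0 m) by exact: measurableX.
  apply/(measurable_restrictT _ mX).
  apply: measurable_funTS; apply/measurable_EFinP; apply: measurableT_comp => //.
  apply: measurable_funB.
    apply: (measurableT_comp mF); apply: measurable_funD => //.
    by apply: (measurableT_comp (measurable_tc_inv TC)); exact: measurable_fst.
  apply: measurable_funM; first exact: measurable_fst.
  exact: (measurableT_comp mF).
have f0 w : (0 <= f w)%E by rewrite /f patchE; case: ifP => // _; rewrite lee_fin.
apply: (eq_measurable_fun (fubini_F (L m) f)); last first.
  by apply: measurable_funTS; exact: measurable_fun_fubini_tonelli_F.
move=> y /set_mem /=; rewrite in_itv/= => y01.
rewrite /fubini_F /deviation [in RHS]integral_mkcond; apply: eq_integral => z _.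
rewrite /f !patchE; have [zD|zD] := boolP (z \in D0 m); last first.
  by rewrite ifF//; apply/negP => /set_mem[_ /= h]; move/negP: zD; apply; exact/mem_set.
have zD' := set_mem zD.
rewrite ifT; last by apply/mem_set; split.
have zs := tsum_ge0 zD'; have t0 := db_inv_ge0 B y01.
rewrite /= /taub patchE mem_set; last by rewrite /= in_itv.
by rewrite !max_r// addr_ge0.
Qed.

End deviation.

Section zeta1_deviation.
Context {R : realType}.
Variables (k : nat) (A : k.-tuple R -> R) (a : R) (F : nat -> R -> R) (tau : R -> R).
Hypothesis k1 : (1 < k)%N.
Hypothesis KM : kernel_model A a F tau.

(** The null point [y = 0] is removed from the outer integral because [tau 0] carries no meaning. *)
Lemma zeta1E : zeta1 A =
  3 * fine (\int[lebesgue_measure]_(y in `]0%R, 1%R]) deviation (k - 1) F tau y)%E.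
Proof.
have m0 : (0 < k - 1)%N by rewrite subn_gt0.
rewrite /zeta1; congr (3 * fine _).
have E (y : R) : y \in ([set` `]0%R, 1%R]] : set R) ->
    (deviation (k - 1) F tau y =
    \int[copula_measure (marginal (k - 1) A)]_(s in cube (k - 1))
          `| markov_kernel A s (box [tuple y | _ < k - (k - 1)]) - y%:E |)%E.
  by move=> /set_mem /=; rewrite in_itv/= => y01; rewrite (zeta1_inner k1 KM).
rewrite -integral_itv_obnd_cbnd; last first.
  by apply: (eq_measurable_fun _ E); exact: (measurable_deviation m0 (km_chain KM)).
by apply: eq_integral => y /E ->.
Qed.

End zeta1_deviation.

Section convergence.
Context {R : realType}.
Variables (k : nat) (A_ : nat -> k.-tuple R -> R) (a_ : nat -> R)
  (F_ : nat -> nat -> R -> R) (tau_ : nat -> R -> R).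
Variables (A : k.-tuple R -> R) (a : R) (F : nat -> R -> R) (tau : R -> R).
Hypothesis k1 : (1 < k)%N.
Hypothesis KM_ : forall n, kernel_model (A_ n) (a_ n) (F_ n) (tau_ n).
Hypothesis KM : kernel_model A a F tau.

Local Notation m := (k - 1)%N.

Hypothesis Fcvg : forall (z_ : nat -> R) (z : R), 0 <= z -> (forall n, 0 <= z_ n) ->
  z_ n @[n --> \oo] --> z -> {for z, continuous (F m)} ->
  F_ n m (z_ n) @[n --> \oo] --> F m z.
Hypothesis taucvg : forall u : R, 0 < u <= 1 -> tau_ n u @[n --> \oo] --> tau u.

Let TC_ n := km_chain (KM_ n).
Let TC := km_chain KM.
Let B_ n := tc_bij (TC_ n).
Let B := tc_bij TC.
Let m0 : (0 < m)%N. Proof. by rewrite subn_gt0. Qed.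

Local Notation L := (@tuple_lebesgue R m).
Local Notation D0 := (upper_orthant (zeros m : m.-tuple R)).

Lemma deviation_cvg (y : R) : 0 < y <= 1 ->
  deviation m (F_ n) (tau_ n) y @[n --> \oo] --> deviation m F tau y.
Proof.
move=> y01.
(* The integrand evaluates [F m] at [tsum z] and at [tsum z + tau y]; the translate accounts for the
   second argument. *)
pose N' : set R := discontinuities m F `|` (fun t => t - tau y) @` discontinuities m F.
have cN : countable N'.
  rewrite /N' -bigcup2inE; apply: bigcup_countable => // -[|[|//]] _ /=.
    exact: (countable_discontinuities m0 TC).
  by apply: (sub_countable (card_image_le _ _)); exact: (countable_discontinuities m0 TC).
have mN : measurable (D0 `&` [set z : m.-tuple R | N' (tsum z)]).
  apply: measurableI; first exact: measurable_upper_orthant.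
  rewrite -[X in measurable X]setTI; apply: measurable_tsum => //.
  exact: countable_measurable.
have contN z : D0 z -> ~ (D0 `&` [set z : m.-tuple R | N' (tsum z)]) z ->
    {for tsum z, continuous (F m)} /\ {for tsum z + tau y, continuous (F m)}.
  move=> zD zN; have zs := tsum_ge0 zD; have t0 := db_inv_ge0 B y01.
  split; apply: contrapT => nc; apply: zN; split=> //.
    by left; split.
  by right; exists (tsum z + tau y); [split => //; exact: addr_ge0|rewrite addrK].
apply: (dominated_by_densities_cvg (measurable_upper_orthant _) mN
  (tsum_countable_null m0 cN) (p_ := fun n z => F_ n m (tsum z)) (p := fun z => F m (tsum z))).
- by move=> n; exact: (measurable_tc_density0 m0 (TC_ n)).
- exact: (measurable_tc_density0 m0 TC).
- by move=> n; exact: (measurable_deviation_integrand m0 (TC_ n) y01).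
- exact: (measurable_deviation_integrand m0 TC y01).
- by [].
- by [].
- by move=> n z zD; exact: (deviation_integrand_le m0 (TC_ n) y01).
- by move=> n; exact: (tc_density_integral m0 (TC_ n)).
- by move=> z /tsum_ge0 zs; exact/ltW/(tc_ge0_gt0 TC).
- exact: (tc_density_integral m0 TC).
- move=> z zD /(contN z zD)[cz _]; have zs := tsum_ge0 zD.
  by apply: (Fcvg (z_ := fun=> tsum z)) => //; exact: cvg_cst.
- move=> z zD /(contN z zD)[cz cz']; have zs := tsum_ge0 zD.
  apply: cvg_norm; apply: cvgB.
    apply: Fcvg => //; first by rewrite addr_ge0// (db_inv_ge0 B).
      by move=> n; rewrite addr_ge0// (db_inv_ge0 (B_ n)).
    by apply: cvgD; [exact: cvg_cst|exact: taucvg].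
  by apply: cvgMl_tmp; apply: (Fcvg (z_ := fun=> tsum z)) => //; exact: cvg_cst.
Qed.

Lemma zeta1_cvg : zeta1 (A_ n) @[n --> \oo] --> zeta1 A.
Proof.
under eq_fun do rewrite (zeta1E k1 (KM_ _)).
rewrite (zeta1E k1 KM); apply: cvgMl_tmp.
pose D : set R := [set` `]0%R, 1%R]].
have D01 y : D y -> 0 < y <= 1 by rewrite /D /= in_itv.
have lD : (@lebesgue_measure R D = 1)%E.
  by rewrite /D /= lebesgue_measure_itv/= lte_fin ltr01 sube0.
have mD : measurable D by exact: measurable_itv.
have I1 : (\int[@lebesgue_measure R]_(y in D) 1%:E = 1%:E)%E.
  by rewrite integral_cst// mul1e; exact: lD.
have bnd a' F' tau' : tail_chain a' m F' tau' -> forall y, D y ->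
    (`|deviation m F' tau' y| <= 1%:E)%E.
  move=> TC' y /D01 y01; rewrite gee0_abs; last exact: deviation_ge0.
  exact: deviation_le1 m0 TC' _ y01.
have int1 : (@lebesgue_measure R).-integrable D (fun=> 1%:E).
  apply/integrableP; split; first exact: measurable_cst.
  rewrite (eq_integral (fun=> 1%:E)); last by move=> y _; rewrite /= normr1.
  by rewrite I1 ltry.
have mdev : measurable_fun D (deviation m F tau) := measurable_deviation m0 TC.
apply: fine_cvg; rewrite fineK; last first.
  rewrite ge0_fin_numE; last by apply: integral_ge0 => y _; exact: deviation_ge0.
  apply: (@le_lt_trans _ _ (\int[lebesgue_measure]_(y in D) 1%:E)%E).
    apply: ge0_le_integral => //; first by move=> y _; exact: deviation_ge0.
    by move=> y /D01 y01; exact: deviation_le1 m0 TC _ y01.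
  by rewrite I1 ltry.
apply: (@dominated_cvg _ _ _ _ _ _ _ _ (fun=> 1%:E)) => //.
- by move=> n; exact: (measurable_deviation m0 (TC_ n)).
- by move=> y /D01 y01; exact: deviation_cvg.
- by move=> n y yD; exact: (bnd _ _ _ (TC_ n)).
Qed.

Let df1 a' F' tau' (s : m.-tuple R) : tail_chain a' m F' tau' -> cube m s ->
  df_value F' tau' s 1 = 1.
Proof.
move=> TC' s01; rewrite /df_value; case: ifPn => // sI.
rewrite /kernel_cdf ltr01 (db_inv1 (tc_bij TC')) addr0 divff// gt_eqF//.
apply: (tc_ge0_gt0 TC') => //; apply: sumr_ge0 => i _; apply: (db_inv_ge0 (tc_bij TC')).
by have [-> _] := (interior_pointP s).1 sI; case/andP: (s01 i).
Qed.

Lemma markov_kernel_cvg (s : m.-tuple R) : cube m s ->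
  (interior_point s -> {for \sum_(i < m) tau (tnth s i), continuous (F m)}) ->
  weak_cvg (fun n => markov_kernel (A_ n) s) (markov_kernel A s).
Proof.
move=> s01 sc; set t := \sum_(i < m) tau (tnth s i).
pose D : set R := [set y | interior_point s -> {for t + tau y, continuous (F m)}].
have km1 : (k - m)%N = 1%N by rewrite subKn// ltnW.
have sI01 : interior_point s -> forall i, 0 < tnth s i <= 1.
  by move=> /interior_pointP[h _] i; rewrite h; case/andP: (s01 i).
have t0 : interior_point s -> 0 <= t.
  by move=> /sI01 h; apply: sumr_ge0 => i _; exact: (db_inv_ge0 B).
apply: (@weak_cvg_of_cdf _ _ _ _ (fun n => df_value (F_ n) (tau_ n) s)
  (df_value F tau s) D km1).
- by move=> n u u01 i; exact: (markov_kernel_box k1 (KM_ n) s01 u01 i).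
- by move=> u u01 i; exact: (markov_kernel_box k1 KM s01 u01 i).
- by move=> n; exact: (df1 (TC_ n)).
- exact: (df1 TC).
- rewrite /df_value /kernel_cdf ltxx; exact: cvg_cst.
- move=> y Dy /andP[y0 y1]; rewrite /df_value; case: ifPn => sI; last exact: cvg_cst.
  have y01 : 0 < y <= 1 by rewrite y0 ltW.
  rewrite /kernel_cdf y0.
  have tn0 n : 0 <= \sum_(i < m) tau_ n (tnth s i).
    by apply: sumr_ge0 => i _; exact: (db_inv_ge0 (B_ n) (sI01 sI i)).
  have tcvg : \sum_(i < m) tau_ n (tnth s i) @[n --> \oo] --> t.
    by apply: cvg_big => [|i _]; [exact: add_continuous|exact: (taucvg (sI01 sI i))].
  apply: cvgM.
    apply: Fcvg => //; last exact: Dy.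
    - by rewrite addr_ge0 ?t0// (db_inv_ge0 B).
    - by move=> n; rewrite addr_ge0// (db_inv_ge0 (B_ n)).
    by apply: cvgD => //; exact: taucvg.
  apply: cvgV; first by rewrite gt_eqF// (tc_ge0_gt0 TC)// t0.
  by apply: Fcvg => //; [exact: t0|exact: sc].
- move=> p q p0 pq q1; have [sI|sI] := boolP (interior_point s); last first.
    by exists ((p + q) / 2); [move=> sI'; rewrite sI' in sI|rewrite midf_lt// midf_lt].
  (* As [p] may be 0, where [tau] is not controlled, the point is sought above the midpoint: a
     continuity point of [F m] between [t + tau q] and [t + tau r] is pulled back by [F 0]. *)
  pose r := (p + q) / 2.
  have pr : p < r by rewrite /r midf_lt.
  have rq : r < q by rewrite /r midf_lt.
  have r0 : 0 < r by exact: le_lt_trans pr.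
  have r01 : 0 < r <= 1 by rewrite r0 (ltW (lt_le_trans rq q1)).
  have q0 : 0 < q by exact: lt_trans rq.
  have q01 : 0 < q <= 1 by rewrite q0 q1.
  have tq0 := db_inv_ge0 B q01.
  have tqr : tau q < tau r by rewrite (db_inv_lt B).
  have tt : t + tau q < t + tau r by rewrite ltrD2l.
  have [z /andP[z1 z2] cz] := continuity_point_between m0 TC
    (addr_ge0 (t0 sI) tq0) tt.
  have zt0 : 0 <= z - t by rewrite subr_ge0 (le_trans _ (ltW z1))// lerDl.
  exists (F 0%N (z - t)).
    by move=> _; rewrite (db_K B)// addrC subrK.
  have -> : F 0%N (z - t) < q.
    rewrite -[X in _ < X](db_invK B q01) (db_lt B)//.
    by rewrite ltrBrDl.
  rewrite andbT; apply: (lt_trans pr).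
  rewrite -[X in X < _](db_invK B r01) (db_lt B) ?(db_inv_ge0 B)//.
  by rewrite ltrBlDl.
Qed.

Lemma kernel_model_weakly_conditional_cvg : weakly_conditional_cvg m A_ A.
Proof.
pose taub : R -> R := tau \_ `]0%R, 1%R].
pose tsumb (s : m.-tuple R) : R := \sum_(i < m) taub (tnth s i).
(* Only interior points can be exceptional: elsewhere the kernel's distribution function is 1 for
   every [n]. *)
pose N := [set s : m.-tuple R | interior_point s /\ discontinuities m F (tsumb s)].
have mtsumb : measurable_fun setT tsumb.
  apply: measurable_sum => i; apply: (measurableT_comp (measurable_tc_inv TC)).
  exact: measurable_tnth.
have cD := countable_discontinuities m0 TC.
have mN : measurable N.
  rewrite (_ : N = interior_point (n := m) @^-1` [set true] `&`
      tsumb @^-1` discontinuities m F); last first.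
    by apply/seteqP; split => s /= [? ?].
  apply: measurableI.
    by rewrite -[X in measurable X]setTI; exact: measurable_interior_point.
  rewrite -[X in measurable X]setTI; apply: mtsumb => //.
  exact: countable_measurable.
have mcube := @measurable_cube R m.
pose mu := copula_measure (marginal m A).
have muN : mu (cube m `&` N) = 0%E.
  have mI : measurable (cube m `&` N) by exact: measurableI.
  have -> : mu (cube m `&` N) = (\int[mu]_s (\1_(cube m `&` N) s)%:E)%E.
    by rewrite integral_indic// setIT.
  rewrite (integral_copula_measure k1 KM); last 2 first.
  - by apply/measurable_EFinP; exact: measurable_indic.
  - by move=> s; rewrite lee_fin.
  pose N2 := D0 `&` [set z : m.-tuple R | discontinuities m F (tsum z)].
  have mD0 := measurable_upper_orthant (zeros m : m.-tuple R).
  have mN2 : measurable N2.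
    apply: measurableI => //; rewrite -[X in measurable X]setTI.
    by apply: measurable_tsum => //; exact: countable_measurable.
  have mX : measurable_fun setT (@tc_point R m F) := measurable_tc_point TC.
  rewrite (ge0_negligible_integral mN2)//; last 3 first.
  - apply: emeasurable_funM; last first.
      by apply/measurable_EFinP; exact: (measurable_tc_density0 m0 TC).
    apply: measurable_funTS; apply/measurable_EFinP.
    by apply: (measurableT_comp _ mX); exact: measurable_indic.
  - move=> z /tsum_ge0 zs; rewrite mule_ge0// lee_fin// ltW//.
    exact: (tc_ge0_gt0 TC).
  - exact: (tsum_countable_null m0).
  apply: integral0_eq => z [zD zN]; rewrite indicE memNset ?mul0e// => -[zc [zI zd]].
  apply: zN; split => //=; move: zd.
  have [E _] := tsumbE KM zc zI.
  suff -> : tsumb (tc_point F z) = tsum z by [].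
  by rewrite -(tc_sum_inv TC zD); exact: E.
exists (cube m `\` N); split.
- exact: measurableD.
- exact: subDsetl.
- have mu1 : mu (cube m) = 1%E := copula_measure_cube k1 KM.
  have E : mu (cube m `\` N) = (mu (cube m) - mu (cube m `&` N))%E.
    apply: measureD => //; suff : (mu (cube m) < +oo)%E by [].
    by rewrite mu1 ltry.
  suff : mu (cube m `\` N) = 1%E by [].
  by rewrite E muN mu1 sube0.
move=> s [s01 sN]; apply: markov_kernel_cvg => // sI.
have [E t0] := tsumbE KM s01 sI.
rewrite -E; apply: contrapT => nc; apply: sN; by split.
Qed.

End convergence.

(** * Conditional copulas *)

Section normalized_generator.
Context {R : realType}.
Variables (n : nat) (A : n.-tuple R -> R) (f tau : R -> R).
Hypothesis B : dec_bij f tau.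
Hypothesis fc : forall z : R, 0 <= z -> {for z, continuous f}.
Hypothesis f0 : f z @[z --> +oo] --> 0.
Hypothesis Af : forall u, cube n u -> A u = arch_value f tau u.

(** [generator_of] selects a generator with value 1/2 at 1. Rescaling the argument by [tau (1/2)]
    achieves this and leaves the copula unchanged, since the inverse is divided by the same
    constant. *)
Definition normalization : R := tau 2^-1.
Local Notation c := normalization.

Lemma normalization_gt0 : 0 < c.
Proof. by apply: (db_inv_gt0 B); apply/andP; split; lra. Qed.

Definition normalized (z : R) : R := f (c * z).

Lemma normalized_bij : dec_bij normalized (fun u => tau u / c).
Proof.
have c0 := normalization_gt0; split.
- by rewrite /normalized mulr0 (db_at0 B).
- by move=> z z0; rewrite /normalized (db_gt0 B)// mulr_ge0// ltW.
- move=> z w z0 zw; apply: (db_dec B); first by rewrite mulr_ge0// ltW.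
  by rewrite ltr_pM2l.
- by move=> u u01; apply: divr_ge0; [exact: (db_inv_ge0 B)|exact: ltW].
- by move=> u u01; rewrite /normalized mulrC divfK ?gt_eqF// (db_invK B).
Qed.

Lemma normalized_strict : strict_generator normalized.
Proof. exact: pinverse0E normalized_bij. Qed.

Lemma normalized_generator : generator normalized.
Proof.
have N := normalized_bij; have c0 := normalization_gt0; split.
- apply: continuous_in_subspaceT => z /set_mem /=; rewrite in_itv/= andbT => z0.
  apply: (continuous_comp (f := fun z => c * z)); first by apply: cvgMl_tmp; exact: cvg_id.
  by apply: fc; rewrite mulr_ge0// ltW.
- by move=> z z0; case/andP: (db_in01 N z0) => /ltW -> ->.
- by move=> z w z0 zw; rewrite (db_le N)// (le_trans z0).
- exact: (db_at0 N).
- apply: (cvg_comp (fun z => c * z) f _ f0).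
  apply/cvgryPge => M; near=> z.
  have Mz : M / c <= z by near: z; apply: nbhs_pinfty_ge; rewrite num_real.
  by rewrite mulrC -ler_pdivrMr.
- by move=> z w z0 zw _; exact: (db_dec N).
- rewrite /normalized mulr1 (db_invK B)//; apply/andP; split; lra.
Unshelve. all: by end_near. Qed.

Lemma normalized_has_generator : has_generator A normalized.
Proof.
have N := normalized_bij; have c0 := normalization_gt0.
split; first exact: normalized_generator.
move=> u u01; rewrite Af// /arch_value; case: ifPn => [/forallP u0|].
  rewrite (sum_pinverseE N); last by move=> i; rewrite u0; case/andP: (u01 i).
  rewrite /ext0 /normalized -mulr_suml mulrC divfK// gt_eqF//.
rewrite negb_forall => /existsP[i]; rewrite -leNgt => ui.
rewrite (sum_pinverse_pinfty (i := i) N)//.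
by apply/eqP; rewrite eq_le ui; case/andP: (u01 i).
Qed.

Lemma normalized_generator_of : (1 < n)%N -> {in `[0, +oo[, generator_of A =1 normalized}.
Proof.
move=> n1; exact: (generator_of_strict n1 normalized_has_generator normalized_strict).
Qed.

End normalized_generator.

Lemma eq_dec_bij {R : realType} (f g phi : R -> R) :
  (forall z, 0 <= z -> f z = g z) -> dec_bij g phi -> dec_bij f phi.
Proof.
move=> fg B; split.
- by rewrite fg// (db_at0 B).
- by move=> z z0; rewrite fg// (db_gt0 B).
- by move=> z w z0 zw; rewrite !fg ?(db_dec B)// ltW// (le_lt_trans z0).
- exact: (db_inv_ge0 B).
- by move=> u u01; rewrite fg ?(db_invK B)// (db_inv_ge0 B).
Qed.

Section conditional_model.
Context {R : realType}.
Variables (d l : nat) (C : d.-tuple R -> R) (x : l.-tuple R) (psi phi : R -> R).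
Hypothesis ld : (1 <= l <= d - 2)%N.
Hypothesis HC : has_generator C psi.
Hypothesis S : strict_generator psi.
Hypothesis M : monotone_of_order d psi.
Hypothesis B : dec_bij psi phi.
Hypothesis x01 : forall i, 0 < tnth x i < 1.

Local Notation sd := (signed_derivative d psi).

Definition cond_shift : R := \sum_(i < l) phi (tnth x i).
Local Notation sigma := cond_shift.

(* [z |-> psi^(l)(sigma + z) / psi^(l)(sigma)], the unnormalized generator of the
   conditional copula, and its signed derivatives. *)
Definition cond_chain (j : nat) (z : R) : R := sd (l + j) (sigma + z) / sd l sigma.
Local Notation F := cond_chain.

Let d1 : (1 < d)%N. Proof. by move: ld; clear; lia. Qed.

Let x01' i : 0 < tnth x i <= 1.
Proof. by case/andP: (x01 i) => -> /ltW ->. Qed.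

Lemma cond_shift_gt0 : 0 < sigma.
Proof.
have l0 : (0 < l)%N by case/andP: ld.
rewrite /sigma (bigD1 (Ordinal l0))//= ltr_pwDl//; first exact: (db_inv_gt0 B).
by apply: sumr_ge0 => i _; exact: (db_inv_ge0 B).
Qed.

Let sd_gt0 j z : (j <= d - 1)%N -> 0 < z -> 0 < sd j z.
Proof. by move=> jd; have [h _] := signed_derivative_gt0_cvg0 d1 M HC.1 S jd; exact: h. Qed.

Let sdl_gt0 : 0 < sd l sigma.
Proof. by apply: sd_gt0; [move: ld; clear; lia|exact: cond_shift_gt0]. Qed.

Lemma cond_chain_slopes j : (j < d - l - 1)%N -> slopes (- sigma) (F j) (F j.+1).
Proof.
move=> jd; have jd' : (l + j < d - 1)%N by move: jd; clear; lia.
have := slopes_shift (c := sigma) (signed_derivative_slopes d1 M jd').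
rewrite sub0r => H z w az zw; have := H _ _ az zw.
rewrite /F addnS -mulrBl [X in _ -> X <= _ <= _]mulrAC [X in _ -> _ <= _ <= X]mulrAC.
by rewrite !ler_pM2r// invr_gt0.
Qed.

Lemma cond_chain_gt0 j z : (j <= d - l - 1)%N -> - sigma < z -> 0 < F j z.
Proof.
move=> jd sz; rewrite divr_gt0// sd_gt0//; first by move: jd ld; clear; lia.
by rewrite -ltrBlDl sub0r.
Qed.

Lemma cond_chain_cvg0 j : (j <= d - l - 1)%N -> F j z @[z --> +oo] --> 0.
Proof.
move=> jd; have jd' : (l + j <= d - 1)%N by move: jd ld; clear; lia.
have [_ c] := signed_derivative_gt0_cvg0 d1 M HC.1 S jd'.
rewrite -(mul0r (sd l sigma)^-1); apply: cvgMr_tmp.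
apply: (cvg_comp (fun z => sigma + z) _ _ c).
apply/cvgryPge => N; near=> z; rewrite -lerBlDl.
by near: z; apply: nbhs_pinfty_ge; rewrite num_real.
Unshelve. all: by end_near. Qed.

Lemma cond_chain0_continuous z : 0 <= z -> {for z, continuous (F 0%N)}.
Proof.
move=> z0; apply: (slopes_continuous (@cond_chain_slopes 0 _)).
  by move: ld; clear; lia.
by apply: lt_le_trans z0; rewrite oppr_lt0 cond_shift_gt0.
Qed.

Lemma cond_chain_bij : exists tau, dec_bij (F 0%N) tau.
Proof.
have s0 : - sigma < 0 by rewrite oppr_lt0 cond_shift_gt0.
have m0 : (0 < d - l - 1)%N by move: ld; clear; lia.
apply: dec_bij_exists.
- by rewrite /F addn0 addr0 divff// gt_eqF.
- by move=> z z0; apply: cond_chain_gt0 => //; exact: lt_le_trans z0.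
- move=> z w z0; apply: slopes_decreasing (cond_chain_slopes m0) _ _.
    by move=> y; exact: cond_chain_gt0.
  exact: lt_le_trans z0.
- apply: continuous_in_subspaceT => z /set_mem /=; rewrite in_itv/= andbT.
  exact: cond_chain0_continuous.
- exact: cond_chain_cvg0.
Qed.

Variable tau : R -> R.
Hypothesis TB : dec_bij (F 0%N) tau.

Lemma cond_tail_chain : tail_chain (- sigma) (d - l - 1) F tau.
Proof.
have s0 : - sigma < 0 by rewrite oppr_lt0 cond_shift_gt0.
split => //.
- exact: cond_chain_slopes.
- exact: cond_chain_gt0.
- exact: cond_chain_cvg0.
- move=> z sz; apply: cvgMr_tmp.
  have -> : (l + (d - l - 1) = d - 1)%N by move: ld; clear; lia.
  have sz0 : 0 < sigma + z by rewrite -ltrBlDl sub0r.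
  apply: (cvg_comp (fun w => sigma + w) _ _ (signed_derivative_left_continuous d1 M sz0)).
  move=> P [e /= e0 He]; exists e => //= w zw wz; apply: He => /=.
    by rewrite opprD addrACA subrr add0r.
  by rewrite ltrD2l.
Qed.

Let E : {in `[0, +oo[, generator_of C =1 psi} := generator_of_strict d1 HC S.

Let E0 z : 0 <= z -> generator_of C z = psi z.
Proof. by move=> z0; apply: E; rewrite in_itv/= z0. Qed.

Let BC : dec_bij (generator_of C) phi := eq_dec_bij E0 B.

Lemma sum_pinverse_cond : sum_pinverse (generator_of C) x = sigma%:E.
Proof. by rewrite (sum_pinverseE BC). Qed.

Let derive1n_generator_of z : 0 < z -> derive1n l (generator_of C) z = (-1) ^+ l * sd l z.
Proof.
move=> z0; rewrite (derive1n_eq_pos (g := psi))//; last by move=> w /ltW/E0.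
by rewrite signed_derivativeE//; [rewrite mulrA -expr2 sqrr_sign mul1r|move: ld; clear; lia].
Qed.

Let cond_ratio z : 0 <= z -> derive1n l (generator_of C) (sigma + z) /
  derive1n l (generator_of C) sigma = F 0%N z.
Proof.
move=> z0; have s0 := cond_shift_gt0.
rewrite !derive1n_generator_of//; last by rewrite ltr_wpDr.
by rewrite /F addn0 -mulf_div divff ?mul1r// signr_eq0.
Qed.

(** Since [l < d - 1], the kernel uses the ordinary derivative of order [l]. The inverse is still
    [phi] and not [tau] because the margins are not yet uniform. *)
Lemma cond_kernelE (y : (d - l).-tuple R) : cube (d - l) y ->
  kernel_df C x y = arch_value (F 0%N) phi y.
Proof.
move=> y01; have s0 := cond_shift_gt0.
have l0 : (0 < l)%N by case/andP: ld.
have xI : interior_point x.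
  apply/interior_pointP; split; first by move=> i; case/andP: (x01 i).
  by exists (Ordinal l0); case/andP: (x01 (Ordinal l0)).
rewrite /kernel_df -/(interior_point x) xI sum_pinverse_cond /kernel_derivative.
rewrite ifF; last by apply/negbTE; rewrite neq_ltn; apply/orP; left; move: ld; clear; lia.
rewrite /arch_value; case: ifPn => [/forallP y0|].
  rewrite (sum_pinverseE BC); last by move=> i; rewrite y0; case/andP: (y01 i).
  rewrite -EFinD /ext0 cond_ratio//; apply: sumr_ge0 => i _.
  by apply: (db_inv_ge0 B); rewrite y0; case/andP: (y01 i).
rewrite negb_forall => /existsP[i]; rewrite -leNgt => yi.
rewrite (sum_pinverse_pinfty (i := i) BC)//.
  by rewrite addeC addye// /ext0 mul0r.
by apply/eqP; rewrite eq_le yi; case/andP: (y01 i).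
Qed.

Lemma cond_marginE (y : R) : 0 <= y <= 1 ->
  cond_margin C x y = if 0 < y then F 0%N (phi y) else 0.
Proof.
move=> /andP[y0 y1]; rewrite /cond_margin sum_pinverse_cond; case: ifPn => [y0'|].
  have y01 : 0 < y <= 1 by rewrite y0'.
  by rewrite (pinverseE BC y01) -EFinD /ext0 cond_ratio// (db_inv_ge0 B).
rewrite -leNgt => y0'; have -> : y = 0 by apply/eqP; rewrite eq_le y0' y0.
by rewrite (pinverse0E BC) addey// /ext0 mul0r.
Qed.

Let g_inv := 'pinv_(fun=> 0) `[0, 1] (cond_margin C x).

Let cond_margin_inj : {in `[0%R, 1%R]%classic &, injective (cond_margin C x)}.
Proof.
have pos (y : R) : 0 < y <= 1 -> 0 < F 0%N (phi y).
  by move=> y01; apply: (db_gt0 TB); exact: (db_inv_ge0 B).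
move=> u v /set_mem /=; rewrite in_itv/= => u01 /set_mem /=; rewrite in_itv/= => v01.
have [/andP[u0 u1] /andP[v0 v1]] := (u01, v01).
rewrite !cond_marginE//; case: ifPn => u0'; case: ifPn => v0'.
- have u01' : 0 < u <= 1 by rewrite u0'.
  have v01' : 0 < v <= 1 by rewrite v0'.
  move/(db_inj TB (db_inv_ge0 B u01') (db_inv_ge0 B v01')) => e.
  by rewrite -(db_invK B u01') e (db_invK B).
- by move=> e; have := pos u; rewrite e u0' u1 ltxx => /(_ isT).
- by move=> e; have := pos v; rewrite -e v0' v1 ltxx => /(_ isT).
move: u0' v0'; rewrite -!leNgt => u0' v0' _.
by apply/eqP; rewrite eq_le (le_trans u0')// (le_trans v0').
Qed.

Lemma cond_margin_inv0 : g_inv 0 = 0.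
Proof.
have z01 : 0 <= (0 : R) <= 1 by rewrite lexx ler01.
have {1}<- : cond_margin C x 0 = 0 by rewrite cond_marginE// ltxx.
by rewrite /g_inv pinvKV//; apply/mem_set; rewrite /= in_itv.
Qed.

(** On (0,1] the margin is [F 0] after [phi], so its inverse is [psi] after [tau]. Substituting it
    turns [phi] into [tau] in the conditional copula. *)
Lemma cond_margin_invE u : 0 < u <= 1 -> g_inv u = psi (tau u).
Proof.
move=> u01; have t0 := db_inv_ge0 TB u01.
have /andP[p0 p1] := db_in01 B t0.
have {1}<- : cond_margin C x (psi (tau u)) = u.
  by rewrite cond_marginE ?p0 ?p1 ?(ltW p0)// (db_K B)// (db_invK TB).
by rewrite /g_inv pinvKV//; apply/mem_set; rewrite /= in_itv/= (ltW p0).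
Qed.

Lemma cond_copulaE (u : (d - l).-tuple R) : cube (d - l) u ->
  cond_copula C x u = arch_value (F 0%N) tau u.
Proof.
move=> u01; rewrite /cond_copula -/g_inv.
have g01 i : 0 <= g_inv (tnth u i) <= 1 /\ (0 < g_inv (tnth u i)) = (0 < tnth u i).
  have [ui0|ui0] := ltP 0 (tnth u i).
    have ui01 : 0 < tnth u i <= 1 by rewrite ui0; case/andP: (u01 i).
    rewrite cond_margin_invE//; have /andP[p0 p1] := db_in01 B (db_inv_ge0 TB ui01).
    by rewrite p0 p1 ltW.
  have -> : tnth u i = 0 by apply/eqP; rewrite eq_le ui0; case/andP: (u01 i).
  by rewrite cond_margin_inv0 lexx ler01 ltxx.
rewrite cond_kernelE; last by move=> i; rewrite tnth_mktuple; case: (g01 i).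
rewrite /arch_value.
under eq_forallb do rewrite tnth_mktuple (g01 _).2.
case: ifPn => // /forallP u0; congr (F 0%N _); apply: eq_bigr => i _.
have ui01 : 0 < tnth u i <= 1 by rewrite u0; case/andP: (u01 i).
by rewrite tnth_mktuple cond_margin_invE// (db_K B)// (db_inv_ge0 TB).
Qed.

Local Notation k := (d - l)%N.
Local Notation A := (cond_copula C x).

Let k1 : (1 < k)%N. Proof. by move: ld; clear; lia. Qed.

Let EA := normalized_generator_of TB cond_chain0_continuous
  (@cond_chain_cvg0 0 (leq0n _)) cond_copulaE k1.

Local Notation c := (normalization tau).

Let EA0 z : 0 <= z -> generator_of A z = normalized (F 0%N) tau z.
Proof. by move=> z0; apply: EA; rewrite in_itv/= z0. Qed.

Let BA : dec_bij (generator_of A) (fun u => tau u / c) := eq_dec_bij EA0 (normalized_bij TB).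

(** The argument [z / c] arises because the inverse of the normalized generator is [tau / c]. The
    factor in front of [F] does not depend on [z] and cancels in the kernel's quotient. *)
Lemma kernel_derivative_cond_copula z : 0 < z ->
  kernel_derivative k (k - 1) (generator_of A) (z / c) =
  (-1) ^+ (k - 1) * c ^+ (k - 1) * F (k - 1)%N z.
Proof.
move=> z0; have c0 := normalization_gt0 TB; have s0 := cond_shift_gt0.
have zc : 0 < z / c by rewrite divr_gt0.
rewrite (kernel_derivative_eq_pos
    (g := fun w => ((-1) ^+ l / sd l sigma) * derive1n l psi (sigma + c * w)))//.
  rewrite (kernel_derivative_affine d1 M _ c0); last 2 first.
  - by move: ld; clear; lia.
  - by rewrite addr_gt0// mulr_gt0.
  rewrite [c * (z / c)]mulrC divfK ?gt_eqF// /F.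
  have ek : (l + (k - 1) = d - 1)%N by move: ld; clear; lia.
  rewrite ek [sd (d - 1)%N]/signed_derivative -{2}ek exprD.
  have := signrMK (k - 1) ((-1) ^+ l : R).
  rewrite mulrCA => s2; rewrite -[in LHS]s2; ring.
move=> w w0; rewrite EA0 ?(ltW w0)// /normalized /F addn0.
have ld2 : (l <= d - 2)%N by case/andP: ld.
by rewrite !signed_derivativeE// mulrAC.
Qed.

Lemma cond_copula_model : kernel_model A (- sigma) F tau.
Proof.
split; [exact: cond_tail_chain|exact: cond_copulaE|].
move=> s y s01 y01 sI i; have [s0 [i0 si0]] := (interior_pointP s).1 sI.
have s01' j : 0 < tnth s j <= 1 by rewrite s0; case/andP: (s01 j).
have c0 := normalization_gt0 TB.
(* A coordinate below 1 makes the sum positive, as required for identifying derivatives of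
   [generator_of]. *)
have T0 : 0 < \sum_(j < k - 1) tau (tnth s j).
  rewrite (bigD1 i0)//= ltr_pwDl//; first by apply: (db_inv_gt0 TB); rewrite s0.
  by apply: sumr_ge0 => j _; exact: (db_inv_ge0 TB).
rewrite /kernel_df -/(interior_point s) sI (sum_pinverseE BA)//.
rewrite -mulr_suml /kernel_cdf; case: ifPn => yi.
  have y01' j : 0 < tnth y j <= 1.
    have -> : j = i by apply/val_inj; move: (ltn_ord i) (ltn_ord j) ld; clear; move=> /=; lia.
    by rewrite yi; case/andP: (y01 i).
  rewrite (sum_pinverseE BA)// -EFinD /ext0 -mulr_suml -mulrDl.
  have -> : \sum_(j < k - (k - 1)) tau (tnth y j) = tau (tnth y i).
    rewrite (bigD1 i)//= big1 ?addr0// => j /negP[]; apply/eqP.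
    by apply/val_inj; move: (ltn_ord i) (ltn_ord j) ld; clear; move=> /=; lia.
  rewrite !kernel_derivative_cond_copula//; last by rewrite ltr_wpDr// (db_inv_ge0 TB).
  rewrite -mulf_div divff ?mul1r// mulf_neq0 ?signr_eq0// expf_neq0// gt_eqF//.
rewrite (sum_pinverse_pinfty (i := i) BA)//.
  by rewrite addeC addye// /ext0 mul0r.
by apply/eqP; rewrite eq_le leNgt yi; case/andP: (y01 i).
Qed.

End conditional_model.

(** * Convergence of the conditional generators and their derivatives *)

Section cond_chain_cvg.
Context {R : realType}.
Variables (d l : nat) (psi_ phi_ : nat -> R -> R) (psi phi : R -> R) (x : l.-tuple R).
Hypothesis ld : (1 <= l <= d - 2)%N.
Hypothesis M_ : forall n, monotone_of_order d (psi_ n).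
Hypothesis M : monotone_of_order d psi.
Hypothesis psi_cvg : forall z, 0 < z -> psi_ n z @[n --> \oo] --> psi z.
Hypothesis phi_cvg : forall i, phi_ n (tnth x i) @[n --> \oo] --> phi (tnth x i).
Hypothesis shift_gt0 : 0 < cond_shift x phi.
Hypothesis sd_shift_gt0 : 0 < signed_derivative d psi l (cond_shift x phi).

Let d1 : (1 < d)%N. Proof. by move: ld; clear; lia. Qed.

Lemma signed_derivative_continuous j (z : R) : (j < d - 1)%N -> 0 < z ->
  {for z, continuous (signed_derivative d psi j)}.
Proof. by move=> jd; apply: slopes_continuous (signed_derivative_slopes d1 M jd). Qed.

(** Below the top order the limit derivatives are continuous, so the induction meets no exceptional
    points. *)
Lemma signed_derivative_cvg j (z : R) : (j < d - 1)%N -> 0 < z ->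
  signed_derivative d (psi_ n) j z @[n --> \oo] --> signed_derivative d psi j z.
Proof.
elim: j z => [|j IH] z jd z0.
  rewrite signed_derivativeE//; under eq_fun do rewrite signed_derivativeE// mul1r.
  by rewrite mul1r; exact: psi_cvg.
have jd' := ltnW jd.
apply: (slopes_moving_cvg (fun n => signed_derivative_slopes d1 (M_ n) jd')
  (signed_derivative_slopes d1 M jd') (fun z => IH z jd') z0).
  exact: cvg_cst.
exact: signed_derivative_continuous.
Qed.

Lemma signed_derivative_moving_cvg j (z_ : nat -> R) (z : R) : (0 < j <= d - 1)%N ->
  0 < z -> z_ n @[n --> \oo] --> z -> {for z, continuous (signed_derivative d psi j)} ->
  signed_derivative d (psi_ n) j (z_ n) @[n --> \oo] --> signed_derivative d psi j z.
Proof.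
case: j => // j jd z0.
exact: (slopes_moving_cvg (fun n => signed_derivative_slopes d1 (M_ n) jd)
  (signed_derivative_slopes d1 M jd) (fun z => @signed_derivative_cvg j z jd) z0).
Qed.

Lemma cond_shift_cvg : cond_shift x (phi_ n) @[n --> \oo] --> cond_shift x phi.
Proof. by apply: cvg_big => [|i _]; [exact: add_continuous|exact: phi_cvg]. Qed.

Lemma cond_chain_moving_cvg j (z_ : nat -> R) (z : R) : (j <= d - l - 1)%N -> 0 <= z ->
  z_ n @[n --> \oo] --> z -> {for z, continuous (cond_chain d x psi phi j)} ->
  cond_chain d x (psi_ n) (phi_ n) j (z_ n) @[n --> \oo] --> cond_chain d x psi phi j z.
Proof.
move=> jd z0 zz cz; set s := cond_shift x phi.
have l1 : (0 < l <= d - 1)%N by move: ld; clear; lia.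
apply: cvgM.
  apply: signed_derivative_moving_cvg.
  - by move: ld jd; clear; lia.
  - by rewrite ltr_wpDr.
  - by apply: cvgD => //; exact: cond_shift_cvg.
  (* Undoing the shift and the scaling transfers the assumed continuity at [z] to the derivative of
     [psi] at [s + z]. *)
  have -> : signed_derivative d psi (l + j) =
      (fun w => cond_chain d x psi phi j (w - s) * signed_derivative d psi l s).
    by apply/funext => w; rewrite /cond_chain -/s addrC subrK divfK// gt_eqF.
  have e : s + z - s = z by rewrite addrAC subrr add0r.
  have sc : {for s + z, continuous (fun w => w - s)}.
    by apply: cvgB; [exact: cvg_id|exact: cvg_cst].
  have cz' : {for s + z - s, continuous (cond_chain d x psi phi j)} by rewrite e.
  by apply: cvgMr_tmp; exact: (continuous_comp sc cz').
apply: cvgV; first by rewrite gt_eqF.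
apply: signed_derivative_moving_cvg => //; first exact: cond_shift_cvg.
by apply: signed_derivative_continuous => //; move: ld; clear; lia.
Qed.

End cond_chain_cvg.

Theorem corollary6p7 (R : realType) (d l : nat)
    (C_ : nat -> d.-tuple R -> R) (C : d.-tuple R -> R)
    (l_range : (1 <= l <= d - 2)%N)
    (Cn_arch : forall n, strict_archimedean (C_ n))
    (C_arch : strict_archimedean C)
    (C_cvg : {uniform cube d, C_ @ \oo --> C})
    (x : l.-tuple R) (x01 : forall i, 0 < tnth x i < 1) :
  weakly_conditional_cvg (d - l - 1) (fun n => cond_copula (C_ n) x)
    (cond_copula C x) /\
  (fun n => `|cond_zeta1 (C_ n) x - cond_zeta1 C x|) @ \oo --> 0.
Proof.
have d1 : (1 < d)%N by move: l_range; clear; lia.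
have k1 : (1 < d - l)%N by move: l_range; clear; lia.
have [_ [psi [HC S M]]] := C_arch.
have /choice [psi_ H_] : forall n, exists psi', [/\ has_generator (C_ n) psi',
    strict_generator psi' & monotone_of_order d psi'].
  by move=> n; have [_ [psi' H]] := Cn_arch n; exists psi'.
have HC_ n : has_generator (C_ n) (psi_ n) by case: (H_ n).
have S_ n : strict_generator (psi_ n) by case: (H_ n).
have M_ n : monotone_of_order d (psi_ n) by case: (H_ n).
pose phi := fine \o pinverse psi; pose phi_ n := fine \o pinverse (psi_ n).
have B : dec_bij psi phi := strict_generator_bij HC.1 S.
have B_ n : dec_bij (psi_ n) (phi_ n) := strict_generator_bij (HC_ n).1 (S_ n).
have CC u : cube d u -> C_ n u @[n --> \oo] --> C u.
  move=> uc; have : {uniform [set u], C_ @ \oo --> C}.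
    by apply: uniform_subset_cvg C_cvg => _ ->.
  by rewrite uniform_set1.
have psi_cvg z : 0 < z -> psi_ n z @[n --> \oo] --> psi z.
  by move/ltW; exact: (generator_cvg d1 HC_ HC B_ B CC).
have phi_cvg i : phi_ n (tnth x i) @[n --> \oo] --> phi (tnth x i).
  exact: (generator_inv_cvg d1 HC_ HC B_ B CC).
have [tau T] := cond_chain_bij l_range HC S M B x01.
have /choice [tau_ T_] n := cond_chain_bij l_range (HC_ n) (S_ n) (M_ n) (B_ n) x01.
have KM := cond_copula_model l_range HC S M B x01 T.
have KM_ n := cond_copula_model l_range (HC_ n) (S_ n) (M_ n) (B_ n) x01 (T_ n).
have s0 := cond_shift_gt0 l_range B x01.
have sd0 : 0 < signed_derivative d psi l (cond_shift x phi).
  have ld : (l <= d - 1)%N by move: l_range; clear; lia.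
  by have [h _] := signed_derivative_gt0_cvg0 d1 M HC.1 S ld; exact: h.
have F_cvg := cond_chain_moving_cvg l_range M_ M psi_cvg phi_cvg s0 sd0.
(* The order 0 case, whose limit is continuous on [[0, oo)], converges at every fixed point and can
   be inverted. *)
have tau_cvg u : 0 < u <= 1 -> tau_ n u @[n --> \oo] --> tau u.
  apply: (dec_bij_inv_cvg T_ T) => z z0.
  apply: F_cvg => //; first exact: cvg_cst.
  exact: (cond_chain0_continuous l_range HC S M B x01).
have Fm_cvg (z_ : nat -> R) (z : R) (z0 : 0 <= z) (zn0 : forall n, 0 <= z_ n) :=
  F_cvg _ z_ z (leqnn (d - l - 1)) z0.
split; first exact: (kernel_model_weakly_conditional_cvg k1 KM_ KM Fm_cvg tau_cvg).
have := zeta1_cvg k1 KM_ KM Fm_cvg tau_cvg.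
move=> /cvgrPdist_lt zc; apply/cvgrPdist_lt => e e0.
near=> n; rewrite sub0r normrN normr_id distrC.
by near: n; exact: zc.
Unshelve. all: by end_near. Qed.
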